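(* Let $(\Sigma,T)$ be a closed triangulated surface with vertex set $V=\{1,\dots,|V|\}$, edge set $E$ and triangle set $F$, and let $I\in\mathbb{R}^{|E|}$ be a weight with $I_{ij}\in[0,\infty)$ for every edge $ij\in E$. (Euclidean case) Let $\mathcal{R}_E\subset\mathbb{R}^{|V|}_{>0}$ be the open set of Euclidean-admissible radius vectors, and let $a:\mathcal{R}_E\to\mathbb{R}^{|V|}$ be the Euclidean cone-angle map. Then $a(cr)=a(r)$ for all $c>0$. Moreover, the restriction of $a$ to the normalized set $\{r\in\mathcal{R}_E:\prod_{i} r_i=1\}$ is a local diffeomorphism into the hyperplane $\{x\in\mathbb{R}^{|V|}:\sum_i x_i=\pi|F|\}$. Consequently, every $r\in\mathcal{R}_E$ has a neighborhood $U$ such that any $r'\in U$ with $a(r')=a(r)$ is a positive scalar multiple of $r$. That is, a Euclidean inversive distance circle packing is locally determined by its cone angles up to similarity. (Hyperbolic case) Let $\mathcal{R}_H\subset\mathbb{R}^{|V|}_{>0}$ be the open set of hyperbolic-admissible radius vectors, and let $a:\mathcal{R}_H\to\mathbb{R}^{|V|}$ be the hyperbolic cone-angle map. Then $a$ is a local diffeomorphism. In particular, it is locally injective, so a hyperbolic inversive distance circle packing is locally determined by its cone angles.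
   Context: Edge lengths. Given a radius vector $r=(r_1,\dots,r_{|V|})\in\mathbb{R}^{|V|}_{>0}$, assign to each edge $ij\in E$ a length $l_{ij}$. In Euclidean geometry, $$l_{ij}=\sqrt{r_i^2+r_j^2+2r_ir_jI_{ij}}.$$ In hyperbolic geometry, $l_{ij}>0$ is defined by $$\cosh l_{ij}=\cosh r_i\cosh r_j+I_{ij}\sinh r_i\sinh r_j.$$ These are the distances between the centers of two circles of radii $r_i,r_j$ whose inversive distance is $I_{ij}$. Admissible radius vectors. A radius vector $r$ is Euclidean-admissible (respectively hyperbolic-admissible) if, for every triangle $\triangle ijk\in F$, the three numbers $l_{ij},l_{jk},l_{ki}$ satisfy the strict triangle inequalities. Cone angles. For an admissible $r$, realize each triangle $\triangle ijk\in F$ as a Euclidean (respectively hyperbolic) triangle with side lengths $l_{ij},l_{jk},l_{ki}$. The cone angle $a_i(r)$ at a vertex $i$ is the sum of the inner angles at $i$ of all triangles of $F$ that contain $i$. *)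

(* Defs.v *)
From Stdlib Require Import Reals Lra Lia List Arith Relations.
Import ListNotations.
Open Scope R_scope.

(* Vectors in R^n are represented as functions nat -> R; only the      *)
(* coordinates 0..n-1 are meaningful. All sets/maps below only depend   *)
(* on these coordinates.                                                 *)

Definition eqn (n : nat) (x y : nat -> R) : Prop :=
  forall i, (i < n)%nat -> x i = y i.

Definition ball (n : nat) (x : nat -> R) (eps : R) (y : nat -> R) : Prop :=
  forall i, (i < n)%nat -> Rabs (y i - x i) < eps.

Definition open_n (n : nat) (U : (nat -> R) -> Prop) : Prop :=
  forall x, U x -> exists eps, 0 < eps /\ forall y, ball n x eps y -> U y.

Definition cont_on (n : nat) (U : (nat -> R) -> Prop) (h : (nat -> R) -> R) : Prop :=
  forall x, U x -> forall eps, 0 < eps ->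
    exists d, 0 < d /\ forall y, U y -> ball n x d y -> Rabs (h y - h x) < eps.

Definition upd (x : nat -> R) (i : nat) (t : R) : nat -> R :=
  fun j => if Nat.eqb j i then t else x j.

Fixpoint Ck (n k : nat) (U : (nat -> R) -> Prop) (h : (nat -> R) -> R) : Prop :=
  match k with
  | O => cont_on n U h
  | S k' => cont_on n U h /\
      forall i, (i < n)%nat -> exists dh : (nat -> R) -> R,
        (forall x, U x -> derivable_pt_lim (fun t => h (upd x i t)) (x i) (dh x))
        /\ Ck n k' U dh
  end.

Definition smooth_on (n : nat) (U : (nat -> R) -> Prop) (h : (nat -> R) -> R) : Prop :=
  forall k, Ck n k U h.

Definition smooth_map_on (n : nat) (U : (nat -> R) -> Prop)
  (f : (nat -> R) -> (nat -> R)) : Prop :=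
  forall i, (i < n)%nat -> smooth_on n U (fun x => f x i).

(* f, defined (and smooth) on the open domain D of R^n, restricts to a local
   diffeomorphism from the subset M of D into the subset N of R^n.
   When M, N are embedded submanifolds (here: open sets, or a level set
   intersected with an open set, and a hyperplane), "smooth" for the local
   inverse means: restriction of a smooth map on an open set of R^n. *)
Definition local_diffeo_between (n : nat) (D M N : (nat -> R) -> Prop)
  (f : (nat -> R) -> (nat -> R)) : Prop :=
  forall x, M x ->
    exists (U W : (nat -> R) -> Prop) (g : (nat -> R) -> (nat -> R)),
      open_n n U /\ U x /\ (forall y, U y -> D y) /\
      open_n n W /\ W (f x) /\
      smooth_map_on n U f /\ smooth_map_on n W g /\
      (forall y, U y -> M y -> W (f y) /\ N (f y) /\ eqn n (g (f y)) y) /\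
      (forall z, W z -> N z -> U (g z) /\ M (g z) /\ eqn n (f (g z)) z).

Fixpoint sumn (n : nat) (x : nat -> R) : R :=
  match n with O => 0 | S m => sumn m x + x m end.

Fixpoint prodn (n : nat) (x : nat -> R) : R :=
  match n with O => 1 | S m => prodn m x * x m end.

Definition scale (c : R) (r : nat -> R) : nat -> R := fun i => c * r i.

(* Triangulated closed surfaces.  Vertices are 0..n-1 (the paper's     *)
(* 1..|V| shifted by one); F is the list of triangles.                 *)

Definition tri := (nat * nat * nat)%type.

Definition in_tri (t : tri) (v : nat) : Prop :=
  let '(a, b, c) := t in v = a \/ v = b \/ v = c.

Definition in_trib (t : tri) (v : nat) : bool :=
  let '(a, b, c) := t in (Nat.eqb v a || Nat.eqb v b || Nat.eqb v c)%bool.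

Definition is_edge (F : list tri) (i j : nat) : Prop :=
  i <> j /\ exists t, In t F /\ in_tri t i /\ in_tri t j.

Definition link_adj (F : list tri) (v u w : nat) : Prop :=
  exists t, In t F /\ in_tri t v /\ in_tri t u /\ in_tri t w /\
            v <> u /\ v <> w /\ u <> w.

Definition closed_tri_surface (n : nat) (F : list tri) : Prop :=
  (forall a b c, In (a, b, c) F ->
     (a < n)%nat /\ (b < n)%nat /\ (c < n)%nat /\ a <> b /\ b <> c /\ a <> c) /\
  (forall k1 k2 t0, (k1 < length F)%nat -> (k2 < length F)%nat ->
     (forall v, in_tri (nth k1 F t0) v <-> in_tri (nth k2 F t0) v) -> k1 = k2) /\
  (forall v, (v < n)%nat -> exists t, In t F /\ in_tri t v) /\
  (forall i j, is_edge F i j ->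
     length (filter (fun t => (in_trib t i && in_trib t j)%bool) F) = 2%nat) /\
  (* the link of every vertex is connected (hence a single circle) *)
  (forall v u w, is_edge F v u -> is_edge F v w ->
     clos_refl_trans nat (link_adj F v) u w) /\
  (forall i j, (i < n)%nat -> (j < n)%nat ->
     clos_refl_trans nat (is_edge F) i j).

Definition lenE (I : nat -> nat -> R) (r : nat -> R) (i j : nat) : R :=
  sqrt (r i ^ 2 + r j ^ 2 + 2 * r i * r j * I i j).

Definition arcosh (x : R) : R := ln (x + sqrt (x ^ 2 - 1)).

Definition lenH (I : nat -> nat -> R) (r : nat -> R) (i j : nat) : R :=
  arcosh (cosh (r i) * cosh (r j) + I i j * sinh (r i) * sinh (r j)).

Definition admissible (n : nat) (F : list tri) (len : nat -> nat -> R)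
  (r : nat -> R) : Prop :=
  (forall i, (i < n)%nat -> 0 < r i) /\
  (forall a b c, In (a, b, c) F ->
     len a b < len b c + len c a /\
     len b c < len c a + len a b /\
     len c a < len a b + len b c).

Definition admE (n : nat) (F : list tri) (I : nat -> nat -> R) (r : nat -> R) :=
  admissible n F (lenE I r) r.

Definition admH (n : nat) (F : list tri) (I : nat -> nat -> R) (r : nat -> R) :=
  admissible n F (lenH I r) r.

Definition angE (x y z : R) : R := acos ((x ^ 2 + y ^ 2 - z ^ 2) / (2 * x * y)).
Definition angH (x y z : R) : R :=
  acos ((cosh x * cosh y - cosh z) / (sinh x * sinh y)).

Definition angle_at (ang : R -> R -> R -> R) (len : nat -> nat -> R)
  (t : tri) (i : nat) : R :=
  let '(a, b, c) := t in
  if Nat.eqb i a then ang (len a b) (len a c) (len b c)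
  else if Nat.eqb i b then ang (len b a) (len b c) (len a c)
  else if Nat.eqb i c then ang (len c a) (len c b) (len a b)
  else 0.

Definition cone_angle (F : list tri) (ang : R -> R -> R -> R)
  (len : nat -> nat -> R) (i : nat) : R :=
  fold_right (fun t s => angle_at ang len t i + s) 0 F.

Definition coneE (F : list tri) (I : nat -> nat -> R) (r : nat -> R) : nat -> R :=
  fun i => cone_angle F angE (lenE I r) i.

Definition coneH (F : list tri) (I : nat -> nat -> R) (r : nat -> R) : nat -> R :=
  fun i => cone_angle F angH (lenH I r) i.

(* Main.v *)
Require Import Defs.
From Stdlib Require Import Reals List.
From Stdlib Require Import Lra Lia Psatz Arith Relations.
From Stdlib Require Import FunctionalExtensionality IndefiniteDescription.
Open Scope R_scope.

(** In the parameter u with du = dr / r (Euclidean) or du = dr / sinh r (hyperbolic), the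
    derivative of the angles of a single triangle is a symmetric matrix. Its off-diagonal
    entries have the signs of the distances from the radical centre to the sides, at most one
    of which can be nonpositive when the inversive distances are nonnegative. Together with
    the signs of the determinant and of one principal minor this makes the matrix negative
    definite (hyperbolic case), or negative semidefinite with kernel spanned by (1,1,1)
    (Euclidean case). Summing over the triangles, the Jacobian of the cone angles is negative definite,
    in the Euclidean case after subtracting the sum of the logarithms of the radii from every
    cone angle, and the inverse function theorem applies. *)

(** * Finite sums and C^k functions of several variables *)

(** An inversive distance above 1 can push the radical centre beyond a side. However, two sides with
    good signs always remain, and they share a vertex. With that vertex numbered 3, the third
    diagonal entry is positive. The variation matrix is the product of the derivative of the angles
    in the sides and the derivative of the sides in the radii, hence closed forms for its
    determinant and minors. One of the two 2 by 2 minors containing index 3 is visibly positive, and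
    the determinant forces the other to be so.

    The Jacobian in r itself is not symmetric. Multiplying its column j by [rad] of the j-th radius
    passes to the parameter u, and the inverse matrix is recovered by the same scaling. The
    subtracted logarithms add the square of the sum of the v_i to the quadratic form, which is
    positive on the kernel left by a connected surface.

    The inverse function theorem receives the inverse Jacobian as a matrix of smooth functions on
    the whole domain, built by elimination. The derivative of the local inverse is then an explicit
    composite, and smoothness follows by bootstrapping. *)

Lemma sumn_ext n f g : (forall i, (i < n)%nat -> f i = g i) -> sumn n f = sumn n g.
Proof.
  induction n as [|n IH]; intros H; simpl; [reflexivity|].
  rewrite IH by (intros; apply H; lia). rewrite H by lia. reflexivity.
Qed.

Lemma sumn_plus n f g : sumn n (fun i => f i + g i) = sumn n f + sumn n g.
Proof. induction n as [|n IH]; simpl; [ring|rewrite IH; ring]. Qed.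

Lemma sumn_scal n c f : sumn n (fun i => c * f i) = c * sumn n f.
Proof. induction n as [|n IH]; simpl; [ring|rewrite IH; ring]. Qed.

Lemma sumn_zero n : sumn n (fun _ => 0) = 0.
Proof. induction n as [|n IH]; simpl; [ring|rewrite IH; ring]. Qed.

Lemma sumn_const n c : sumn n (fun _ => c) = INR n * c.
Proof. induction n as [|n IH]; [simpl; ring|]. rewrite S_INR; simpl; rewrite IH; ring. Qed.

Lemma sumn_minus n f g : sumn n (fun i => f i - g i) = sumn n f - sumn n g.
Proof. induction n as [|n IH]; simpl; [ring|rewrite IH; ring]. Qed.

Lemma sumn_swap n m f :
  sumn n (fun i => sumn m (fun j => f i j)) = sumn m (fun j => sumn n (fun i => f i j)).
Proof.
  induction n as [|n IH]; simpl.
  - symmetry; apply sumn_zero.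
  - rewrite IH, <- sumn_plus. reflexivity.
Qed.

Lemma sumn_le n f g : (forall i, (i < n)%nat -> f i <= g i) -> sumn n f <= sumn n g.
Proof.
  induction n as [|n IH]; intros H; simpl; [lra|].
  apply Rplus_le_compat; [apply IH; intros; apply H; lia | apply H; lia].
Qed.

Lemma sumn_abs n f : Rabs (sumn n f) <= sumn n (fun i => Rabs (f i)).
Proof.
  induction n as [|n IH]; simpl; [rewrite Rabs_R0; lra|].
  eapply Rle_trans; [apply Rabs_triang|]. lra.
Qed.

Lemma sumn_nonneg n f : (forall i, (i < n)%nat -> 0 <= f i) -> 0 <= sumn n f.
Proof. intros H. rewrite <- (sumn_zero n). now apply sumn_le. Qed.

Lemma sumn_term_le n f k :
  (forall i, (i < n)%nat -> 0 <= f i) -> (k < n)%nat -> f k <= sumn n f.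
Proof.
  induction n as [|n IH]; intros H Hk; [lia|]; simpl.
  pose proof (H n ltac:(lia)).
  assert (0 <= sumn n f) by (apply sumn_nonneg; intros; apply H; lia).
  destruct (Nat.eq_dec k n) as [->|]; [lra|].
  assert (f k <= sumn n f) by (apply IH; [intros; apply H|]; lia). lra.
Qed.

Lemma sumn_single n f k :
  (k < n)%nat -> (forall i, (i < n)%nat -> i <> k -> f i = 0) -> sumn n f = f k.
Proof.
  induction n as [|n IH]; intros Hk H; [lia|]; simpl.
  destruct (Nat.eq_dec k n) as [->|].
  - rewrite (sumn_ext n f (fun _ => 0)) by (intros; apply H; lia). rewrite sumn_zero; ring.
  - rewrite IH by (try lia; intros; apply H; lia). rewrite (H n) by lia. ring.
Qed.

Definition kron (i j : nat) : R := if Nat.eqb i j then 1 else 0.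

Lemma kron_refl i : kron i i = 1.
Proof. unfold kron. now rewrite Nat.eqb_refl. Qed.

Lemma kron_neq i j : i <> j -> kron i j = 0.
Proof. unfold kron. intros H. apply Nat.eqb_neq in H. now rewrite H. Qed.

Lemma sumn_kron_l n k f : (k < n)%nat -> sumn n (fun i => kron k i * f i) = f k.
Proof.
  intros Hk. rewrite (sumn_single n _ k Hk).
  - rewrite kron_refl; ring.
  - intros i _ Hi. rewrite kron_neq by auto. ring.
Qed.

Lemma sumn_kron_r n k f : (k < n)%nat -> sumn n (fun i => f i * kron i k) = f k.
Proof.
  intros Hk. rewrite (sumn_single n _ k Hk).
  - rewrite kron_refl; ring.
  - intros i _ Hi. rewrite kron_neq by auto. ring.
Qed.

(** Every epsilon-delta argument over finitely many coordinates goes through this lemma. Stability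
    of [Q] under shrinking lets the radii be merged one by one with [Rmin]. *)
Lemma uniform_radius (n : nat) (Q : nat -> R -> Prop) :
  (forall i d d', Q i d -> 0 < d' <= d -> Q i d') ->
  (forall i, (i < n)%nat -> exists d, 0 < d /\ Q i d) ->
  exists d, 0 < d /\ forall i, (i < n)%nat -> Q i d.
Proof.
  intros Hmon. induction n as [|n IH]; intros H.
  - exists 1. split; [lra|]. intros; lia.
  - destruct IH as [d1 [Hd1 H1]]; [intros; apply H; lia|].
    destruct (H n ltac:(lia)) as [d2 [Hd2 H2]].
    assert (0 < Rmin d1 d2) by now apply Rmin_pos.
    exists (Rmin d1 d2). split; auto. intros i Hi.
    destruct (Nat.eq_dec i n) as [->|].
    + apply Hmon with d2; auto. split; auto. apply Rmin_r.
    + apply Hmon with d1; [apply H1; lia|]. split; auto. apply Rmin_l.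
Qed.

(** * Coordinate updates, boxes and open sets *)

Lemma upd_same x i t : upd x i t i = t.
Proof. unfold upd. now rewrite Nat.eqb_refl. Qed.

Lemma upd_other x i j t : j <> i -> upd x i t j = x j.
Proof. unfold upd. intros H. apply Nat.eqb_neq in H. now rewrite H. Qed.

Lemma upd_id x i : upd x i (x i) = x.
Proof.
  extensionality j. unfold upd. destruct (Nat.eqb_spec j i); now subst.
Qed.

Lemma upd_upd x i s t : upd (upd x i s) i t = upd x i t.
Proof. extensionality j. unfold upd. now destruct (Nat.eqb j i). Qed.

Lemma ball_refl n x e : 0 < e -> ball n x e x.
Proof. intros He i _. now rewrite Rminus_diag, Rabs_R0. Qed.

Lemma ball_le n x d e y : d <= e -> ball n x d y -> ball n x e y.
Proof. intros Hde H i Hi. specialize (H i Hi). lra. Qed.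

Lemma ball_upd n x i d t : Rabs (t - x i) < d -> ball n x d (upd x i t).
Proof.
  intros Ht j _. destruct (Nat.eq_dec j i) as [->|Hj].
  - now rewrite upd_same.
  - rewrite upd_other by auto. rewrite Rminus_diag, Rabs_R0.
    pose proof (Rabs_pos (t - x i)). lra.
Qed.

Lemma ball_eqn n x y e : 0 < e -> eqn n x y -> ball n x e y.
Proof. intros He H i Hi. rewrite (H i Hi), Rminus_diag, Rabs_R0. auto. Qed.

Lemma open_upd n U x i :
  open_n n U -> U x -> exists d, 0 < d /\ forall t, Rabs (t - x i) < d -> U (upd x i t).
Proof.
  intros HU Hx. destruct (HU x Hx) as [d [Hd H]]. exists d. split; auto.
  intros t Ht. apply H. now apply ball_upd.
Qed.

Lemma open_and n U V : open_n n U -> open_n n V -> open_n n (fun x => U x /\ V x).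
Proof.
  intros HU HV x [H1 H2].
  destruct (HU x H1) as [d1 [Hd1 HU1]]. destruct (HV x H2) as [d2 [Hd2 HV2]].
  exists (Rmin d1 d2). split; [now apply Rmin_pos|]. intros y Hy. split.
  - apply HU1. eapply ball_le; [apply Rmin_l|exact Hy].
  - apply HV2. eapply ball_le; [apply Rmin_r|exact Hy].
Qed.

Lemma open_ball n x e : open_n n (ball n x e).
Proof.
  intros y Hy.
  destruct (uniform_radius n (fun i d => forall t, Rabs (t - y i) < d -> Rabs (t - x i) < e))
    as [d [Hd H]].
  - intros i d d' HQ [_ Hd'] t Ht. apply HQ. lra.
  - intros i Hi. specialize (Hy i Hi). exists (e - Rabs (y i - x i)). split; [lra|].
    intros t Ht. replace (t - x i) with ((t - y i) + (y i - x i)) by ring.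
    eapply Rle_lt_trans; [apply Rabs_triang|]. lra.
  - exists d. split; auto. intros z Hz i Hi. apply H; auto.
Qed.

Lemma open_preimage n U m V (g : nat -> (nat -> R) -> R) :
  open_n n U -> open_n m V -> (forall i, (i < m)%nat -> cont_on n U (g i)) ->
  open_n n (fun x => U x /\ V (fun i => g i x)).
Proof.
  intros HU HV Hg x [Hx HVx]. destruct (HV _ HVx) as [e [He HVe]].
  destruct (HU x Hx) as [d0 [Hd0 HU0]].
  destruct (uniform_radius m (fun i d => forall y, U y -> ball n x d y -> Rabs (g i y - g i x) < e))
    as [d [Hd H]].
  - intros i d d' HQ [_ Hd'] y Uy Hy. apply HQ; auto. now apply ball_le with d'.
  - intros i Hi. destruct (Hg i Hi x Hx e He) as [d [Hd H]]. exists d; auto.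
  - exists (Rmin d0 d). split; [now apply Rmin_pos|]. intros y Hy.
    assert (Uy : U y) by (apply HU0; eapply ball_le; [apply Rmin_l|exact Hy]).
    split; auto. apply HVe. intros i Hi. apply H; auto.
    eapply ball_le; [apply Rmin_r|exact Hy].
Qed.


Lemma Rabs_lt_all_eq a b : (forall e, 0 < e -> Rabs (a - b) < e) -> a = b.
Proof.
  intros H. apply Rminus_diag_uniq. destruct (Req_dec (a - b) 0) as [|Hn]; auto.
  specialize (H (Rabs (a - b)) (Rabs_pos_lt _ Hn)). lra.
Qed.

(** Boxes see only the coordinates below n, so y lies in every box around x. Continuity is thus what
    makes a function ignore the meaningless coordinates of a vector. *)
Lemma cont_on_eqn n U h x y : cont_on n U h -> U x -> U y -> eqn n x y -> h y = h x.
Proof.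
  intros Hc Hx Hy He. apply Rabs_lt_all_eq. intros e Hpos.
  destruct (Hc x Hx e Hpos) as [d [Hd H]]. apply H; auto. now apply ball_eqn.
Qed.

Lemma derivable_pt_lim_local f g x l d :
  0 < d -> (forall t, Rabs (t - x) < d -> f t = g t) ->
  derivable_pt_lim f x l -> derivable_pt_lim g x l.
Proof.
  intros Hd Hfg Hf e He. destruct (Hf e He) as [d1 H1].
  assert (Hp : 0 < Rmin d1 d) by (apply Rmin_pos; [apply cond_pos|auto]).
  exists (mkposreal _ Hp). intros h Hh0 Hh. simpl in Hh.
  rewrite <- !Hfg.
  - apply H1; auto. eapply Rlt_le_trans; [exact Hh|apply Rmin_l].
  - rewrite Rminus_diag, Rabs_R0; auto.
  - replace (x + h - x) with h by ring. eapply Rlt_le_trans; [exact Hh|apply Rmin_r].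
Qed.

(** * Algebra of continuous and C^k functions *)

Lemma cont_on_ext n U h h' :
  (forall x, U x -> h x = h' x) -> cont_on n U h -> cont_on n U h'.
Proof.
  intros He Hc x Hx e Hpos. destruct (Hc x Hx e Hpos) as [d [Hd H]].
  exists d. split; auto. intros y Hy Hb. rewrite <- !He; auto.
Qed.

Lemma cont_on_sub n U U' h : (forall x, U' x -> U x) -> cont_on n U h -> cont_on n U' h.
Proof.
  intros Hs Hc x Hx e He. destruct (Hc x (Hs x Hx) e He) as [d [Hd H]]. exists d; auto.
Qed.

Lemma Ck_cont n k U h : Ck n k U h -> cont_on n U h.
Proof. destruct k; simpl; tauto. Qed.

(** Openness of U is needed to transfer derivatives: equality must hold on a whole segment of the
    coordinate line through x. *)
Lemma Ck_ext n k U h h' :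
  open_n n U -> (forall x, U x -> h x = h' x) -> Ck n k U h -> Ck n k U h'.
Proof.
  intros HU. destruct k as [|k]; simpl; intros He.
  - now apply cont_on_ext.
  - intros [Hc Hd]. split; [now apply cont_on_ext with h|].
    intros i Hi. destruct (Hd i Hi) as [dh [Hdh Hk]]. exists dh. split; auto.
    intros x Hx. destruct (open_upd n U x i HU Hx) as [d [Hdp Hu]].
    apply derivable_pt_lim_local with (fun t => h (upd x i t)) d; auto.
Qed.

Lemma Ck_sub n k U U' h : (forall x, U' x -> U x) -> Ck n k U h -> Ck n k U' h.
Proof.
  intros Hs. revert h. induction k as [|k IH]; simpl; intros h.
  - now apply cont_on_sub.
  - intros [Hc Hd]. split; [now apply cont_on_sub with U|].
    intros i Hi. destruct (Hd i Hi) as [dh [Hdh Hk]]. exists dh. split; auto.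
Qed.

Lemma Ck_pred n k U h : Ck n (S k) U h -> Ck n k U h.
Proof.
  revert h. induction k as [|k IH]; intros h H.
  - now apply Ck_cont in H.
  - destruct H as [Hc Hd]. split; auto. intros i Hi.
    destruct (Hd i Hi) as [dh [Hdh Hk]]. exists dh. split; auto.
Qed.

(** [Ck] only asserts that some partial derivative is C^k. Uniqueness of limits passes this to any
    function known to be the partial derivative on U. *)
Lemma Ck_partial n k U h i dh :
  open_n n U -> Ck n (S k) U h -> (i < n)%nat ->
  (forall x, U x -> derivable_pt_lim (fun t => h (upd x i t)) (x i) (dh x)) ->
  Ck n k U dh.
Proof.
  intros HU [_ Hd] Hi Hdh. destruct (Hd i Hi) as [dh' [Hdh' Hk]].
  apply Ck_ext with dh'; auto. intros x Hx.
  apply (uniqueness_limite (fun t => h (upd x i t)) (x i)); auto.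
Qed.

Lemma cont_on_const n U c : cont_on n U (fun _ => c).
Proof.
  intros x _ e He. exists 1. split; [lra|]. intros. now rewrite Rminus_diag, Rabs_R0.
Qed.

Lemma Ck_const n k U c : Ck n k U (fun _ => c).
Proof.
  revert c. induction k as [|k IH]; intros c; simpl; [apply cont_on_const|].
  split; [apply cont_on_const|]. intros i _. exists (fun _ => 0). split; auto.
  intros. apply derivable_pt_lim_const.
Qed.

Lemma Ck_proj n k U i : (i < n)%nat -> Ck n k U (fun x => x i).
Proof.
  intros Hi.
  assert (Hc : cont_on n U (fun x => x i)) by (intros x _ e He; exists e; auto).
  destruct k as [|k]; simpl; auto. split; auto. intros j Hj.
  exists (fun _ => kron i j). split; [|apply Ck_const]. intros x _.
  destruct (Nat.eq_dec i j) as [->|Hn].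
  - rewrite kron_refl. apply derivable_pt_lim_local with id 1; [lra| |apply derivable_pt_lim_id].
    intros; now rewrite upd_same.
  - rewrite kron_neq by auto. apply derivable_pt_lim_local with (fun _ => x i) 1;
      [lra| |apply derivable_pt_lim_const].
    intros; now rewrite upd_other.
Qed.

Lemma cont_on_plus n U f g :
  cont_on n U f -> cont_on n U g -> cont_on n U (fun x => f x + g x).
Proof.
  intros Hf Hg x Hx e He.
  destruct (Hf x Hx (e/2) ltac:(lra)) as [d1 [Hd1 H1]].
  destruct (Hg x Hx (e/2) ltac:(lra)) as [d2 [Hd2 H2]].
  exists (Rmin d1 d2). split; [now apply Rmin_pos|]. intros y Hy Hb.
  assert (A := H1 y Hy (ball_le _ _ _ _ _ (Rmin_l d1 d2) Hb)).
  assert (B := H2 y Hy (ball_le _ _ _ _ _ (Rmin_r d1 d2) Hb)).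
  replace (f y + g y - (f x + g x)) with ((f y - f x) + (g y - g x)) by ring.
  eapply Rle_lt_trans; [apply Rabs_triang|]. lra.
Qed.

Lemma cont_on_mult n U f g :
  cont_on n U f -> cont_on n U g -> cont_on n U (fun x => f x * g x).
Proof.
  intros Hf Hg x Hx e He.
  (* The product of the two increments is at most e' because e' <= 1, so the total error is at most
     e' times (|f x| + |g x| + 1). The summand 2 in K makes the final inequality strict. *)
  set (K := Rabs (f x) + Rabs (g x) + 2).
  assert (HK : 2 <= K) by (unfold K; pose proof (Rabs_pos (f x)); pose proof (Rabs_pos (g x)); lra).
  set (e' := Rmin 1 (e / K)).
  assert (He' : 0 < e') by (apply Rmin_pos; [lra|apply Rdiv_lt_0_compat; lra]).
  destruct (Hf x Hx e' He') as [d1 [Hd1 H1]].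
  destruct (Hg x Hx e' He') as [d2 [Hd2 H2]].
  exists (Rmin d1 d2). split; [now apply Rmin_pos|]. intros y Hy Hb.
  assert (A := H1 y Hy (ball_le _ _ _ _ _ (Rmin_l d1 d2) Hb)).
  assert (B := H2 y Hy (ball_le _ _ _ _ _ (Rmin_r d1 d2) Hb)).
  replace (f y * g y - f x * g x) with
    ((f y - f x) * (g y - g x) + ((f y - f x) * g x + f x * (g y - g x))) by ring.
  assert (E1 : e' <= 1) by apply Rmin_l.
  assert (E2 : e' * K <= e).
  { replace e with (e / K * K) by (field; lra).
    apply Rmult_le_compat_r; [lra|apply Rmin_r]. }
  eapply Rle_lt_trans; [apply Rabs_triang|].
  eapply Rle_lt_trans; [apply Rplus_le_compat_l, Rabs_triang|].
  rewrite !Rabs_mult.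
  pose proof (Rabs_pos (f x)); pose proof (Rabs_pos (g x)).
  pose proof (Rabs_pos (f y - f x)); pose proof (Rabs_pos (g y - g x)).
  assert (Rabs (f y - f x) * Rabs (g y - g x) <= e' * 1) by (apply Rmult_le_compat; lra).
  assert (Rabs (f y - f x) * Rabs (g x) <= e' * Rabs (g x)) by (apply Rmult_le_compat_r; lra).
  assert (Rabs (f x) * Rabs (g y - g x) <= Rabs (f x) * e') by (apply Rmult_le_compat_l; lra).
  assert (e' * K = e' * Rabs (f x) + e' * Rabs (g x) + 2 * e') by (unfold K; ring).
  lra.
Qed.

Lemma Ck_plus n k U f g : Ck n k U f -> Ck n k U g -> Ck n k U (fun x => f x + g x).
Proof.
  revert f g. induction k as [|k IH]; intros f g.
  - apply cont_on_plus.
  - intros [Cf Df] [Cg Dg]. split; [now apply cont_on_plus|]. intros i Hi.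
    destruct (Df i Hi) as [df [Hf Kf]]. destruct (Dg i Hi) as [dg [Hg Kg]].
    exists (fun x => df x + dg x). split; auto. intros x Hx.
    apply (derivable_pt_lim_plus (fun t => f (upd x i t)) (fun t => g (upd x i t))); auto.
Qed.

Lemma Ck_mult n k U f g : Ck n k U f -> Ck n k U g -> Ck n k U (fun x => f x * g x).
Proof.
  revert f g. induction k as [|k IH]; intros f g.
  - apply cont_on_mult.
  (* The product rule keeps one factor undifferentiated, so both factors are also needed at the
     lower order k. *)
  - intros Hf0 Hg0. pose proof (Ck_pred _ _ _ _ Hf0). pose proof (Ck_pred _ _ _ _ Hg0).
    destruct Hf0 as [Cf Df]. destruct Hg0 as [Cg Dg].
    split; [now apply cont_on_mult|]. intros i Hi.
    destruct (Df i Hi) as [df [Hf Kf]]. destruct (Dg i Hi) as [dg [Hg Kg]].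
    exists (fun x => df x * g x + f x * dg x). split.
    + intros x Hx.
      pose proof (derivable_pt_lim_mult (fun t => f (upd x i t)) (fun t => g (upd x i t))
                    (x i) (df x) (dg x) (Hf x Hx) (Hg x Hx)) as P.
      simpl in P. rewrite !upd_id in P. exact P.
    + apply Ck_plus; apply IH; auto.
Qed.

Lemma Ck_sumn n k U m (f : nat -> (nat -> R) -> R) :
  (forall i, (i < m)%nat -> Ck n k U (f i)) -> Ck n k U (fun x => sumn m (fun i => f i x)).
Proof.
  induction m as [|m IH]; intros H; simpl; [apply Ck_const|].
  apply (Ck_plus n k U (fun x => sumn m (fun i => f i x)) (f m)); [apply IH; intros|]; apply H; lia.
Qed.

(* Increments are split along the path x = w_0, w_1, ..., w_n = y that changes one
   coordinate at a time; it stays in the box spanned by x and y. *)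
Lemma increment_bound n U h (dh : nat -> (nat -> R) -> R) x y c e :
  cont_on n U h ->
  (forall j w, (j < n)%nat -> U w -> derivable_pt_lim (fun t => h (upd w j t)) (w j) (dh j w)) ->
  (forall w, (forall i, (i < n)%nat -> Rmin (x i) (y i) <= w i <= Rmax (x i) (y i)) ->
     U w /\ forall j, (j < n)%nat -> Rabs (dh j w - c j) <= e) ->
  Rabs (h y - h x - sumn n (fun j => c j * (y j - x j))) <= e * sumn n (fun j => Rabs (y j - x j)).
Proof.
  intros Hc Hd Hbox.
  set (path := fun (k : nat) (i : nat) => if (i <? k)%nat then y i else x i).
  assert (Hpath : forall k t i, (i < n)%nat -> (k < n)%nat ->
     Rmin (x k) (y k) <= t <= Rmax (x k) (y k) ->
     Rmin (x i) (y i) <= upd (path k) k t i <= Rmax (x i) (y i)).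
  { intros k t i Hi Hk Ht. destruct (Nat.eq_dec i k) as [->|Hn].
    - now rewrite upd_same.
    - rewrite upd_other by auto. unfold path. destruct (i <? k)%nat; split;
        auto using Rmin_l, Rmin_r, Rmax_l, Rmax_r. }
  assert (Hstep : forall k, (k < n)%nat ->
     Rabs (h (path (S k)) - h (path k) - c k * (y k - x k)) <= e * Rabs (y k - x k)).
  { intros k Hk.
    assert (E1 : path (S k) = upd (path k) k (y k)).
    { extensionality i. unfold upd, path.
      destruct (Nat.eqb_spec i k) as [->|]; [now rewrite (proj2 (Nat.ltb_lt k (S k))) by lia|].
      destruct (Nat.ltb_spec i (S k)), (Nat.ltb_spec i k); auto; lia. }
    assert (E0 : path k = upd (path k) k (x k)).
    { extensionality i. unfold upd, path.
      destruct (Nat.eqb_spec i k) as [->|]; auto. now rewrite Nat.ltb_irrefl. }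
    rewrite E1. rewrite E0 at 2.
    assert (Hin : forall t, Rmin (x k) (y k) <= t <= Rmax (x k) (y k) ->
       U (upd (path k) k t) /\ forall j, (j < n)%nat -> Rabs (dh j (upd (path k) k t) - c j) <= e)
      by (intros t Ht; apply Hbox; auto).
    set (w := path k) in *. clearbody w.
    assert (Hder : forall t, Rmin (x k) (y k) <= t <= Rmax (x k) (y k) ->
       derivable_pt_lim (fun s => h (upd w k s)) t (dh k (upd w k t))).
    { intros t Ht. destruct (Hin t Ht) as [HUt _].
      specialize (Hd k (upd w k t) Hk HUt). rewrite upd_same in Hd.
      replace (fun s => h (upd w k s)) with (fun s => h (upd (upd w k t) k s)); auto.
      extensionality s. now rewrite upd_upd. }
    assert (Hex : exists t, Rmin (x k) (y k) <= t <= Rmax (x k) (y k) /\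
       h (upd w k (y k)) - h (upd w k (x k)) = dh k (upd w k t) * (y k - x k)).
    { destruct (Rtotal_order (x k) (y k)) as [Hlt|[Heq|Hgt]].
      - rewrite Rmin_left, Rmax_right in * by lra.
        destruct (MVT_cor2 _ (fun t => dh k (upd w k t)) _ _ Hlt Hder) as [t [Ht Hbt]].
        exists t. split; [lra|exact Ht].
      - exists (x k). rewrite Heq. rewrite Rmin_left, Rmax_left by lra. split; [lra|ring].
      - rewrite Rmin_right, Rmax_left in * by lra.
        destruct (MVT_cor2 _ (fun t => dh k (upd w k t)) _ _ Hgt Hder) as [t [Ht Hbt]].
        exists t. split; [lra|]. lra. }
    destruct Hex as [t [Ht Heq]]. rewrite Heq.
    replace (dh k (upd w k t) * (y k - x k) - c k * (y k - x k))
      with ((dh k (upd w k t) - c k) * (y k - x k)) by ring.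
    rewrite Rabs_mult. apply Rmult_le_compat_r; [apply Rabs_pos|].
    now apply Hin. }
  assert (Hind : forall k, (k <= n)%nat ->
     Rabs (h (path k) - h x - sumn k (fun j => c j * (y j - x j)))
       <= e * sumn k (fun j => Rabs (y j - x j))).
  { induction k as [|k IH]; intros Hk.
    - simpl. change (path 0%nat) with x. rewrite Rminus_diag, Rminus_0_r, Rabs_R0. lra.
    - simpl. specialize (IH ltac:(lia)). specialize (Hstep k ltac:(lia)).
      replace (h (path (S k)) - h x - (sumn k (fun j => c j * (y j - x j)) + c k * (y k - x k)))
        with ((h (path k) - h x - sumn k (fun j => c j * (y j - x j)))
              + (h (path (S k)) - h (path k) - c k * (y k - x k))) by ring.
      eapply Rle_trans; [apply Rabs_triang|]. lra. }
  specialize (Hind n (le_n n)).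
  assert (Hmm : forall i, Rmin (x i) (y i) <= y i <= Rmax (x i) (y i))
    by (intros; split; [apply Rmin_r|apply Rmax_r]).
  assert (Hpn : forall i, (i < n)%nat -> path n i = y i).
  { intros i Hi. unfold path. now rewrite (proj2 (Nat.ltb_lt i n)). }
  assert (Hy : U y) by (apply Hbox; auto).
  assert (Hpy : U (path n)) by (apply Hbox; intros i Hi; rewrite Hpn; auto).
  rewrite (cont_on_eqn n U h (path n) y Hc Hpy Hy Hpn). exact Hind.
Qed.

(** * Total differentiability and the chain rule *)

Lemma between_close (a b t d : R) :
  Rmin a b <= t <= Rmax a b -> Rabs (b - a) < d -> Rabs (t - a) < d.
Proof.
  intros Ht Hd. apply Rabs_def2 in Hd. apply Rabs_def1;
  unfold Rmin, Rmax in Ht; destruct (Rle_dec a b); lra.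
Qed.

(** On a small box all partial derivatives are within e of their values at x, and the box between x
    and y stays inside it. [increment_bound] then gives the linear approximation, with error
    measured in the l^1 norm. *)
Lemma differentiable n U h (dh : nat -> (nat -> R) -> R) x :
  open_n n U -> cont_on n U h -> U x ->
  (forall j w, (j < n)%nat -> U w -> derivable_pt_lim (fun t => h (upd w j t)) (w j) (dh j w)) ->
  (forall j, (j < n)%nat -> cont_on n U (dh j)) ->
  forall e, 0 < e -> exists d, 0 < d /\ forall y, ball n x d y -> U y /\
    Rabs (h y - h x - sumn n (fun j => dh j x * (y j - x j)))
      <= e * sumn n (fun j => Rabs (y j - x j)).
Proof.
  intros HU Hc Hx Hd Hcd e He.
  destruct (HU x Hx) as [d0 [Hd0 HU0]].
  destruct (uniform_radius n (fun j d => forall w, U w -> ball n x d w -> Rabs (dh j w - dh j x) < e))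
    as [d1 [Hd1 H1]].
  - intros i d d' HQ [_ Hd'] w Uw Hw. apply HQ; auto. now apply ball_le with d'.
  - intros j Hj. destruct (Hcd j Hj x Hx e He) as [d [Hdp H]]. exists d; auto.
  - exists (Rmin d0 d1). split; [now apply Rmin_pos|]. intros y Hy.
    split; [apply HU0; eapply ball_le; [apply Rmin_l|exact Hy]|].
    apply increment_bound with U dh; auto.
    intros w Hw.
    assert (Hbw : ball n x (Rmin d0 d1) w)
      by (intros i Hi; apply between_close with (y i); auto).
    assert (Uw : U w) by (apply HU0; eapply ball_le; [apply Rmin_l|exact Hbw]).
    split; auto. intros j Hj. left. apply H1; auto.
    eapply ball_le; [apply Rmin_r|exact Hbw].
Qed.

Lemma Ck_partials n k U h :
  Ck n (S k) U h -> exists dh : nat -> (nat -> R) -> R, forall i, (i < n)%nat ->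
    (forall x, U x -> derivable_pt_lim (fun t => h (upd x i t)) (x i) (dh i x)) /\ Ck n k U (dh i).
Proof.
  intros [_ Hd].
  apply (functional_choice (fun i dhi => (i < n)%nat ->
    (forall x, U x -> derivable_pt_lim (fun t => h (upd x i t)) (x i) (dhi x)) /\ Ck n k U dhi)).
  intros i. destruct (lt_dec i n) as [Hi|Hi].
  - destruct (Hd i Hi) as [dh H]. exists dh; auto.
  - exists (fun _ => 0). lia.
Qed.

Lemma derivable_pt_lim_sumn m (G : nat -> R -> R) (g' c : nat -> R) a :
  (forall i, (i < m)%nat -> derivable_pt_lim (G i) a (g' i)) ->
  derivable_pt_lim (fun t => sumn m (fun i => c i * G i t)) a (sumn m (fun i => c i * g' i)).
Proof.
  induction m as [|m IH]; intros H; simpl; [apply derivable_pt_lim_const|].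
  apply (derivable_pt_lim_plus (fun t => sumn m (fun i => c i * G i t)) (fun t => c m * G m t)).
  - apply IH. intros; apply H; lia.
  - apply (derivable_pt_lim_scal (G m)). apply H; lia.
Qed.

(** This and its converse state the derivative without a quotient. Error bounds can then be added
    and composed, and t = a needs no exception. *)
Lemma derivable_pt_lim_increment f a l :
  derivable_pt_lim f a l -> forall e, 0 < e -> exists d, 0 < d /\
    forall t, Rabs (t - a) < d -> Rabs (f t - f a - l * (t - a)) <= e * Rabs (t - a).
Proof.
  intros H e He. destruct (H e He) as [d Hd]. exists d. split; [apply cond_pos|].
  intros t Ht. destruct (Req_dec t a) as [->|Hn].
  - rewrite !Rminus_diag, Rmult_0_r, Rminus_0_r, Rabs_R0. lra.
  - specialize (Hd (t - a) ltac:(lra) Ht). replace (a + (t - a)) with t in Hd by ring.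
    replace (f t - f a - l * (t - a)) with (((f t - f a) / (t - a) - l) * (t - a)) by (field; lra).
    rewrite Rabs_mult. apply Rmult_le_compat_r; [apply Rabs_pos|lra].
Qed.

Lemma increment_derivable_pt_lim f a l :
  (forall e, 0 < e -> exists d, 0 < d /\
    forall t, Rabs (t - a) < d -> Rabs (f t - f a - l * (t - a)) <= e * Rabs (t - a)) ->
  derivable_pt_lim f a l.
Proof.
  intros H e He. destruct (H (e/2) ltac:(lra)) as [d [Hd Hi]].
  exists (mkposreal d Hd). intros s Hs Hsd. simpl in Hsd.
  specialize (Hi (a + s)). replace (a + s - a) with s in Hi by ring.
  specialize (Hi Hsd).
  replace ((f (a + s) - f a) / s - l) with ((f (a + s) - f a - l * s) / s) by (field; lra).
  unfold Rdiv. rewrite Rabs_mult, Rabs_inv.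
  pose proof (Rabs_pos_lt s Hs).
  apply Rle_lt_trans with (e / 2 * Rabs s * / Rabs s).
  - apply Rmult_le_compat_r; auto. left. now apply Rinv_0_lt_compat.
  - replace (e / 2 * Rabs s * / Rabs s) with (e / 2) by (field; lra). lra.
Qed.

Lemma derivable_pt_lim_lipschitz f a l :
  derivable_pt_lim f a l -> exists d, 0 < d /\
    forall t, Rabs (t - a) < d -> Rabs (f t - f a) <= (Rabs l + 1) * Rabs (t - a).
Proof.
  intros H. destruct (derivable_pt_lim_increment f a l H 1 ltac:(lra)) as [d [Hd Hi]].
  exists d. split; auto. intros t Ht. specialize (Hi t Ht).
  replace (f t - f a) with ((f t - f a - l * (t - a)) + l * (t - a)) by ring.
  eapply Rle_trans; [apply Rabs_triang|]. rewrite Rabs_mult. lra.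
Qed.

Lemma chain_rule m V h (dh : nat -> (nat -> R) -> R) (G : nat -> R -> R) (g' : nat -> R) a :
  open_n m V -> cont_on m V h ->
  (forall j w, (j < m)%nat -> V w -> derivable_pt_lim (fun t => h (upd w j t)) (w j) (dh j w)) ->
  (forall j, (j < m)%nat -> cont_on m V (dh j)) ->
  V (fun i => G i a) ->
  (forall i, (i < m)%nat -> derivable_pt_lim (G i) a (g' i)) ->
  derivable_pt_lim (fun t => h (fun i => G i t)) a (sumn m (fun i => dh i (fun i => G i a) * g' i)).
Proof.
  intros HV Hc Hd Hcd Ha HG.
  set (y0 := fun i => G i a) in *.
  set (K := sumn m (fun i => Rabs (g' i) + 1)).
  assert (HK : 0 <= K) by (apply sumn_nonneg; intros; pose proof (Rabs_pos (g' i)); lra).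
  apply increment_derivable_pt_lim. intros e He.
  (* K bounds the l^1 speed of the curve [G] near a. Half of e pays for the nonlinearity of h along
     the curve, the other half for the curve's own deviation from its tangent. *)
  set (e1 := e / 2 / (K + 1)).
  assert (He1 : 0 < e1) by (apply Rdiv_lt_0_compat; lra).
  destruct (differentiable m V h dh y0 HV Hc Ha Hd Hcd e1 He1) as [d0 [Hd0 H0]].
  destruct (derivable_pt_lim_increment _ _ _
    (derivable_pt_lim_sumn m G g' (fun i => dh i y0) a HG) (e / 2) ltac:(lra)) as [d1 [Hd1 H1]].
  destruct (uniform_radius m (fun i d => forall t, Rabs (t - a) < d ->
      Rabs (G i t - G i a) <= (Rabs (g' i) + 1) * Rabs (t - a) /\ Rabs (G i t - G i a) < d0))
    as [d2 [Hd2 H2]].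
  { intros i d d' HQ [_ Hle] t Ht. apply HQ. lra. }
  { intros i Hi. destruct (derivable_pt_lim_lipschitz _ _ _ (HG i Hi)) as [d [Hdp Hl]].
    pose proof (Rabs_pos (g' i)) as Hp.
    exists (Rmin d (d0 / (Rabs (g' i) + 1))). split.
    - apply Rmin_pos; auto. apply Rdiv_lt_0_compat; lra.
    - intros t Ht. assert (Hl' := Hl t (Rlt_le_trans _ _ _ Ht (Rmin_l _ _))). split; auto.
      eapply Rle_lt_trans; [exact Hl'|].
      assert (Ht' := Rlt_le_trans _ _ _ Ht (Rmin_r _ _)).
      apply Rmult_lt_compat_l with (r := Rabs (g' i) + 1) in Ht'; [|lra].
      replace ((Rabs (g' i) + 1) * (d0 / (Rabs (g' i) + 1))) with d0 in Ht' by (field; lra). lra. }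
  exists (Rmin d1 d2). split; [now apply Rmin_pos|]. intros t Ht.
  assert (Ht1 := Rlt_le_trans _ _ _ Ht (Rmin_l _ _)).
  assert (Ht2 := Rlt_le_trans _ _ _ Ht (Rmin_r _ _)).
  destruct (H0 (fun i => G i t)) as [_ Hdiff].
  { intros i Hi. now apply H2. }
  specialize (H1 t Ht1). simpl in H1.
  assert (Hs : sumn m (fun j => dh j y0 * (G j t - y0 j))
     = sumn m (fun i => dh i y0 * G i t) - sumn m (fun i => dh i y0 * G i a)).
  { rewrite <- sumn_minus. apply sumn_ext. intros. unfold y0. ring. }
  rewrite Hs in Hdiff.
  assert (Hb : sumn m (fun j => Rabs (G j t - y0 j)) <= K * Rabs (t - a)).
  { unfold K. rewrite Rmult_comm, <- sumn_scal. apply sumn_le. intros i Hi.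
    rewrite Rmult_comm. now apply H2. }
  assert (Hb' : e1 * sumn m (fun j => Rabs (G j t - y0 j)) <= e / 2 * Rabs (t - a)).
  { apply Rle_trans with (e1 * (K * Rabs (t - a))).
    - apply Rmult_le_compat_l; lra.
    - rewrite <- Rmult_assoc. apply Rmult_le_compat_r; [apply Rabs_pos|].
      replace (e / 2) with (e1 * (K + 1)) by (unfold e1; field; lra).
      apply Rmult_le_compat_l; lra. }
  set (A := sumn m (fun i => dh i y0 * G i t)) in *.
  set (B := sumn m (fun i => dh i y0 * G i a)) in *.
  set (l := sumn m (fun i => dh i y0 * g' i)) in *.
  change (h (fun i => G i a)) with (h y0).
  replace (h (fun i => G i t) - h y0 - l * (t - a))
    with ((h (fun i => G i t) - h y0 - (A - B)) + (A - B - l * (t - a))) by ring.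
  eapply Rle_trans; [apply Rabs_triang|]. lra.
Qed.

Lemma cont_on_comp n U m V h (g : nat -> (nat -> R) -> R) :
  cont_on m V h -> (forall i, (i < m)%nat -> cont_on n U (g i)) ->
  (forall x, U x -> V (fun i => g i x)) -> cont_on n U (fun x => h (fun i => g i x)).
Proof.
  intros Hh Hg HUV x Hx e He. destruct (Hh _ (HUV x Hx) e He) as [d [Hd H]].
  destruct (uniform_radius m (fun i r => forall y, U y -> ball n x r y -> Rabs (g i y - g i x) < d))
    as [r [Hr H']].
  - intros i r r' HQ [_ Hr'] y Uy Hy. apply HQ; auto. now apply ball_le with r'.
  - intros i Hi. destruct (Hg i Hi x Hx d Hd) as [r [Hr H']]. exists r; auto.
  - exists r. split; auto. intros y Uy Hy. apply H; auto. intros i Hi. now apply H'.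
Qed.

(** By the chain rule a partial derivative of the composite is a sum of products (dh_i composed with
    g) times dg_i. The induction is on k with h generalized, so that it applies to each dh_i with
    the same g. *)
Lemma Ck_comp n U m V k h (g : nat -> (nat -> R) -> R) :
  open_n m V -> Ck m k V h -> (forall i, (i < m)%nat -> Ck n k U (g i)) ->
  (forall x, U x -> V (fun i => g i x)) -> Ck n k U (fun x => h (fun i => g i x)).
Proof.
  intros HV. revert h. induction k as [|k IH]; intros h Hh Hg HUV.
  - now apply cont_on_comp with (V := V) (m := m).
  - assert (Hc : cont_on m V h) by now apply Ck_cont in Hh.
    split.
    + apply cont_on_comp with (V := V) (m := m); auto. intros i Hi. eapply Ck_cont; eauto.
    + intros j Hj. destruct (Ck_partials _ _ _ _ Hh) as [dh Hdh].
      assert (Hgd : exists dg : nat -> (nat -> R) -> R, forall i, (i < m)%nat ->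
        (forall x, U x -> derivable_pt_lim (fun t => g i (upd x j t)) (x j) (dg i x))
        /\ Ck n k U (dg i)).
      { apply (functional_choice (fun i dg => (i < m)%nat ->
          (forall x, U x -> derivable_pt_lim (fun t => g i (upd x j t)) (x j) (dg x))
          /\ Ck n k U dg)).
        intros i. destruct (lt_dec i m) as [Hi|Hi].
        - destruct (Hg i Hi) as [_ Hd]. destruct (Hd j Hj) as [dg H]. exists dg; auto.
        - exists (fun _ => 0). lia. }
      destruct Hgd as [dg Hdg].
      exists (fun x => sumn m (fun i => dh i (fun i => g i x) * dg i x)). split.
      * intros x Hx.
        pose proof (chain_rule m V h dh (fun i t => g i (upd x j t)) (fun i => dg i x) (x j)) as P.
        cbv beta in P. rewrite upd_id in P. apply P; auto.
        -- intros i w Hi. now apply Hdh.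
        -- intros i Hi. eapply Ck_cont. now apply Hdh.
        -- intros i Hi. now apply Hdg.
      * apply (Ck_sumn n k U m (fun i x => dh i (fun i => g i x) * dg i x)).
        intros i Hi. apply Ck_mult; [|now apply Hdg].
        apply IH; auto; [now apply Hdh|]. intros. now apply Ck_pred, Hg.
Qed.

(** * Smooth functions of one variable *)

(** A function of one real variable is read on coordinate 0 of R^1, so that [Ck_comp] also covers
    composition with [sqrt], [ln], [acos] and the like. *)
Definition line (V : R -> Prop) : (nat -> R) -> Prop := fun x => V (x 0%nat).

Definition smooth1 (V : R -> Prop) (f : R -> R) : Prop :=
  smooth_on 1 (line V) (fun x => f (x 0%nat)).

Definition open1 (V : R -> Prop) : Prop :=
  forall a, V a -> exists d, 0 < d /\ forall t, Rabs (t - a) < d -> V t.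

Lemma open_line V : open1 V -> open_n 1 (line V).
Proof.
  intros H x Hx. destruct (H _ Hx) as [d [Hd Hb]]. exists d. split; auto.
  intros y Hy. apply Hb. apply Hy. lia.
Qed.

Lemma smooth_on_comp1 n U V f h :
  open1 V -> smooth1 V f -> smooth_on n U h -> (forall x, U x -> V (h x)) ->
  smooth_on n U (fun x => f (h x)).
Proof.
  intros HV Hf Hh HUV k.
  apply (Ck_comp n U 1 (line V) k (fun x => f (x 0%nat)) (fun _ => h)); auto.
  now apply open_line.
Qed.

Lemma cont_on_derivable1 V f f' :
  (forall a, V a -> derivable_pt_lim f a (f' a)) -> cont_on 1 (line V) (fun x => f (x 0%nat)).
Proof.
  intros H x Hx e He.
  assert (C : continuity_pt f (x 0%nat)) by (apply derivable_continuous_pt; eexists; apply H, Hx).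
  destruct (C e He) as [d [Hd Hc]]. exists d. split; auto. intros y _ Hy.
  destruct (Req_dec (y 0%nat) (x 0%nat)) as [E|E].
  - rewrite E, Rminus_diag, Rabs_R0. auto.
  - apply Hc. split; [split; [exact Logic.I|auto]|]. apply Hy. lia.
Qed.

Lemma Ck1_S V k f f' :
  (forall a, V a -> derivable_pt_lim f a (f' a)) ->
  Ck 1 k (line V) (fun x => f' (x 0%nat)) -> Ck 1 (S k) (line V) (fun x => f (x 0%nat)).
Proof.
  intros Hd Hk. split; [now apply cont_on_derivable1 with f'|].
  intros i Hi. assert (i = 0%nat) by lia. subst i. exists (fun x => f' (x 0%nat)). split; [|exact Hk].
  intros x Hx. unfold upd. simpl. apply Hd. exact Hx.
Qed.

Lemma Ck1_proj V k : Ck 1 k (line V) (fun x => x 0%nat).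
Proof. apply Ck_proj. lia. Qed.

Lemma open1_pos : open1 (fun t => 0 < t).
Proof.
  intros a Ha. exists a. split; auto. intros t Ht. apply Rabs_def2 in Ht. lra.
Qed.

Lemma open1_neq0 : open1 (fun t => t <> 0).
Proof.
  intros a Ha. exists (Rabs a). split; [now apply Rabs_pos_lt|]. intros t Ht ->.
  rewrite Rminus_0_l, Rabs_Ropp in Ht. lra.
Qed.

Lemma open1_unit : open1 (fun t => -1 < t < 1).
Proof.
  intros a Ha. exists (Rmin (1 - a) (a + 1)). split; [apply Rmin_pos; lra|].
  intros t Ht.
  pose proof (Rlt_le_trans _ _ _ Ht (Rmin_l _ _)) as A.
  pose proof (Rlt_le_trans _ _ _ Ht (Rmin_r _ _)) as B.
  apply Rabs_def2 in A. apply Rabs_def2 in B. lra.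
Qed.

Lemma open1_all : open1 (fun _ => True).
Proof. intros a _. exists 1. split; [lra|auto]. Qed.

Lemma derivable_pt_lim_Rinv a : a <> 0 -> derivable_pt_lim Rinv a (- (/ a * / a)).
Proof.
  intros Ha.
  pose proof (derivable_pt_lim_div (fct_cte 1) id a 0 1 (derivable_pt_lim_const 1 a)
    (derivable_pt_lim_id a) Ha) as P.
  apply derivable_pt_lim_local with (fct_cte 1 / id)%F 1; [lra| |].
  - intros. unfold div_fct, fct_cte, id, Rdiv. ring.
  - replace (- (/ a * / a)) with ((0 * id a - 1 * fct_cte 1 a) / (id a)²).
    + exact P.
    + unfold id, fct_cte, Rsqr. field. auto.
Qed.

(** The derivative is a polynomial in the function itself, so the C^k property of the inverse feeds
    its own induction step. The square root works in the same way. *)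
Lemma smooth1_inv : smooth1 (fun t => t <> 0) Rinv.
Proof.
  intros k. induction k as [|k IH].
  - apply cont_on_derivable1 with (fun a => - (/ a * / a)). apply derivable_pt_lim_Rinv.
  - apply Ck1_S with (fun a => - (/ a * / a)); [apply derivable_pt_lim_Rinv|].
    apply Ck_ext with (fun x => (-1) * (/ x 0%nat * / x 0%nat)).
    + apply open_line, open1_neq0.
    + intros. ring.
    + apply Ck_mult; [apply Ck_const|]. now apply Ck_mult.
Qed.

Lemma Ck_inv_pos n k U h :
  open_n n U -> Ck n k U h -> (forall x, U x -> 0 < h x) -> Ck n k U (fun x => / h x).
Proof.
  intros HU Hh Hp.
  apply (Ck_comp n U 1 (line (fun t => t <> 0)) k (fun x => / x 0%nat) (fun _ => h)); auto.
  - apply open_line, open1_neq0.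
  - apply smooth1_inv.
  - intros x Hx. unfold line. specialize (Hp x Hx). lra.
Qed.

Lemma smooth1_sqrt : smooth1 (fun t => 0 < t) sqrt.
Proof.
  assert (D : forall a, 0 < a -> derivable_pt_lim sqrt a (/ (2 * sqrt a)))
    by apply derivable_pt_lim_sqrt.
  intros k. induction k as [|k IH].
  - now apply cont_on_derivable1 with (fun a => / (2 * sqrt a)).
  - apply Ck1_S with (fun a => / (2 * sqrt a)); auto.
    apply (Ck_inv_pos 1 k (line (fun t => 0 < t)) (fun x => 2 * sqrt (x 0%nat))).
    + apply open_line, open1_pos.
    + apply Ck_mult; [apply Ck_const|auto].
    + intros x Hx. pose proof (sqrt_lt_R0 _ Hx). lra.
Qed.

Lemma smooth1_ln : smooth1 (fun t => 0 < t) ln.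
Proof.
  assert (D : forall a, 0 < a -> derivable_pt_lim ln a (/ a)) by apply derivable_pt_lim_ln.
  intros [|k].
  - now apply cont_on_derivable1 with Rinv.
  - apply Ck1_S with Rinv; auto.
    apply Ck_sub with (line (fun t => t <> 0)); [|apply smooth1_inv].
    unfold line. intros. lra.
Qed.

Lemma Ck1_cosh_sinh k :
  Ck 1 k (line (fun _ => True)) (fun x => cosh (x 0%nat)) /\
  Ck 1 k (line (fun _ => True)) (fun x => sinh (x 0%nat)).
Proof.
  induction k as [|k [IHc IHs]]; split.
  - apply cont_on_derivable1 with sinh. intros; apply derivable_pt_lim_cosh.
  - apply cont_on_derivable1 with cosh. intros; apply derivable_pt_lim_sinh.
  - apply Ck1_S with sinh; auto. intros; apply derivable_pt_lim_cosh.
  - apply Ck1_S with cosh; auto. intros; apply derivable_pt_lim_sinh.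
Qed.

Lemma smooth1_cosh : smooth1 (fun _ => True) cosh.
Proof. intros k. apply Ck1_cosh_sinh. Qed.

Lemma smooth1_sinh : smooth1 (fun _ => True) sinh.
Proof. intros k. apply Ck1_cosh_sinh. Qed.

Lemma derivable_pt_lim_acos a : -1 < a < 1 -> derivable_pt_lim acos a (- / sqrt (1 - a * a)).
Proof.
  intros Ha. pose proof (derive_pt_acos a Ha) as E.
  destruct (derivable_pt_acos a Ha) as [l Hl]. simpl in E. unfold derivable_pt_abs in Hl.
  replace (- / sqrt (1 - a * a)) with l; auto.
  rewrite E. unfold Rsqr, Rdiv. ring.
Qed.

Lemma smooth1_acos : smooth1 (fun t => -1 < t < 1) acos.
Proof.
  intros [|k].
  - apply cont_on_derivable1 with (fun a => - / sqrt (1 - a * a)). apply derivable_pt_lim_acos.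
  - apply Ck1_S with (fun a => - / sqrt (1 - a * a)); [apply derivable_pt_lim_acos|].
    assert (HO := open_line _ open1_unit).
    assert (Hp : forall x, line (fun t => -1 < t < 1) x -> 0 < 1 + -1 * (x 0%nat * x 0%nat))
      by (unfold line; intros; nra).
    apply Ck_ext with (fun x => -1 * / sqrt (1 + -1 * (x 0%nat * x 0%nat))); auto.
    { intros. replace (1 + -1 * (x 0%nat * x 0%nat)) with (1 - x 0%nat * x 0%nat) by ring. ring. }
    apply Ck_mult; [apply Ck_const|]. apply Ck_inv_pos; auto.
    + apply (smooth_on_comp1 1 _ (fun t => 0 < t) sqrt (fun x => 1 + -1 * (x 0%nat * x 0%nat)));
        [apply open1_pos|apply smooth1_sqrt| |auto].
      intros k'. apply Ck_plus; [apply Ck_const|]. apply Ck_mult; [apply Ck_const|].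
      apply Ck_mult; apply Ck1_proj.
    + intros x Hx. apply sqrt_lt_R0. auto.
Qed.

(** * Smooth inverses of positive definite matrices *)

Lemma smooth_on_mult n U f g :
  smooth_on n U f -> smooth_on n U g -> smooth_on n U (fun x => f x * g x).
Proof. intros Hf Hg k. now apply Ck_mult. Qed.

Lemma smooth_on_plus n U f g :
  smooth_on n U f -> smooth_on n U g -> smooth_on n U (fun x => f x + g x).
Proof. intros Hf Hg k. now apply Ck_plus. Qed.

Lemma smooth_on_const n U c : smooth_on n U (fun _ => c).
Proof. intros k. apply Ck_const. Qed.

Lemma smooth_on_proj n U i : (i < n)%nat -> smooth_on n U (fun x => x i).
Proof. intros Hi k. now apply Ck_proj. Qed.

Lemma smooth_on_ext n U f g :
  open_n n U -> (forall x, U x -> f x = g x) -> smooth_on n U f -> smooth_on n U g.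
Proof. intros HU E H k. now apply Ck_ext with f. Qed.

Lemma smooth_on_sub n U U' f :
  (forall x, U' x -> U x) -> smooth_on n U f -> smooth_on n U' f.
Proof. intros HU H k. now apply Ck_sub with U. Qed.

Lemma smooth_on_minus n U f g :
  open_n n U -> smooth_on n U f -> smooth_on n U g -> smooth_on n U (fun x => f x - g x).
Proof.
  intros HU Hf Hg. apply smooth_on_ext with (fun x => f x + -1 * g x); auto.
  - intros. ring.
  - apply smooth_on_plus; auto. apply smooth_on_mult; auto. apply smooth_on_const.
Qed.

Lemma smooth_on_inv n U h :
  open_n n U -> smooth_on n U h -> (forall x, U x -> 0 < h x) -> smooth_on n U (fun x => / h x).
Proof. intros HU Hh Hp k. now apply Ck_inv_pos. Qed.

Lemma smooth_on_div n U f h :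
  open_n n U -> smooth_on n U f -> smooth_on n U h -> (forall x, U x -> 0 < h x) ->
  smooth_on n U (fun x => f x / h x).
Proof. intros HU Hf Hh Hp. apply smooth_on_mult; auto. now apply smooth_on_inv. Qed.

Lemma smooth_on_sumn n U m (f : nat -> (nat -> R) -> R) :
  (forall i, (i < m)%nat -> smooth_on n U (f i)) -> smooth_on n U (fun x => sumn m (fun i => f i x)).
Proof. intros H k. apply Ck_sumn. intros i Hi. now apply H. Qed.

Lemma smooth_on_partial n U h i dh :
  open_n n U -> smooth_on n U h -> (i < n)%nat ->
  (forall x, U x -> derivable_pt_lim (fun t => h (upd x i t)) (x i) (dh x)) -> smooth_on n U dh.
Proof. intros HU Hh Hi Hd k. now apply Ck_partial with h i. Qed.

Definition mulv (n : nat) (A : nat -> nat -> R) (v : nat -> R) (i : nat) : R :=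
  sumn n (fun j => A i j * v j).

Definition posdef (n : nat) (A : nat -> nat -> R) : Prop :=
  forall v, (exists i, (i < n)%nat /\ v i <> 0) -> 0 < sumn n (fun i => v i * mulv n A v i).

Lemma posdef_diag n A k : posdef n A -> (k < n)%nat -> 0 < A k k.
Proof.
  intros H Hk. specialize (H (kron k)).
  rewrite (sumn_kron_l n k (mulv n A (kron k)) Hk) in H.
  unfold mulv in H.
  rewrite (sumn_ext n _ (fun j => kron k j * A k j)) in H by (intros; ring).
  rewrite sumn_kron_l in H by auto. apply H. exists k. split; auto. rewrite kron_refl. lra.
Qed.

(** The subtraction is written as [+ -1 *] so that closure of smooth functions under sums and
    products applies directly. *)
Definition schur (n : nat) (A : nat -> nat -> R) (i j : nat) : R :=
  A i j + -1 * (A i n * (A n j * / A n n)).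

Lemma schur_mulv n A v i :
  mulv n (schur n A) v i = mulv n A v i - A i n * / A n n * mulv n A v n.
Proof.
  unfold mulv, schur. rewrite <- sumn_scal, <- sumn_minus. apply sumn_ext. intros. ring.
Qed.

(** Extend v by the last coordinate t that annihilates row n of the product. The form of A at the
    extended vector then equals the form of the Schur complement at v. *)
Lemma posdef_schur n A : posdef (S n) A -> posdef n (schur n A).
Proof.
  intros H v [k [Hk Hv]].
  assert (Ha : 0 < A n n) by (apply (posdef_diag (S n)); auto).
  set (t := - (mulv n A v n / A n n)).
  assert (E : forall i, mulv (S n) A (upd v n t) i = mulv n A v i + A i n * t).
  { intros i. unfold mulv. simpl. rewrite upd_same. f_equal. apply sumn_ext. intros j Hj.
    rewrite upd_other by lia. reflexivity. }
  specialize (H (upd v n t)). simpl in H. rewrite upd_same, E in H.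
  replace (mulv n A v n + A n n * t) with 0 in H by (unfold t; field; lra).
  rewrite (sumn_ext n _ (fun i => v i * mulv n (schur n A) v i)) in H.
  - rewrite Rmult_0_r, Rplus_0_r in H. apply H. exists k. split; [lia|].
    rewrite upd_other by lia. auto.
  - intros i Hi. rewrite upd_other by lia. rewrite E, schur_mulv. unfold t, Rdiv. ring.
Qed.

(** Elimination of the last unknown, followed by back substitution. Only sums, products and division
    by the pivot [A n n] occur, and the pivot is positive on U, so the solution depends smoothly on
    x. *)
Lemma posdef_solve d U (HU : open_n d U) n :
  forall (A : nat -> nat -> (nat -> R) -> R) (q : nat -> (nat -> R) -> R),
  (forall i j, (i < n)%nat -> (j < n)%nat -> smooth_on d U (A i j)) ->
  (forall i, (i < n)%nat -> smooth_on d U (q i)) ->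
  (forall x, U x -> posdef n (fun i j => A i j x)) ->
  exists p : nat -> (nat -> R) -> R, (forall i, (i < n)%nat -> smooth_on d U (p i)) /\
    forall x i, U x -> (i < n)%nat ->
      mulv n (fun i j => A i j x) (fun j => p j x) i = q i x.
Proof.
  induction n as [|n IH]; intros A q HA Hq Hpos.
  - exists (fun _ _ => 0). split; intros; lia.
  - assert (Ha : forall x, U x -> 0 < A n n x)
      by (intros x Hx; apply (posdef_diag (S n) (fun i j => A i j x)); auto).
    assert (Hinv : smooth_on d U (fun x => / A n n x)) by (apply smooth_on_inv; auto).
    destruct (IH (fun i j x => schur n (fun i j => A i j x) i j)
                 (fun i x => q i x + -1 * (A i n x * (q n x * / A n n x)))) as [p [Hp Hs]].
    + intros i j Hi Hj. unfold schur. apply smooth_on_plus; [apply HA; lia|].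
      apply smooth_on_mult; [apply smooth_on_const|]. apply smooth_on_mult; [apply HA; lia|].
      apply smooth_on_mult; auto.
    + intros i Hi. apply smooth_on_plus; [apply Hq; lia|].
      apply smooth_on_mult; [apply smooth_on_const|]. apply smooth_on_mult; [apply HA; lia|].
      apply smooth_on_mult; auto.
    + intros x Hx. apply (posdef_schur n (fun i j => A i j x)). now apply Hpos.
    + set (last := fun x => (q n x + -1 * sumn n (fun j => A n j x * p j x)) * / A n n x).
      exists (fun i => if Nat.eqb i n then last else p i). split.
      * intros i Hi. destruct (Nat.eqb_spec i n) as [->|Hn]; [|apply Hp; lia].
        apply smooth_on_mult; auto. apply smooth_on_plus; auto.
        apply smooth_on_mult; [apply smooth_on_const|].
        apply (smooth_on_sumn d U n (fun j x => A n j x * p j x)). intros j Hj.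
        apply smooth_on_mult; [apply HA; lia|auto].
      * intros x i Hx Hi. specialize (Ha x Hx).
        assert (E : mulv (S n) (fun i j => A i j x)
                      (fun j => (if Nat.eqb j n then last else p j) x) i
                    = mulv n (fun i j => A i j x) (fun j => p j x) i + A i n x * last x).
        { unfold mulv. simpl. rewrite Nat.eqb_refl. f_equal. apply sumn_ext. intros j Hj.
          now rewrite (proj2 (Nat.eqb_neq j n)) by lia. }
        rewrite E. unfold last. fold (mulv n (fun i j => A i j x) (fun j => p j x) n).
        destruct (Nat.eq_dec i n) as [->|Hn]; [field; lra|].
        specialize (Hs x i Hx ltac:(lia)). rewrite schur_mulv in Hs.
        apply Rplus_eq_reg_r with (-1 * (A i n x * (q n x * / A n n x))). rewrite <- Hs. ring.
Qed.

Lemma posdef_smooth_inverse d U n (A : nat -> nat -> (nat -> R) -> R) :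
  open_n d U ->
  (forall i j, (i < n)%nat -> (j < n)%nat -> smooth_on d U (A i j)) ->
  (forall x, U x -> posdef n (fun i j => A i j x)) ->
  exists B : nat -> nat -> (nat -> R) -> R,
    (forall i j, (i < n)%nat -> (j < n)%nat -> smooth_on d U (B i j)) /\
    (forall x i j, U x -> (i < n)%nat -> (j < n)%nat ->
       sumn n (fun k => A i k x * B k j x) = kron i j) /\
    (forall x i j, U x -> (i < n)%nat -> (j < n)%nat ->
       sumn n (fun k => B i k x * A k j x) = kron i j).
Proof.
  intros HU HA Hpos.
  destruct (functional_choice (fun (k : nat) (p : nat -> (nat -> R) -> R) =>
    (forall i, (i < n)%nat -> smooth_on d U (p i)) /\
    forall x i, U x -> (i < n)%nat ->
      mulv n (fun i j => A i j x) (fun j => p j x) i = kron i k)) as [C HC].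
  { intros k. apply (posdef_solve d U HU n A (fun i _ => kron i k)); auto.
    intros; apply smooth_on_const. }
  exists (fun i j => C j i).
  assert (HAB : forall x i j, U x -> (i < n)%nat -> (j < n)%nat ->
       sumn n (fun k => A i k x * C j k x) = kron i j).
  { intros x i j Hx Hi Hj. exact (proj2 (HC j) x i Hx Hi). }
  repeat split.
  - intros i j Hi Hj. now apply HC.
  - exact HAB.
  - intros x i j Hx Hi Hj.
    (* v is column j of BA - I. Since AB = I, A annihilates v, and definiteness turns this into v =
       0: the right inverse is also a left inverse. *)
    set (v := fun l => sumn n (fun k => C k l x * A k j x) - kron l j).
    assert (Hv : forall l, (l < n)%nat -> mulv n (fun i j => A i j x) v l = 0).
    { intros l Hl. unfold mulv, v.
      rewrite (sumn_ext n _ (fun m => sumn n (fun k => A k j x * (A l m x * C k m x))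
                                       - A l m x * kron m j)).
      2:{ intros m Hm. rewrite Rmult_minus_distr_l. f_equal. rewrite <- sumn_scal.
          apply sumn_ext. intros; ring. }
      rewrite sumn_minus, sumn_swap, sumn_kron_r by auto.
      rewrite (sumn_ext n _ (fun k => kron l k * A k j x)).
      - rewrite sumn_kron_l by auto. ring.
      - intros k Hk. rewrite sumn_scal, HAB by auto. ring. }
    destruct (Req_dec (v i) 0) as [Hz|Hnz]; [unfold v in Hz; lra|].
    specialize (Hpos x Hx v (ex_intro _ i (conj Hi Hnz))).
    rewrite (sumn_ext n _ (fun _ => 0)) in Hpos by (intros l Hl; rewrite Hv by auto; ring).
    rewrite sumn_zero in Hpos. lra.
Qed.

(** * Maximum norm and geometric convergence *)

Definition maxabs (n : nat) (v : nat -> R) : R :=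
  (fix go m := match m with O => 0 | S m' => Rmax (go m') (Rabs (v m')) end) n.

Lemma maxabs_ge n v i : (i < n)%nat -> Rabs (v i) <= maxabs n v.
Proof.
  induction n as [|n IH]; intros Hi; [lia|]. simpl.
  destruct (Nat.eq_dec i n) as [->|]; [apply Rmax_r|].
  eapply Rle_trans; [apply IH; lia|apply Rmax_l].
Qed.

Lemma maxabs_le n v M : 0 <= M -> (forall i, (i < n)%nat -> Rabs (v i) <= M) -> maxabs n v <= M.
Proof.
  induction n as [|n IH]; intros HM H; simpl; auto.
  apply Rmax_lub; [apply IH; auto|apply H; lia].
Qed.

Lemma maxabs_nonneg n v : 0 <= maxabs n v.
Proof.
  destruct n as [|n]; simpl; [lra|]. eapply Rle_trans; [apply (Rabs_pos (v n))|apply Rmax_r].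
Qed.

Lemma geometric_converges (u : nat -> R) (C : R) :
  (forall m, Rabs (u (S m) - u m) <= C * (/ 2) ^ m) ->
  exists l, Un_cv u l /\ forall m, Rabs (u m - l) <= 2 * C * (/ 2) ^ m.
Proof.
  intros H.
  assert (HC : 0 <= C) by (specialize (H 0%nat); simpl in H; pose proof (Rabs_pos (u 1%nat - u 0%nat)); lra).
  assert (Hp : forall m, 0 < (/ 2) ^ m) by (intros; apply pow_lt; lra).
  (* The exact factor 1 - (1/2)^k of the geometric sum is kept because the weaker bound without it
     would not pass through the induction on k. *)
  assert (Hk : forall m k, Rabs (u (m + k)%nat - u m) <= 2 * C * (/ 2) ^ m * (1 - (/ 2) ^ k)).
  { intros m k. induction k as [|k IH].
    - rewrite Nat.add_0_r, Rminus_diag, Rabs_R0. simpl. lra.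
    - replace (u (m + S k)%nat - u m) with ((u (S (m + k)) - u (m + k)%nat) + (u (m + k)%nat - u m))
        by (rewrite Nat.add_succ_r; ring).
      eapply Rle_trans; [apply Rabs_triang|]. specialize (H (m + k)%nat).
      rewrite pow_add in H. simpl. lra. }
  assert (Hk2 : forall m k, Rabs (u (m + k)%nat - u m) <= 2 * C * (/ 2) ^ m).
  { intros m k. eapply Rle_trans; [apply Hk|].
    assert (0 <= 2 * C * (/ 2) ^ m) by (specialize (Hp m); nra).
    specialize (Hp k). nra. }
  assert (Hsmall : forall e, 0 < e -> exists N, 2 * C * (/ 2) ^ N < e).
  { intros e He. destruct (pow_lt_1_zero (/ 2) ltac:(rewrite Rabs_right; lra) (e / (2 * C + 1)))
      as [N HN]; [apply Rdiv_lt_0_compat; lra|].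
    exists N. specialize (HN N (le_n N)). rewrite Rabs_right in HN by (specialize (Hp N); lra).
    apply Rmult_lt_compat_l with (r := 2 * C + 1) in HN; [|lra].
    replace ((2 * C + 1) * (e / (2 * C + 1))) with e in HN by (field; lra).
    specialize (Hp N). lra. }
  destruct (R_complete u) as [l Hl].
  { intros e He. destruct (Hsmall (e / 2) ltac:(lra)) as [N HN]. exists N. intros a b Ha Hb.
    unfold Rdist. replace (u a - u b) with ((u (N + (a - N))%nat - u N) - (u (N + (b - N))%nat - u N))
      by (replace (N + (a - N))%nat with a by lia; replace (N + (b - N))%nat with b by lia; ring).
    eapply Rle_lt_trans; [apply Rabs_triang|]. rewrite Rabs_Ropp.
    pose proof (Hk2 N (a - N)%nat). pose proof (Hk2 N (b - N)%nat). lra. }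
  exists l. split; auto. intros m. apply le_epsilon. intros e He.
  destruct (Hl e He) as [N HN]. specialize (HN (m + N)%nat ltac:(lia)). unfold Rdist in HN.
  replace (u m - l) with ((u (m + N)%nat - l) - (u (m + N)%nat - u m)) by ring.
  eapply Rle_trans; [apply Rabs_triang|]. rewrite Rabs_Ropp.
  pose proof (Hk2 m N). lra.
Qed.

(** * The inverse function theorem *)

Lemma sumn_abs_maxabs n v : sumn n (fun i => Rabs (v i)) <= INR n * maxabs n v.
Proof.
  rewrite <- sumn_const. apply sumn_le. intros i Hi. now apply maxabs_ge.
Qed.

Lemma ball_between n x0 rho x y w :
  ball n x0 rho x -> ball n x0 rho y ->
  (forall i, (i < n)%nat -> Rmin (x i) (y i) <= w i <= Rmax (x i) (y i)) -> ball n x0 rho w.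
Proof.
  intros Hx Hy Hw i Hi. specialize (Hx i Hi). specialize (Hy i Hi). specialize (Hw i Hi).
  apply Rabs_def2 in Hx. apply Rabs_def2 in Hy. apply Rabs_def1;
  unfold Rmin, Rmax in Hw; destruct (Rle_dec (x i) (y i)); lra.
Qed.

(** With b the inverse of the Jacobian at x0, the map x - b f(x) has zero derivative at x0. Its
    derivative is therefore small on a ball, where the map contracts by the factor 1/2. *)
Lemma near_linear_on_ball n D (f : (nat -> R) -> nat -> R) P (b : nat -> nat -> R) x0 :
  open_n n D -> smooth_map_on n D f ->
  (forall i j x, (i < n)%nat -> (j < n)%nat -> D x ->
     derivable_pt_lim (fun t => f (upd x j t) i) (x j) (P i j x)) ->
  D x0 ->
  (forall i j, (i < n)%nat -> (j < n)%nat -> sumn n (fun k => b i k * P k j x0) = kron i j) ->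
  exists rho, 0 < rho /\ (forall x, ball n x0 rho x -> D x) /\
    forall x y i, ball n x0 rho x -> ball n x0 rho y -> (i < n)%nat ->
      Rabs (y i - x i - sumn n (fun k => b i k * (f y k - f x k)))
        <= / 2 * maxabs n (fun i => y i - x i).
Proof.
  intros HD Hf HP Hx0 Hb.
  (* [increment_bound] measures y - x in the l^1 norm, which is at most n times the maximum norm.
     This e turns that factor n into at most 1/2. *)
  set (e := / (2 * (INR n + 1))).
  assert (Hn : 0 <= INR n) by apply pos_INR.
  assert (He : 0 < e) by (apply Rinv_0_lt_compat; lra).
  set (dh := fun i j x => kron i j + -1 * sumn n (fun k => b i k * P k j x)).
  assert (HPs : forall i j, (i < n)%nat -> (j < n)%nat -> smooth_on n D (P i j)).
  { intros i j Hi Hj. apply smooth_on_partial with (fun x => f x i) j; auto. }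
  assert (Hdh : forall i j, (i < n)%nat -> (j < n)%nat -> cont_on n D (dh i j)).
  { intros i j Hi Hj. apply (Ck_cont n 0).
    apply Ck_plus; [apply Ck_const|]. apply Ck_mult; [apply Ck_const|].
    apply (Ck_sumn n 0 D n (fun k x => b i k * P k j x)). intros k Hk.
    apply Ck_mult; [apply Ck_const|]. now apply HPs. }
  assert (Hdh0 : forall i j, (i < n)%nat -> (j < n)%nat -> dh i j x0 = 0).
  { intros i j Hi Hj. unfold dh. rewrite Hb by auto. ring. }
  destruct (HD x0 Hx0) as [r0 [Hr0 HD0]].
  destruct (uniform_radius n (fun i d => forall j w, (j < n)%nat -> D w -> ball n x0 d w ->
      Rabs (dh i j w) <= e)) as [r1 [Hr1 H1]].
  { intros i d d' HQ [_ Hle] j w Hj Hw Hbw. apply HQ; auto. now apply ball_le with d'. }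
  { intros i Hi.
    destruct (uniform_radius n (fun j d => forall w, D w -> ball n x0 d w ->
      Rabs (dh i j w) <= e)) as [r [Hr H]].
    - intros j d d' HQ [_ Hle] w Hw Hbw. apply HQ; auto. now apply ball_le with d'.
    - intros j Hj. destruct (Hdh i j Hi Hj x0 Hx0 e He) as [d [Hd H]]. exists d. split; auto.
      intros w Hw Hbw. specialize (H w Hw Hbw). rewrite Hdh0, Rminus_0_r in H by auto. lra.
    - exists r. split; auto. }
  set (rho := Rmin r0 r1).
  assert (HDr : forall x, ball n x0 rho x -> D x)
    by (intros x Hx; apply HD0; eapply ball_le; [apply Rmin_l|exact Hx]).
  exists rho. split; [now apply Rmin_pos|]. split; auto.
  intros x y i Hx Hy Hi.
  set (h := fun x => x i + -1 * sumn n (fun k => b i k * f x k)).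
  assert (Hinc : Rabs (h y - h x - sumn n (fun j => 0 * (y j - x j)))
                 <= e * sumn n (fun j => Rabs (y j - x j))).
  { apply (increment_bound n D h (dh i) x y (fun _ => 0) e).
    - apply (Ck_cont n 0). apply Ck_plus; [now apply Ck_proj|].
      apply Ck_mult; [apply Ck_const|].
      apply (Ck_sumn n 0 D n (fun k x => b i k * f x k)). intros k Hk.
      apply Ck_mult; [apply Ck_const|]. now apply Hf.
    - intros j w Hj Hw. unfold h, dh.
      apply (derivable_pt_lim_plus (fun t => upd w j t i)
        (fun t => -1 * sumn n (fun k => b i k * f (upd w j t) k))).
      + destruct (Nat.eq_dec i j) as [->|Hn'].
        * rewrite kron_refl. apply derivable_pt_lim_local with id 1;
            [lra| |apply derivable_pt_lim_id]. intros; now rewrite upd_same.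
        * rewrite kron_neq by auto. apply derivable_pt_lim_local with (fun _ => w i) 1;
            [lra| |apply derivable_pt_lim_const]. intros; now rewrite upd_other.
      + apply (derivable_pt_lim_scal (fun t => sumn n (fun k => b i k * f (upd w j t) k))).
        apply (derivable_pt_lim_sumn n (fun k t => f (upd w j t) k) (fun k => P k j w)).
        intros k Hk. auto.
    - intros w Hw. assert (Hbw : ball n x0 rho w) by now apply ball_between with x y.
      split; auto. intros j Hj. rewrite Rminus_0_r. apply H1; auto.
      eapply ball_le; [apply Rmin_r|exact Hbw]. }
  rewrite sumn_scal, Rmult_0_l, Rminus_0_r in Hinc.
  replace (y i - x i - sumn n (fun k => b i k * (f y k - f x k))) with (h y - h x).
  2:{ unfold h. rewrite (sumn_ext n (fun k => b i k * (f y k - f x k))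
        (fun k => b i k * f y k - b i k * f x k)) by (intros; ring).
      rewrite sumn_minus. ring. }
  eapply Rle_trans; [exact Hinc|].
  pose proof (sumn_abs_maxabs n (fun i => y i - x i)) as Hm. simpl in Hm.
  pose proof (maxabs_nonneg n (fun i => y i - x i)) as Hm0.
  apply Rle_trans with (e * (INR n * maxabs n (fun i => y i - x i))).
  - apply Rmult_le_compat_l; lra.
  - rewrite <- Rmult_assoc. apply Rmult_le_compat_r; auto.
    apply Rmult_le_reg_l with (2 * (INR n + 1)); [lra|].
    rewrite <- Rmult_assoc. unfold e. rewrite Rinv_r by lra. lra.
Qed.

Lemma local_surjection n (f : (nat -> R) -> nat -> R) (b p : nat -> nat -> R) x0 rho :
  0 < rho ->
  (forall i j, (i < n)%nat -> (j < n)%nat -> sumn n (fun k => p i k * b k j) = kron i j) ->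
  (forall x y i, ball n x0 rho x -> ball n x0 rho y -> (i < n)%nat ->
      Rabs (y i - x i - sumn n (fun k => b i k * (f y k - f x k)))
        <= / 2 * maxabs n (fun i => y i - x i)) ->
  forall z, (forall i, (i < n)%nat -> Rabs (sumn n (fun k => b i k * (z k - f x0 k))) < rho / 4) ->
  exists x, ball n x0 rho x /\ eqn n (f x) z.
Proof.
  intros Hrho Hpb Hlin z Hz.
  set (T := fun x i => x i - sumn n (fun k => b i k * (f x k - z k))).
  assert (HT : forall x y i, ball n x0 rho x -> ball n x0 rho y -> (i < n)%nat ->
     Rabs (T y i - T x i) <= / 2 * maxabs n (fun i => y i - x i)).
  { intros x y i Hx Hy Hi. specialize (Hlin x y i Hx Hy Hi).
    replace (T y i - T x i) with (y i - x i - sumn n (fun k => b i k * (f y k - f x k))); auto.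
    unfold T. rewrite (sumn_ext n (fun k => b i k * (f y k - f x k))
      (fun k => b i k * (f y k - z k) - b i k * (f x k - z k))) by (intros; ring).
    rewrite sumn_minus. ring. }
  assert (HT0 : forall i, (i < n)%nat -> Rabs (T x0 i - x0 i) < rho / 4).
  { intros i Hi. specialize (Hz i Hi).
    replace (T x0 i - x0 i) with (sumn n (fun k => b i k * (z k - f x0 k))); auto.
    unfold T. rewrite (sumn_ext n (fun k => b i k * (z k - f x0 k))
      (fun k => -1 * (b i k * (f x0 k - z k)))) by (intros; ring).
    rewrite sumn_scal. ring. }
  set (u := fun m => Nat.iter m T x0).
  (* T moves x0 by less than rho/4 and contracts by 1/2, so a distance of at most rho/2 from x0
     reproduces itself: rho/4 + rho/4. *)
  assert (Hu : forall m i, (i < n)%nat -> Rabs (u m i - x0 i) <= rho / 2).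
  { induction m as [|m IH]; intros i Hi.
    - simpl. rewrite Rminus_diag, Rabs_R0. lra.
    - change (u (S m)) with (T (u m)).
      replace (T (u m) i - x0 i) with ((T (u m) i - T x0 i) + (T x0 i - x0 i)) by ring.
      eapply Rle_trans; [apply Rabs_triang|].
      assert (Hm : maxabs n (fun i => u m i - x0 i) <= rho / 2) by (apply maxabs_le; [lra|auto]).
      assert (Hb' := HT x0 (u m) i (ball_refl n x0 rho Hrho)
        (fun j Hj => Rle_lt_trans _ (rho/2) rho (IH j Hj) ltac:(lra)) Hi).
      specialize (HT0 i Hi). lra. }
  assert (Hub : forall m, ball n x0 rho (u m)).
  { intros m i Hi. specialize (Hu m i Hi). lra. }
  assert (Hstep : forall m i, (i < n)%nat -> Rabs (u (S m) i - u m i) <= rho / 4 * (/ 2) ^ m).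
  { induction m as [|m IH]; intros i Hi.
    - simpl. specialize (HT0 i Hi). change (Nat.iter 0 T x0) with x0. change (u 1%nat) with (T x0).
      change (u 0%nat) with x0. lra.
    - change (u (S (S m)) i - u (S m) i) with (T (u (S m)) i - T (u m) i).
      eapply Rle_trans; [apply HT; auto|].
      assert (Hm : maxabs n (fun i => u (S m) i - u m i) <= rho / 4 * (/ 2) ^ m).
      { apply maxabs_le; auto. assert (0 < (/2)^m) by (apply pow_lt; lra). nra. }
      change ((/ 2) ^ S m) with (/ 2 * (/ 2) ^ m). lra. }
  destruct (functional_choice (fun i l => (i < n)%nat ->
     Un_cv (fun m => u m i) l /\ forall m, Rabs (u m i - l) <= 2 * (rho / 4) * (/ 2) ^ m))
    as [x Hx].
  { intros i. destruct (lt_dec i n) as [Hi|Hi]; [|exists 0; lia].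
    destruct (geometric_converges (fun m => u m i) (rho / 4)) as [l Hl]; [auto|].
    exists l. auto. }
  assert (Hxb : ball n x0 rho x).
  { intros i Hi. destruct (Hx i Hi) as [_ H]. specialize (H 0%nat).
    change (u 0%nat) with x0 in H. rewrite Rabs_minus_sym in H. simpl in H. lra. }
  exists x. split; auto.
  assert (Hfix : forall i, (i < n)%nat -> sumn n (fun k => b i k * (f x k - z k)) = 0).
  { intros i Hi. apply Rabs_lt_all_eq. intros e He.
    (* The three terms of the decomposition below are at most rho/2, rho/4 and rho/4 times (1/2)^N,
       so they add up to at most rho (1/2)^N. *)
    destruct (pow_lt_1_zero (/ 2) ltac:(rewrite Rabs_right; lra) (e / (2 * rho)))
      as [N HN]; [apply Rdiv_lt_0_compat; lra|].
    specialize (HN N (le_n N)).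
    assert (Hp : 0 < (/ 2) ^ N) by (apply pow_lt; lra). rewrite Rabs_right in HN by lra.
    apply Rmult_lt_compat_l with (r := 2 * rho) in HN; [|lra].
    replace (2 * rho * (e / (2 * rho))) with e in HN by (field; lra).
    replace (sumn n (fun k => b i k * (f x k - z k)) - 0) with
      ((x i - u N i) - (u (S N) i - u N i) - (T x i - T (u N) i))
      by (change (u (S N) i) with (T (u N) i); unfold T; ring).
    assert (A1 := proj2 (Hx i Hi) N). rewrite Rabs_minus_sym in A1.
    assert (A2 := Hstep N i Hi).
    assert (A3 := HT (u N) x i (Hub N) Hxb Hi).
    assert (A4 : maxabs n (fun i => x i - u N i) <= 2 * (rho / 4) * (/ 2) ^ N).
    { apply maxabs_le; [nra|]. intros j Hj. rewrite Rabs_minus_sym. now apply Hx. }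
    eapply Rle_lt_trans; [apply Rabs_triang|]. rewrite Rabs_Ropp.
    eapply Rle_lt_trans; [apply Rplus_le_compat_r, Rabs_triang|]. rewrite Rabs_Ropp.
    nra. }
  intros i Hi. apply Rminus_diag_uniq.
  transitivity (sumn n (fun k => p i k * sumn n (fun j => b k j * (f x j - z j)))).
  - rewrite (sumn_ext n _ (fun k => sumn n (fun j => (f x j - z j) * (p i k * b k j)))).
    + rewrite sumn_swap.
      rewrite (sumn_ext n _ (fun j => kron i j * (f x j - z j))).
      * now rewrite sumn_kron_l.
      * intros j Hj. rewrite sumn_scal, Hpb by auto. ring.
    + intros k Hk. rewrite <- sumn_scal. apply sumn_ext. intros; ring.
  - rewrite (sumn_ext n _ (fun _ => 0)); [apply sumn_zero|].
    intros k Hk. rewrite Hfix by auto. ring.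
Qed.

(** B must invert the Jacobian on all of D, and smoothly: the local inverse g has derivative B
    composed with g, from which its own smoothness is bootstrapped. *)
Theorem inverse_function n D (f : (nat -> R) -> nat -> R) P B x0 :
  open_n n D -> smooth_map_on n D f ->
  (forall i j x, (i < n)%nat -> (j < n)%nat -> D x ->
     derivable_pt_lim (fun t => f (upd x j t) i) (x j) (P i j x)) ->
  (forall i j, (i < n)%nat -> (j < n)%nat -> smooth_on n D (B i j)) ->
  (forall x i j, D x -> (i < n)%nat -> (j < n)%nat ->
     sumn n (fun k => P i k x * B k j x) = kron i j) ->
  (forall x i j, D x -> (i < n)%nat -> (j < n)%nat ->
     sumn n (fun k => B i k x * P k j x) = kron i j) ->
  D x0 ->
  exists (U W : (nat -> R) -> Prop) (g : (nat -> R) -> nat -> R),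
    open_n n U /\ U x0 /\ (forall y, U y -> D y) /\ open_n n W /\ W (f x0) /\
    smooth_map_on n W g /\
    (forall y, U y -> W (f y) /\ eqn n (g (f y)) y) /\
    (forall z, W z -> U (g z) /\ eqn n (f (g z)) z).
Proof.
  intros HD Hf HP HB HPB HBP Hx0.
  set (b := fun i j => B i j x0).
  destruct (near_linear_on_ball n D f P b x0 HD Hf HP Hx0 (fun i j => HBP x0 i j Hx0))
    as [rho [Hrho [HDr Hlin]]].
  assert (Hpb : forall i j, (i < n)%nat -> (j < n)%nat ->
    sumn n (fun k => P i k x0 * b k j) = kron i j) by (intros; now apply HPB).
  clearbody b.
  (* W is exactly the condition under which [local_surjection] solves f x = z. Taking U as the
     preimage of W in the ball makes f and g mutually inverse between U and W. *)
  set (W := fun z => forall i, (i < n)%nat ->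
              Rabs (sumn n (fun k => b i k * (z k - f x0 k))) < rho / 4).
  set (U := fun x => ball n x0 rho x /\ W (f x)).
  assert (HfC : forall i, (i < n)%nat -> cont_on n D (fun x => f x i))
    by (intros i Hi; apply (Ck_cont n 0), Hf, Hi).
  assert (HWo : open_n n W).
  { intros z Hz.
    destruct (uniform_radius n (fun i d => forall w, ball n z d w ->
       Rabs (sumn n (fun k => b i k * (w k - f x0 k))) < rho / 4)) as [d [Hd H]].
    - intros i d d' HQ [_ Hle] w Hw. apply HQ. now apply ball_le with d'.
    - intros i Hi.
      assert (C : cont_on n (fun _ => True) (fun w => sumn n (fun k => b i k * (w k + -1 * f x0 k)))).
      { apply (Ck_cont n 0). apply (Ck_sumn n 0 _ n (fun k w => b i k * (w k + -1 * f x0 k))).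
        intros k Hk. apply Ck_mult; [apply Ck_const|]. apply Ck_plus; [now apply Ck_proj|].
        apply Ck_const. }
      assert (E : forall w, sumn n (fun k => b i k * (w k + -1 * f x0 k))
                   = sumn n (fun k => b i k * (w k - f x0 k)))
        by (intros; apply sumn_ext; intros; ring).
      destruct (C z Logic.I (rho / 4 - Rabs (sumn n (fun k => b i k * (z k - f x0 k)))))
        as [d [Hd H]]; [specialize (Hz i Hi); lra|].
      exists d. split; auto. intros w Hw. specialize (H w Logic.I Hw). rewrite !E in H.
      replace (sumn n (fun k => b i k * (w k - f x0 k))) with
        ((sumn n (fun k => b i k * (w k - f x0 k)) - sumn n (fun k => b i k * (z k - f x0 k)))
         + sumn n (fun k => b i k * (z k - f x0 k))) by ring.
      eapply Rle_lt_trans; [apply Rabs_triang|]. lra.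
    - exists d. split; auto. intros w Hw i Hi. now apply H. }
  (* f (g z) agrees with z only in the coordinates below n, so membership in W must be insensitive
     to the others. *)
  assert (HWe : forall z w, eqn n z w -> W z -> W w).
  { intros z w E Hz i Hi. specialize (Hz i Hi).
    rewrite (sumn_ext n _ (fun k => b i k * (z k - f x0 k))); auto.
    intros k Hk. now rewrite (E k Hk). }
  destruct (functional_choice (fun z x => W z -> ball n x0 rho x /\ eqn n (f x) z)) as [g Hg].
  (* x0 is a dummy value outside W; choice needs a total relation. *)
  { intros z. destruct (Classical_Prop.classic (W z)) as [Hz|Hz]; [|exists x0; tauto].
    destruct (local_surjection n f b (fun i j => P i j x0) x0 rho Hrho Hpb Hlin z Hz) as [x Hx].
    exists x; auto. }
  (* The local inverse is Lipschitz because f is a perturbation of an invertible linear map. *)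
  assert (Hlip : forall x y, ball n x0 rho x -> ball n x0 rho y ->
    maxabs n (fun i => y i - x i)
      <= 2 * maxabs n (fun i => sumn n (fun k => b i k * (f y k - f x k)))).
  { intros x y Hx Hy.
    set (M := maxabs n (fun i => y i - x i)) in *.
    set (N := maxabs n (fun i => sumn n (fun k => b i k * (f y k - f x k)))).
    assert (HM : M <= / 2 * M + N).
    { apply maxabs_le.
      - pose proof (maxabs_nonneg n (fun i => y i - x i)) as H1. fold M in H1.
        pose proof (maxabs_nonneg n (fun i => sumn n (fun k => b i k * (f y k - f x k)))) as H2.
        fold N in H2. lra.
      - intros i Hi. specialize (Hlin x y i Hx Hy Hi).
        pose proof (maxabs_ge n (fun i => sumn n (fun k => b i k * (f y k - f x k))) i Hi) as HN.
        fold N in HN. cbv beta in HN, Hlin. fold M in Hlin.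
        replace (y i - x i) with ((y i - x i - sumn n (fun k => b i k * (f y k - f x k)))
          + sumn n (fun k => b i k * (f y k - f x k))) by ring.
        eapply Rle_trans; [apply Rabs_triang|]. lra. }
    lra. }
  set (K := 2 * (sumn n (fun i => sumn n (fun k => Rabs (b i k))) + 1)).
  assert (HK : 0 < K).
  { assert (0 <= sumn n (fun i => sumn n (fun k => Rabs (b i k))))
      by (apply sumn_nonneg; intros; apply sumn_nonneg; intros; apply Rabs_pos). unfold K. lra. }
  assert (HgL : forall z w M, W z -> W w -> 0 <= M -> (forall i, (i < n)%nat -> Rabs (w i - z i) <= M) ->
     forall i, (i < n)%nat -> Rabs (g w i - g z i) <= K * M).
  { intros z w M Hz Hw HM Hzw i Hi. destruct (Hg z Hz) as [Bz Ez]. destruct (Hg w Hw) as [Bw Ew].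
    pose proof (maxabs_ge n (fun i => g w i - g z i) i Hi) as H1. simpl in H1.
    pose proof (Hlip _ _ Bz Bw) as H2.
    eapply Rle_trans; [exact H1|]. eapply Rle_trans; [exact H2|].
    unfold K. rewrite Rmult_assoc. apply Rmult_le_compat_l; [lra|].
    assert (Hs : forall j, (j < n)%nat -> 0 <= sumn n (fun k => Rabs (b j k)))
      by (intros; apply sumn_nonneg; intros; apply Rabs_pos).
    apply maxabs_le.
    - apply Rmult_le_pos; auto.
      assert (0 <= sumn n (fun i => sumn n (fun k => Rabs (b i k)))) by (apply sumn_nonneg; auto). lra.
    - intros j Hj. eapply Rle_trans; [apply sumn_abs|].
      apply Rle_trans with (sumn n (fun k => M * Rabs (b j k))).
      + apply sumn_le. intros k Hk. rewrite Rabs_mult, Rmult_comm.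
        apply Rmult_le_compat_r; [apply Rabs_pos|].
        rewrite (Ez k Hk), (Ew k Hk). auto.
      + rewrite sumn_scal, Rmult_comm. apply Rmult_le_compat_r; auto.
        assert (H3 := sumn_term_le n (fun i => sumn n (fun k => Rabs (b i k))) j Hs Hj).
        simpl in H3. lra. }
  assert (HgD : forall z, W z -> D (g z)) by (intros z Hz; apply HDr; now apply Hg).
  assert (HgC : forall i, (i < n)%nat -> cont_on n W (fun z => g z i)).
  { intros i Hi z Hz e He. exists (e / (2 * K)). split; [apply Rdiv_lt_0_compat; lra|].
    intros w Hw Hb'. apply Rle_lt_trans with (K * (e / (2 * K))).
    - apply HgL; auto.
      + left. apply Rdiv_lt_0_compat; lra.
      + intros j Hj. left. now apply Hb'.
    - replace (K * (e / (2 * K))) with (e / 2) by (field; lra). lra. }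
  assert (Hgd : forall i j z, (i < n)%nat -> (j < n)%nat -> W z ->
     derivable_pt_lim (fun t => g (upd z j t) i) (z j) (B i j (g z))).
  { intros i j z Hi Hj Hz. apply increment_derivable_pt_lim. intros e He.
    set (x := g z). assert (Dx : D x) by (apply HgD; auto).
    set (C := sumn n (fun k => Rabs (B i k x))).
    assert (HC : 0 <= C) by (apply sumn_nonneg; intros; apply Rabs_pos).
    assert (Hn : 0 <= INR n) by apply pos_INR.
    (* The remainder of f is amplified by the l^1 norm C of row i of B, by the n coordinates of the
       l^1 norm and by the Lipschitz constant K of g. *)
    set (e1 := e / ((C + 1) * (INR n + 1) * K)).
    assert (Hden : 0 < (C + 1) * (INR n + 1) * K).
    { apply Rmult_lt_0_compat; auto. apply Rmult_lt_0_compat; lra. }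
    assert (He1 : 0 < e1) by (apply Rdiv_lt_0_compat; auto).
    destruct (uniform_radius n (fun k d => forall y, ball n x d y ->
       Rabs (f y k - f x k - sumn n (fun l => P k l x * (y l - x l)))
         <= e1 * sumn n (fun l => Rabs (y l - x l)))) as [d [Hd H]].
    { intros k d d' HQ [_ Hle] y Hy. apply HQ. now apply ball_le with d'. }
    { intros k Hk. destruct (differentiable n D (fun x => f x k) (P k) x HD (HfC k Hk) Dx)
        with (e := e1) as [d [Hd H]]; auto.
      - intros l Hl. apply (Ck_cont n 0).
        now apply (smooth_on_partial n D (fun x => f x k) l (P k l) HD (Hf k Hk)); auto.
      - exists d. split; auto. intros y Hy. now apply H. }
    destruct (open_upd n W z j HWo Hz) as [d1 [Hd1 HW1]].
    exists (Rmin d1 (d / (2 * K))). split; [apply Rmin_pos; auto; apply Rdiv_lt_0_compat; lra|].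
    intros t Ht. rewrite upd_id.
    assert (Wt : W (upd z j t)) by (apply HW1; eapply Rlt_le_trans; [exact Ht|apply Rmin_l]).
    assert (Ht2 := Rlt_le_trans _ _ _ Ht (Rmin_r _ _)).
    set (y := g (upd z j t)). fold x.
    assert (Hyx : forall l, (l < n)%nat -> Rabs (y l - x l) <= K * Rabs (t - z j)).
    { apply HgL; auto; [apply Rabs_pos|]. intros l Hl. destruct (Nat.eq_dec l j) as [->|Hn'].
      - rewrite upd_same. lra.
      - rewrite upd_other, Rminus_diag, Rabs_R0 by auto. apply Rabs_pos. }
    assert (Hby : ball n x d y).
    { intros l Hl. eapply Rle_lt_trans; [apply Hyx; auto|].
      apply Rmult_lt_compat_l with (r := K) in Ht2; auto.
      replace (K * (d / (2 * K))) with (d / 2) in Ht2 by (field; lra). lra. }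
    assert (Hfy : forall k, (k < n)%nat -> f y k - f x k = kron k j * (t - z j)).
    { intros k Hk. destruct (Hg _ Wt) as [_ E1]. destruct (Hg _ Hz) as [_ E2].
      fold x in E2. fold y in E1. rewrite (E1 k Hk), (E2 k Hk).
      destruct (Nat.eq_dec k j) as [->|Hn'].
      - rewrite upd_same, kron_refl. ring.
      - rewrite upd_other, kron_neq by auto. ring. }
    (* Apply B to the linear approximation f y - f x = P (y - x) + remainder. Since BP = I and f y -
       f x is (t - z_j) times the j-th unit vector, only B applied to the remainder is left. *)
    assert (Key : y i - x i - B i j x * (t - z j)
      = - sumn n (fun k => B i k x * (f y k - f x k - sumn n (fun l => P k l x * (y l - x l))))).
    { rewrite (sumn_ext n _ (fun k => (t - z j) * (B i k x * kron k j)
         - sumn n (fun l => (y l - x l) * (B i k x * P k l x)))).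
      2:{ intros k Hk. rewrite Hfy by auto. rewrite Rmult_minus_distr_l. f_equal; [ring|].
          rewrite <- sumn_scal. apply sumn_ext. intros; ring. }
      rewrite sumn_minus, sumn_scal, sumn_kron_r, sumn_swap by auto.
      rewrite (sumn_ext n (fun l => sumn n (fun k => (y l - x l) * (B i k x * P k l x)))
        (fun l => kron i l * (y l - x l))).
      - rewrite sumn_kron_l by auto. ring.
      - intros l Hl. rewrite sumn_scal, HBP by auto. ring. }
    rewrite Key, Rabs_Ropp.
    eapply Rle_trans; [apply sumn_abs|].
    assert (Hsum : sumn n (fun l => Rabs (y l - x l)) <= INR n * (K * Rabs (t - z j))).
    { rewrite <- sumn_const. apply sumn_le. auto. }
    apply Rle_trans with (sumn n (fun k => (e1 * (INR n * (K * Rabs (t - z j)))) * Rabs (B i k x))).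
    - apply sumn_le. intros k Hk. rewrite Rabs_mult, Rmult_comm.
      apply Rmult_le_compat_r; [apply Rabs_pos|].
      eapply Rle_trans; [apply H; auto|]. apply Rmult_le_compat_l; lra.
    - rewrite sumn_scal. fold C.
      replace (e1 * (INR n * (K * Rabs (t - z j))) * C)
        with (e1 * (C * INR n * K) * Rabs (t - z j)) by ring.
      apply Rmult_le_compat_r; [apply Rabs_pos|].
      replace e with (e1 * ((C + 1) * (INR n + 1) * K)) by (unfold e1; field; lra).
      apply Rmult_le_compat_l; [lra|]. apply Rmult_le_compat_r; [lra|].
      apply Rmult_le_compat; lra. }
  exists U, W, g.
  assert (HWx : W (f x0)).
  { intros i Hi. rewrite (sumn_ext n _ (fun _ => 0)) by (intros; ring).
    rewrite sumn_zero, Rabs_R0. lra. }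
  split; [|split; [|split; [|split; [|split; [|split; [|split]]]]]]; auto.
  - apply (open_preimage n (ball n x0 rho) n W (fun i x => f x i)); auto.
    + apply open_ball.
    + intros i Hi. apply cont_on_sub with D; auto.
  - split; auto. now apply ball_refl.
  - intros y [Hy _]. auto.
  (* Bootstrapping: if g is C^k, then so is its derivative, B composed with g, and g is C^(k+1). *)
  - intros i Hi k. revert i Hi. induction k as [|k IH]; intros i Hi; [now apply HgC|].
    split; [now apply HgC|]. intros j Hj. exists (fun z => B i j (g z)). split; auto.
    apply (Ck_comp n W n D k (B i j) (fun i z => g z i)); auto. now apply HB.
  - intros y [Hy Wy]. split; auto. destruct (Hg _ Wy) as [Hb' Ef].
    assert (Hz : maxabs n (fun i => g (f y) i - y i) <= 0).
    { eapply Rle_trans; [apply Hlip; auto|].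
      assert (maxabs n (fun i => sumn n (fun k => b i k * (f (g (f y)) k - f y k))) <= 0); [|lra].
      apply maxabs_le; [lra|]. intros i Hi.
      rewrite (sumn_ext n _ (fun _ => 0)) by (intros k Hk; rewrite (Ef k Hk); ring).
      rewrite sumn_zero, Rabs_R0. lra. }
    intros i Hi. pose proof (maxabs_ge n (fun i => g (f y) i - y i) i Hi) as Hm. simpl in Hm.
    apply Rminus_diag_uniq. destruct (Req_dec (g (f y) i - y i) 0) as [|Hn']; auto.
    pose proof (Rabs_pos_lt _ Hn'). lra.
  - intros z Hz. destruct (Hg z Hz) as [Hb' Ef]. split; auto. split; auto.
    apply HWe with z; auto. intros i Hi. symmetry. auto.
Qed.

(** * Definiteness of the variation of the angles of a triangle *)

Definition qform3 (m11 m12 m13 m21 m22 m23 m31 m32 m33 v1 v2 v3 : R) : R :=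
  v1 * (m11 * v1 + m12 * v2 + m13 * v3) + v2 * (m21 * v1 + m22 * v2 + m23 * v3)
  + v3 * (m31 * v1 + m32 * v2 + m33 * v3).

(** Sylvester's criterion by completing squares in the order v3, v1, v2. Here a is the minor on the
    indices 1, 3 and d the determinant. *)
Lemma qform3_posdef m11 m12 m13 m22 m23 m33 v1 v2 v3 :
  0 < m33 -> 0 < m11 * m33 - m13 * m13 ->
  0 < m11 * (m22 * m33 - m23 * m23) - m12 * (m12 * m33 - m23 * m13) + m13 * (m12 * m23 - m22 * m13) ->
  0 <= qform3 m11 m12 m13 m12 m22 m23 m13 m23 m33 v1 v2 v3 /\
  (qform3 m11 m12 m13 m12 m22 m23 m13 m23 m33 v1 v2 v3 = 0 -> v1 = 0 /\ v2 = 0 /\ v3 = 0).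
Proof.
  intros H3 Ha Hdet.
  set (F := qform3 _ _ _ _ _ _ _ _ _ _ _ _).
  set (a := m11 * m33 - m13 * m13) in *.
  set (d := m11 * (m22 * m33 - m23 * m23) - _ + _) in *.
  set (h := m33 * m12 - m13 * m23).
  assert (E : a * m33 * F = a * (m33 * v3 + m13 * v1 + m23 * v2) ^ 2
      + (a * v1 + h * v2) ^ 2 + m33 * d * v2 ^ 2)
    by (unfold F, a, d, h, qform3; ring).
  assert (Hp : 0 < a * m33) by now apply Rmult_lt_0_compat.
  assert (Hmd : 0 < m33 * d) by now apply Rmult_lt_0_compat.
  pose proof (pow2_ge_0 (m33 * v3 + m13 * v1 + m23 * v2)) as Q1.
  pose proof (pow2_ge_0 (a * v1 + h * v2)) as Q2.
  pose proof (pow2_ge_0 v2) as Q3.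
  assert (0 <= a * (m33 * v3 + m13 * v1 + m23 * v2) ^ 2) by (apply Rmult_le_pos; lra).
  assert (0 <= m33 * d * v2 ^ 2) by (apply Rmult_le_pos; lra).
  split.
  - apply Rmult_le_reg_l with (a * m33); lra.
  - intros HF. rewrite HF, Rmult_0_r in E.
    assert (Z2 : v2 = 0).
    { assert (m33 * d * v2 ^ 2 = 0) as Z by lra. apply Rmult_integral in Z.
      destruct Z; [lra|]. nra. }
    assert (Z1 : v1 = 0).
    { assert ((a * v1 + h * v2) ^ 2 = 0) as Z by lra. rewrite Z2 in Z.
      assert (Z' : a * v1 = 0) by nra. apply Rmult_integral in Z'. destruct Z'; [lra|auto]. }
    assert (Z3 : v3 = 0).
    { assert (a * (m33 * v3 + m13 * v1 + m23 * v2) ^ 2 = 0) as Z by lra.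
      rewrite Z1, Z2 in Z. apply Rmult_integral in Z. destruct Z as [|Z]; [lra|].
      assert (Z' : m33 * v3 = 0) by nra. apply Rmult_integral in Z'. destruct Z'; [lra|auto]. }
    auto.
Qed.

(* The matrix of the variation of the angles of a hyperbolic triangle (up to the factor
   [- sqrt D]) in terms of the cosh of its sides and their partial derivatives
   [x], [y], [z] with respect to the three vertex parameters. *)
Lemma hyperbolic_variation_posdef L12 L13 L23 x12 x13 y12 y23 z13 z23 v1 v2 v3 :
  let c1 := L12 * L13 - L23 in
  let c2 := L12 * L23 - L13 in
  let c3 := L13 * L23 - L12 in
  let S12 := L12 * L12 - 1 in
  let S13 := L13 * L13 - 1 in
  let S23 := L23 * L23 - 1 in
  let m11 := x12 * c2 / S12 + x13 * c3 / S13 in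
  let m12 := y12 * c2 / S12 - y23 in
  let m13 := z13 * c3 / S13 - z23 in
  let m21 := x12 * c1 / S12 - x13 in
  let m22 := y12 * c1 / S12 + y23 * c3 / S23 in
  let m23 := z23 * c3 / S23 - z13 in
  let m31 := x13 * c1 / S13 - x12 in
  let m32 := y23 * c2 / S23 - y12 in
  let m33 := z13 * c1 / S13 + z23 * c2 / S23 in
  1 < L12 -> 1 < L13 -> 1 < L23 -> c1 * c1 < S12 * S13 ->
  0 < x12 -> 0 < x13 -> 0 < y12 -> 0 < y23 -> 0 < z13 -> 0 < z23 ->
  m12 = m21 -> m13 = m31 -> m23 = m32 -> m13 < 0 -> m23 < 0 ->
  0 <= qform3 m11 m12 m13 m21 m22 m23 m31 m32 m33 v1 v2 v3 /\
  (qform3 m11 m12 m13 m21 m22 m23 m31 m32 m33 v1 v2 v3 = 0 -> v1 = 0 /\ v2 = 0 /\ v3 = 0).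
Proof.
  intros c1 c2 c3 S12 S13 S23 m11 m12 m13 m21 m22 m23 m31 m32 m33
    H12 H13 H23 HD Hx12 Hx13 Hy12 Hy23 Hz13 Hz23 E12 E13 E23 N13 N23.
  assert (P12 : 0 < S12) by (unfold S12; nra).
  assert (P13 : 0 < S13) by (unfold S13; nra).
  assert (P23 : 0 < S23) by (unfold S23; nra).
  set (D := S12 * S13 - c1 * c1). assert (PD : 0 < D) by (unfold D; lra).
  assert (PS : 0 < S12 * S13 * S23) by (repeat apply Rmult_lt_0_compat; auto).
  (* A weighted column relation replaces the vanishing column sums of the Euclidean case. It makes
     m33 positive as soon as m13 and m23 are negative. *)
  assert (M33 : m33 = - L13 * m13 - L23 * m23).
  { unfold m33, m13, m23, c1, c2, c3, S13, S23 in *. field. lra. }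
  assert (P33 : 0 < m33) by (rewrite M33; nra).
  (* The matrix factors through the sides. The sum of two triple products is, up to sign, the
     determinant of the derivative of the sides in the vertex parameters; the rest comes from the
     angles as functions of the sides. *)
  assert (Det : m11 * (m22 * m33 - m23 * m32) - m12 * (m21 * m33 - m23 * m31)
                + m13 * (m21 * m32 - m22 * m31)
                = D * D * (x12 * y23 * z13 + x13 * y12 * z23) / (S12 * S13 * S23)).
  { unfold m11, m12, m13, m21, m22, m23, m31, m32, m33, D, c1, c2, c3, S12, S13, S23 in *.
    field. lra. }
  assert (Min1 : m22 * m33 - m23 * m32
     = D * (y12 * (L12 * (z23 * S13) - z13 * S23) + y23 * z13 * L13 * S12) / (S12 * S13 * S23)).
  { unfold m22, m23, m32, m33, D, c1, c2, c3, S12, S13, S23 in *. field. lra. }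
  assert (Min2 : m11 * m33 - m13 * m31
     = D * (x12 * (L12 * (z13 * S23) - z23 * S13) + x13 * z23 * L23 * S12) / (S12 * S13 * S23)).
  { unfold m11, m13, m31, m33, D, c1, c2, c3, S12, S13, S23 in *. field. lra. }
  assert (PDet : 0 < m11 * (m22 * m33 - m23 * m32) - m12 * (m21 * m33 - m23 * m31)
                + m13 * (m21 * m32 - m22 * m31)).
  { rewrite Det. apply Rdiv_lt_0_compat; auto. apply Rmult_lt_0_compat; [nra|].
    assert (0 < x12 * y23 * z13) by (repeat apply Rmult_lt_0_compat; auto).
    assert (0 < x13 * y12 * z23) by (repeat apply Rmult_lt_0_compat; auto). lra. }
  (* Since L12 > 1, the brackets [L12 X - Y] and [L12 Y - X] cannot both be negative. *)
  assert (One : 0 < m22 * m33 - m23 * m32 \/ 0 < m11 * m33 - m13 * m31).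
  { rewrite Min1, Min2.
    assert (T1 : 0 < y23 * z13 * L13 * S12) by (repeat apply Rmult_lt_0_compat; lra).
    assert (T2 : 0 < x13 * z23 * L23 * S12) by (repeat apply Rmult_lt_0_compat; lra).
    assert (PX : 0 < z23 * S13) by now apply Rmult_lt_0_compat.
    assert (PY : 0 < z13 * S23) by now apply Rmult_lt_0_compat.
    set (X := z23 * S13) in *. set (Y := z13 * S23) in *.
    destruct (Rle_lt_dec X Y) as [Hle|Hlt].
    - right. apply Rdiv_lt_0_compat; auto. apply Rmult_lt_0_compat; auto.
      assert (0 <= x12 * (L12 * Y - X)) by (apply Rmult_le_pos; nra). lra.
    - left. apply Rdiv_lt_0_compat; auto. apply Rmult_lt_0_compat; auto.
      assert (0 <= y12 * (L12 * X - Y)) by (apply Rmult_le_pos; nra). lra. }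
  clear Det Min1 Min2 M33.
  rewrite <- E12, <- E13, <- E23 in *.
  clearbody m11 m12 m13 m22 m23 m33.
  (* Jacobi's identity for minors: m33 times the determinant is the product of the two minors
     containing index 3 minus a square. As the left side is positive, the two minors have the same
     sign, so positivity of either suffices. *)
  assert (Syl : m33 * (m11 * (m22 * m33 - m23 * m23) - m12 * (m12 * m33 - m23 * m13)
                + m13 * (m12 * m23 - m22 * m13))
      = (m11 * m33 - m13 * m13) * (m22 * m33 - m23 * m23) - (m12 * m33 - m13 * m23) ^ 2) by ring.
  apply qform3_posdef; auto.
  pose proof (Rmult_lt_0_compat _ _ P33 PDet) as Hpos. rewrite Syl in Hpos.
  pose proof (pow2_ge_0 (m12 * m33 - m13 * m23)).
  destruct One as [One|One]; auto.
  apply Rmult_lt_reg_r with (m22 * m33 - m23 * m23); auto. lra.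
Qed.

Lemma euclidean_variation_semidef g12 g13 g23 x12 x13 y12 y23 z13 z23 v1 v2 v3 :
  let c1 := (g12 + g13 - g23) / 2 in
  let c2 := (g12 + g23 - g13) / 2 in
  let c3 := (g13 + g23 - g12) / 2 in
  let m11 := x12 * c2 / g12 + x13 * c3 / g13 in
  let m12 := y12 * c2 / g12 - y23 in
  let m13 := z13 * c3 / g13 - z23 in
  let m21 := x12 * c1 / g12 - x13 in
  let m22 := y12 * c1 / g12 + y23 * c3 / g23 in
  let m23 := z23 * c3 / g23 - z13 in
  let m31 := x13 * c1 / g13 - x12 in
  let m32 := y23 * c2 / g23 - y12 in
  let m33 := z13 * c1 / g13 + z23 * c2 / g23 in
  0 < g12 -> 0 < g13 -> 0 < g23 -> c1 * c1 < g12 * g13 ->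
  0 < x12 -> 0 < x13 -> 0 < y12 -> 0 < y23 -> 0 < z13 -> 0 < z23 ->
  m12 = m21 -> m13 = m31 -> m23 = m32 -> m13 < 0 -> m23 < 0 ->
  0 <= qform3 m11 m12 m13 m21 m22 m23 m31 m32 m33 v1 v2 v3 /\
  (qform3 m11 m12 m13 m21 m22 m23 m31 m32 m33 v1 v2 v3 = 0 -> v1 = v2 /\ v2 = v3).
Proof.
  intros c1 c2 c3 m11 m12 m13 m21 m22 m23 m31 m32 m33
    P12 P13 P23 HD Hx12 Hx13 Hy12 Hy23 Hz13 Hz23 E12 E13 E23 N13 N23.
  set (D := g12 * g13 - c1 * c1). assert (PD : 0 < D) by (unfold D; lra).
  assert (PS : 0 < g12 * g13 * g23) by (repeat apply Rmult_lt_0_compat; auto).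
  (* This and the next two relations say that the columns sum to zero: the angle sum of a Euclidean
     triangle is constant. *)
  assert (M33 : m33 = - m13 - m23).
  { unfold m33, m13, m23, c1, c2, c3 in *. field. lra. }
  assert (M22 : m22 = - m12 - m32).
  { unfold m22, m12, m32, c1, c2, c3 in *. field. lra. }
  assert (M11 : m11 = - m21 - m31).
  { unfold m11, m21, m31, c1, c2, c3 in *. field. lra. }
  assert (Min1 : m22 * m33 - m23 * m32
     = D * (y12 * (z23 * g13 - z13 * g23) + y23 * z13 * g12) / (g12 * g13 * g23)).
  { unfold m22, m23, m32, m33, D, c1, c2, c3 in *. field. lra. }
  assert (Min2 : m11 * m33 - m13 * m31
     = D * (x12 * (z13 * g23 - z23 * g13) + x13 * z23 * g12) / (g12 * g13 * g23)).
  { unfold m11, m13, m31, m33, D, c1, c2, c3 in *. field. lra. }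
  assert (One : 0 < m22 * m33 - m23 * m32 \/ 0 < m11 * m33 - m13 * m31).
  { rewrite Min1, Min2.
    assert (T1 : 0 < y23 * z13 * g12) by (repeat apply Rmult_lt_0_compat; lra).
    assert (T2 : 0 < x13 * z23 * g12) by (repeat apply Rmult_lt_0_compat; lra).
    set (X := z23 * g13) in *. set (Y := z13 * g23) in *.
    destruct (Rle_lt_dec X Y) as [Hle|Hlt].
    - right. apply Rdiv_lt_0_compat; auto. apply Rmult_lt_0_compat; auto.
      assert (0 <= x12 * (Y - X)) by (apply Rmult_le_pos; lra). lra.
    - left. apply Rdiv_lt_0_compat; auto. apply Rmult_lt_0_compat; auto.
      assert (0 <= y12 * (X - Y)) by (apply Rmult_le_pos; lra). lra. }
  clear Min1 Min2.
  rewrite M11, M22, M33 in *. rewrite <- E12, <- E13, <- E23 in *.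
  clearbody m12 m13 m23.
  (* Because rows and columns sum to zero, q is the common value of all three principal 2 by 2
     minors. *)
  set (q := m12 * m13 + m12 * m23 + m13 * m23).
  assert (Hq : 0 < q) by (unfold q; destruct One; lra).
  set (F := qform3 _ _ _ _ _ _ _ _ _ _ _ _).
  assert (E : (- m13 - m23) * F = (m13 * (v1 - v3) + m23 * (v2 - v3)) ^ 2 + q * (v1 - v2) ^ 2)
    by (unfold F, q, qform3; ring).
  pose proof (pow2_ge_0 (m13 * (v1 - v3) + m23 * (v2 - v3))) as Q1.
  pose proof (pow2_ge_0 (v1 - v2)) as Q2.
  assert (0 <= q * (v1 - v2) ^ 2) by (apply Rmult_le_pos; lra).
  split.
  - apply Rmult_le_reg_l with (- m13 - m23); lra.
  - intros HF. rewrite HF, Rmult_0_r in E.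
    assert (Z1 : v1 - v2 = 0).
    { assert (q * (v1 - v2) ^ 2 = 0) as Z by lra. apply Rmult_integral in Z.
      destruct Z; [lra|]. nra. }
    assert (Z2 : (m13 + m23) * (v2 - v3) = 0).
    { assert ((m13 * (v1 - v3) + m23 * (v2 - v3)) ^ 2 = 0) as Z by lra.
      replace (v1 - v3) with (v2 - v3) in Z by lra. nra. }
    apply Rmult_integral in Z2. destruct Z2; lra.
Qed.

(** * Position of the radical centre *)

(** Both inequalities force p, q >= 1. They then read Y p q <= X (p^2 - 1) and X p q <= Y (q^2 - 1),
    whose product gives p^2 + q^2 <= 1, a contradiction. *)
Lemma at_most_one_obtuse X Y p q w T1 T2 :
  0 < X -> 0 < Y -> 0 <= p -> 0 <= q -> 0 <= w -> 0 <= T1 -> 0 <= T2 ->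
  X * (1 - p * p) + Y * (w + p * q) + T1 <= 0 ->
  Y * (1 - q * q) + X * (w + p * q) + T2 <= 0 -> False.
Proof.
  intros HX HY Hp Hq Hw H1 H2 A B.
  assert (Hpq : 0 <= p * q) by now apply Rmult_le_pos.
  assert (C1 : 0 <= Y * (w + p * q)) by (apply Rmult_le_pos; lra).
  assert (C2 : 0 <= X * (w + p * q)) by (apply Rmult_le_pos; lra).
  assert (Gp : 1 <= p).
  { apply Rnot_lt_le. intros Hlt.
    assert (0 < X * (1 - p * p)) by (apply Rmult_lt_0_compat; nra). lra. }
  assert (Gq : 1 <= q).
  { apply Rnot_lt_le. intros Hlt.
    assert (0 < Y * (1 - q * q)) by (apply Rmult_lt_0_compat; nra). lra. }
  assert (A' : Y * (p * q) <= X * (p * p - 1)) by nra.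
  assert (B' : X * (p * q) <= Y * (q * q - 1)) by nra.
  assert (Pq : 0 < p * q) by nra.
  assert (M : (Y * (p * q)) * (X * (p * q)) <= (X * (p * p - 1)) * (Y * (q * q - 1)))
    by (apply Rmult_le_compat; nra).
  assert (XY : 0 < X * Y) by nra.
  assert (M' : (X * Y) * ((p * q) * (p * q)) <= (X * Y) * ((p * p - 1) * (q * q - 1))) by lra.
  apply Rmult_le_reg_l in M'; [nra|auto].
Qed.

(* [edge x y p] is the squared length (Euclidean case) or the cosh of the length
   (hyperbolic case) of the side joining two circles of radii x, y with inversive distance p;
   [dedge x y p] is its derivative (half of it in the Euclidean case) in the parameter u
   with dx = rad x du; the angle between sides e1, e2 opposite to e3 is
   acos (cosnum e1 e2 e3 / (sqrt (sinsq e1) * sqrt (sinsq e2))). *)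
Record geometry := Geometry {
  edge : R -> R -> R -> R;
  dedge : R -> R -> R -> R;
  cosnum : R -> R -> R -> R;
  sinsq : R -> R;
  rad : R -> R
}.

(* For a triangle x, y, z with inversive distances p (xy), q (xz), w (yz): [- sqrt gram] times
   the derivative of the angle at x in the parameter of x ([own]) or of y ([nb]). *)
Definition own (G : geometry) (x y z p q w : R) : R :=
  dedge G x y p * cosnum G (edge G x y p) (edge G y z w) (edge G x z q) / sinsq G (edge G x y p)
  + dedge G x z q * cosnum G (edge G x z q) (edge G y z w) (edge G x y p) / sinsq G (edge G x z q).

Definition nb (G : geometry) (x y z p q w : R) : R :=
  dedge G y x p * cosnum G (edge G x y p) (edge G y z w) (edge G x z q) / sinsq G (edge G x y p)
  - dedge G y z w.

Definition tri_form (G : geometry) (x y z p q w v1 v2 v3 : R) : R :=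
  qform3 (own G x y z p q w) (nb G x y z p q w) (nb G x z y q p w)
        (nb G y x z p w q) (own G y x z p w q) (nb G y z x w p q)
        (nb G z x y q w p) (nb G z y x w q p) (own G z x y q w p) v1 v2 v3.

(** The product of the two [sinsq] factors with the squared sine of the angle at x; four times the
    squared area in the Euclidean case. It is symmetric in the vertices, so the three angles share
    one denominator. *)
Definition gram (G : geometry) (x y z p q w : R) : R :=
  sinsq G (edge G x y p) * sinsq G (edge G x z q)
  - cosnum G (edge G x y p) (edge G x z q) (edge G y z w)
    * cosnum G (edge G x y p) (edge G x z q) (edge G y z w).

Lemma own_swap G x y z p q w :
  (forall x y p, edge G x y p = edge G y x p) -> own G x y z p q w = own G x z y q p w.
Proof.
  intros Hs. unfold own. rewrite (Hs z y w). ring.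
Qed.

Lemma tri_form_swap23 G x y z p q w v1 v2 v3 :
  (forall x y p, edge G x y p = edge G y x p) ->
  tri_form G x z y q p w v1 v3 v2 = tri_form G x y z p q w v1 v2 v3.
Proof.
  intros Hs. unfold tri_form, qform3. rewrite (own_swap G x z y) by auto. ring.
Qed.

Lemma tri_form_swap13 G x y z p q w v1 v2 v3 :
  (forall x y p, edge G x y p = edge G y x p) ->
  tri_form G z y x w q p v3 v2 v1 = tri_form G x y z p q w v1 v2 v3.
Proof.
  intros Hs. unfold tri_form, qform3. rewrite (own_swap G x z y), (own_swap G y z x), (own_swap G z y x) by auto. ring.
Qed.

Definition euclidean : geometry := {|
  edge := fun x y p => x ^ 2 + y ^ 2 + 2 * x * y * p;
  dedge := fun x y p => x * (x + p * y);
  cosnum := fun a b c => (a + b - c) / 2;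
  sinsq := fun e => e;
  rad := fun x => x
|}.

Definition hyperbolic : geometry := {|
  edge := fun x y p => cosh x * cosh y + p * sinh x * sinh y;
  dedge := fun x y p => sinh x * (sinh x * cosh y + p * cosh x * sinh y);
  cosnum := fun a b c => a * b - c;
  sinsq := fun e => e * e - 1;
  rad := sinh
|}.

Lemma edge_sym_E x y p : edge euclidean x y p = edge euclidean y x p.
Proof. simpl. ring. Qed.

Lemma edge_sym_H x y p : edge hyperbolic x y p = edge hyperbolic y x p.
Proof. simpl. ring. Qed.

Lemma gram_swap23_E x y z p q w : gram euclidean x z y q p w = gram euclidean x y z p q w.
Proof. unfold gram. simpl. field. Qed.

Lemma gram_swap13_E x y z p q w : gram euclidean z y x w q p = gram euclidean x y z p q w.
Proof. unfold gram. simpl. field. Qed.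

Lemma gram_swap23_H x y z p q w : gram hyperbolic x z y q p w = gram hyperbolic x y z p q w.
Proof. unfold gram. simpl. ring. Qed.

Lemma gram_swap13_H x y z p q w : gram hyperbolic z y x w q p = gram hyperbolic x y z p q w.
Proof. unfold gram. simpl. ring. Qed.

(* Up to positive factors, the signed distance from the radical centre of the three circles
   to the side joining the first two; it determines the sign of [nb]. *)
Definition radical (s1 c1 s2 c2 s3 c3 p q w : R) : R :=
  s1 * s2 * c3 * (1 - p * p) + s1 * c2 * s3 * (w + p * q) + c1 * s2 * s3 * (q + p * w).

Lemma radical_swap s1 c1 s2 c2 s3 c3 p q w :
  radical s2 c2 s1 c1 s3 c3 p w q = radical s1 c1 s2 c2 s3 c3 p q w.
Proof. unfold radical. ring. Qed.

(** The two quantities belong to the two sides at vertex 1. Their last summands are nonnegative, and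
    the other terms share the coefficients s1 s2 c3 and s1 c2 s3, with the roles of p and q
    exchanged. *)
Lemma radical_nonpos_once s1 c1 s2 c2 s3 c3 p q w :
  0 < s1 -> 0 < s2 -> 0 < s3 -> 0 < c1 -> 0 < c2 -> 0 < c3 -> 0 <= p -> 0 <= q -> 0 <= w ->
  radical s1 c1 s2 c2 s3 c3 p q w <= 0 -> radical s1 c1 s3 c3 s2 c2 q p w <= 0 -> False.
Proof.
  intros S1 S2 S3 C1 C2 C3 Hp Hq Hw A B. unfold radical in *.
  assert (P1 : 0 <= c1 * s2 * s3 * (q + p * w)).
  { apply Rmult_le_pos; [|nra]. left. repeat apply Rmult_lt_0_compat; auto. }
  assert (P2 : 0 <= c1 * s3 * s2 * (p + q * w)).
  { apply Rmult_le_pos; [|nra]. left. repeat apply Rmult_lt_0_compat; auto. }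
  apply (at_most_one_obtuse (s1 * s2 * c3) (s1 * c2 * s3) p q w
    (c1 * s2 * s3 * (q + p * w)) (c1 * s3 * s2 * (p + q * w))); auto;
    try (repeat apply Rmult_lt_0_compat; assumption); lra.
Qed.

(** The alternatives are grouped by the vertex common to the two good sides: 3, 2 or 1. Renumbering
    reduces each of them to the first. *)
Lemma two_radical_pos s1 c1 s2 c2 s3 c3 p q w :
  0 < s1 -> 0 < s2 -> 0 < s3 -> 0 < c1 -> 0 < c2 -> 0 < c3 -> 0 <= p -> 0 <= q -> 0 <= w ->
  let h12 := radical s1 c1 s2 c2 s3 c3 p q w in
  let h13 := radical s1 c1 s3 c3 s2 c2 q p w in
  let h23 := radical s2 c2 s3 c3 s1 c1 w p q in
  (0 < h13 /\ 0 < h23) \/ (0 < h12 /\ 0 < h23) \/ (0 < h13 /\ 0 < h12).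
Proof.
  intros S1 S2 S3 C1 C2 C3 Hp Hq Hw h12 h13 h23.
  destruct (Rlt_le_dec 0 h12) as [A|A]; destruct (Rlt_le_dec 0 h13) as [B|B];
    destruct (Rlt_le_dec 0 h23) as [C|C]; auto; exfalso.
  - apply (radical_nonpos_once s3 c3 s1 c1 s2 c2 q w p); auto.
    + rewrite radical_swap. auto.
    + rewrite radical_swap. auto.
  - apply (radical_nonpos_once s2 c2 s1 c1 s3 c3 p w q); auto. rewrite radical_swap. auto.
  - apply (radical_nonpos_once s1 c1 s2 c2 s3 c3 p q w); auto.
  - apply (radical_nonpos_once s1 c1 s2 c2 s3 c3 p q w); auto.
Qed.

(** * Euclidean triangles *)

Lemma edge_pos_E x y p : 0 < x -> 0 < y -> 0 <= p -> 0 < edge euclidean x y p.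
Proof. intros. simpl. assert (0 <= x * y * p) by (apply Rmult_le_pos; nra). nra. Qed.

Lemma dedge_pos_E x y p : 0 < x -> 0 < y -> 0 <= p -> 0 < dedge euclidean x y p.
Proof. intros. simpl. apply Rmult_lt_0_compat; auto. nra. Qed.

(** The Euclidean case of [radical] has the radii for s and 1 for c. The formula gives the symmetry
    of the variation matrix as well as the sign of its entry. *)
Lemma nb_radical_E x y z p q w :
  0 < x -> 0 < y -> 0 <= p ->
  nb euclidean x y z p q w = - (x * y * radical x 1 y 1 z 1 p q w / edge euclidean x y p).
Proof.
  intros Hx Hy Hp. pose proof (edge_pos_E x y p Hx Hy Hp) as H.
  unfold nb, radical. simpl in *. field. lra.
Qed.

Lemma nb_sym_E x y z p q w :
  0 < x -> 0 < y -> 0 <= p -> nb euclidean x y z p q w = nb euclidean y x z p w q.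
Proof.
  intros. rewrite !nb_radical_E by auto. rewrite radical_swap, (edge_sym_E y x). field.
  apply Rgt_not_eq. now apply edge_pos_E.
Qed.

Lemma nb_neg_E x y z p q w :
  0 < x -> 0 < y -> 0 <= p -> 0 < radical x 1 y 1 z 1 p q w -> nb euclidean x y z p q w < 0.
Proof.
  intros. rewrite nb_radical_E by auto.
  apply Ropp_lt_gt_0_contravar. apply Rdiv_lt_0_compat; [|now apply edge_pos_E].
  apply Rmult_lt_0_compat; auto. nra.
Qed.

Lemma tri_form_E_vertex3 x y z p q w v1 v2 v3 :
  0 < x -> 0 < y -> 0 < z -> 0 <= p -> 0 <= q -> 0 <= w ->
  0 < gram euclidean x y z p q w ->
  0 < radical x 1 z 1 y 1 q p w -> 0 < radical y 1 z 1 x 1 w p q ->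
  0 <= tri_form euclidean x y z p q w v1 v2 v3 /\
  (tri_form euclidean x y z p q w v1 v2 v3 = 0 -> v1 = v2 /\ v2 = v3).
Proof.
  intros Hx Hy Hz Hp Hq Hw HD H13 H23.
  pose proof (nb_sym_E x y z p q w Hx Hy Hp) as E12.
  pose proof (nb_sym_E x z y q p w Hx Hz Hq) as E13.
  pose proof (nb_sym_E y z x w p q Hy Hz Hw) as E23.
  pose proof (nb_neg_E x z y q p w Hx Hz Hq H13) as N13.
  pose proof (nb_neg_E y z x w p q Hy Hz Hw H23) as N23.
  unfold gram in HD.
  pose proof (euclidean_variation_semidef (edge euclidean x y p) (edge euclidean x z q)
    (edge euclidean y z w) (dedge euclidean x y p) (dedge euclidean x z q)
    (dedge euclidean y x p) (dedge euclidean y z w) (dedge euclidean z x q)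
    (dedge euclidean z y w) v1 v2 v3) as L. cbv zeta in L.
  assert (N : forall a b c, cosnum euclidean a b c = cosnum euclidean b a c) by (intros; simpl; field).
  unfold tri_form, own, nb in *.
  rewrite ?(edge_sym_E y x p), ?(edge_sym_E z x q), ?(edge_sym_E z y w) in *.
  rewrite ?(N (edge euclidean y z w) (edge euclidean x z q)) in *.
  rewrite ?(N (edge euclidean x z q) (edge euclidean x y p)) in *.
  rewrite ?(N (edge euclidean y z w) (edge euclidean x y p)) in *.
  apply L; auto using edge_pos_E, dedge_pos_E.
  change (sinsq euclidean (edge euclidean x y p)) with (edge euclidean x y p) in HD.
  change (sinsq euclidean (edge euclidean x z q)) with (edge euclidean x z q) in HD.
  change (cosnum euclidean (edge euclidean x y p) (edge euclidean x z q) (edge euclidean y z w))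
    with ((edge euclidean x y p + edge euclidean x z q - edge euclidean y z w) / 2) in HD. lra.
Qed.

Lemma tri_form_E x y z p q w v1 v2 v3 :
  0 < x -> 0 < y -> 0 < z -> 0 <= p -> 0 <= q -> 0 <= w ->
  0 < gram euclidean x y z p q w ->
  0 <= tri_form euclidean x y z p q w v1 v2 v3 /\
  (tri_form euclidean x y z p q w v1 v2 v3 = 0 -> v1 = v2 /\ v2 = v3).
Proof.
  intros Hx Hy Hz Hp Hq Hw HD.
  destruct (two_radical_pos x 1 y 1 z 1 p q w) as [[A B]|[[A B]|[A B]]]; auto; try lra.
  - now apply tri_form_E_vertex3.
  - rewrite <- (tri_form_swap23 euclidean x y z p q w) by apply edge_sym_E.
    rewrite <- gram_swap23_E in HD. rewrite <- radical_swap in B.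
    destruct (tri_form_E_vertex3 x z y q p w v1 v3 v2) as [F Z]; auto.
    split; auto. intros E. destruct (Z E). lra.
  - rewrite <- (tri_form_swap13 euclidean x y z p q w) by apply edge_sym_E.
    rewrite <- gram_swap13_E in HD. rewrite <- radical_swap in A, B.
    destruct (tri_form_E_vertex3 z y x w q p v3 v2 v1) as [F Z]; auto.
    split; auto. intros E. destruct (Z E). lra.
Qed.

(** * Hyperbolic triangles *)

Lemma sinh_pos x : 0 < x -> 0 < sinh x.
Proof. intros H. rewrite <- sinh_0. now apply sinh_lt. Qed.

Lemma cosh_pos x : 0 < cosh x.
Proof. unfold cosh. pose proof (exp_pos x). pose proof (exp_pos (- x)). lra. Qed.

Lemma cosh2_sinh2 x : cosh x * cosh x = 1 + sinh x * sinh x.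
Proof.
  unfold cosh, sinh. assert (E : exp x * exp (- x) = 1) by (rewrite <- exp_plus, Rplus_opp_r; apply exp_0).
  replace ((exp x + exp (- x)) / 2 * ((exp x + exp (- x)) / 2))
    with ((exp x * exp x + exp (- x) * exp (- x) + 2 * (exp x * exp (- x))) / 4) by field.
  replace ((exp x - exp (- x)) / 2 * ((exp x - exp (- x)) / 2))
    with ((exp x * exp x + exp (- x) * exp (- x) - 2 * (exp x * exp (- x))) / 4) by field.
  rewrite E. field.
Qed.

Lemma cosh_gt_1 x : 0 < x -> 1 < cosh x.
Proof.
  intros H. pose proof (sinh_pos x H). pose proof (cosh_pos x). pose proof (cosh2_sinh2 x).
  apply Rnot_le_lt. intros Hle.
  assert (0 < sinh x * sinh x) by now apply Rmult_lt_0_compat.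
  assert (cosh x * cosh x <= 1 * 1) by (apply Rmult_le_compat; lra). lra.
Qed.

Lemma edge_gt1_H x y p : 0 < x -> 0 < y -> 0 <= p -> 1 < edge hyperbolic x y p.
Proof.
  intros Hx Hy Hp. simpl. pose proof (cosh_gt_1 x Hx). pose proof (cosh_gt_1 y Hy).
  pose proof (sinh_pos x Hx). pose proof (sinh_pos y Hy).
  assert (0 <= p * sinh x * sinh y)
    by (apply Rmult_le_pos; [apply Rmult_le_pos|]; lra).
  assert (1 * 1 < cosh x * cosh y) by (apply Rmult_le_0_lt_compat; lra). lra.
Qed.

Lemma sq_pos_H x y p : 0 < x -> 0 < y -> 0 <= p -> 0 < sinsq hyperbolic (edge hyperbolic x y p).
Proof. intros Hx Hy Hp.
  pose proof (edge_gt1_H x y p Hx Hy Hp) as H. set (e := edge hyperbolic x y p) in *.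
  change (0 < e * e - 1). nra.
Qed.

Lemma dedge_pos_H x y p : 0 < x -> 0 < y -> 0 <= p -> 0 < dedge hyperbolic x y p.
Proof.
  intros Hx Hy Hp. simpl. pose proof (cosh_pos x). pose proof (cosh_pos y).
  pose proof (sinh_pos x Hx). pose proof (sinh_pos y Hy).
  assert (0 <= p * cosh x * sinh y)
    by (apply Rmult_le_pos; [apply Rmult_le_pos|]; lra).
  apply Rmult_lt_0_compat; auto. assert (0 < sinh x * cosh y) by now apply Rmult_lt_0_compat. lra.
Qed.

Lemma radical_identity c1 c2 c3 s1 s2 s3 p q w :
  c1 * c1 = 1 + s1 * s1 -> c2 * c2 = 1 + s2 * s2 ->
  let L12 := c1 * c2 + p * s1 * s2 in
  let L13 := c1 * c3 + q * s1 * s3 in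
  let L23 := c2 * c3 + w * s2 * s3 in
  s2 * (s2 * c3 + w * c2 * s3) * (L12 * L12 - 1)
  - s2 * (s2 * c1 + p * c2 * s1) * (L12 * L23 - L13)
  = s1 * s2 * radical s1 c1 s2 c2 s3 c3 p q w.
Proof.
  intros H1 H2 L12 L13 L23. apply Rminus_diag_uniq.
  (* A certificate: the difference is a combination of the two relations c^2 - (1 + s^2), with
     explicit polynomial cofactors. [ring] checks the combination, and the hypotheses then make it
     vanish. *)
  transitivity (s2 * ((c3 * s2 - c2 * (s2 * s2) * s3 * w + c2 * c2 * c2 * s3 * w)
                        * (c1 * c1 - (1 + s1 * s1))
                    + (- c3 * (s1 * s1) * s2 * (p * p) + c2 * s3 * w + c2 * (s1 * s1) * s3 * w
                       + c1 * s1 * s2 * s3 * p * w - c1 * c2 * c3 * s1 * p)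
                        * (c2 * c2 - (1 + s2 * s2)))).
  - unfold L12, L13, L23, radical. ring.
  - rewrite H1, H2. ring.
Qed.

Lemma nb_radical_H x y z p q w :
  0 < x -> 0 < y -> 0 <= p ->
  nb hyperbolic x y z p q w
  = - (sinh x * sinh y * radical (sinh x) (cosh x) (sinh y) (cosh y) (sinh z) (cosh z) p q w
       / sinsq hyperbolic (edge hyperbolic x y p)).
Proof.
  intros Hx Hy Hp. pose proof (sq_pos_H x y p Hx Hy Hp) as H.
  rewrite <- (radical_identity (cosh x) (cosh y) (cosh z) (sinh x) (sinh y) (sinh z) p q w)
    by apply cosh2_sinh2.
  unfold nb. simpl in *. field. lra.
Qed.

Lemma nb_sym_H x y z p q w :
  0 < x -> 0 < y -> 0 <= p -> nb hyperbolic x y z p q w = nb hyperbolic y x z p w q.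
Proof.
  intros. rewrite !nb_radical_H by auto. rewrite radical_swap, (edge_sym_H y x). field.
  apply Rgt_not_eq. now apply sq_pos_H.
Qed.

Lemma nb_neg_H x y z p q w :
  0 < x -> 0 < y -> 0 <= p ->
  0 < radical (sinh x) (cosh x) (sinh y) (cosh y) (sinh z) (cosh z) p q w ->
  nb hyperbolic x y z p q w < 0.
Proof.
  intros Hx Hy Hp Hr. rewrite nb_radical_H by auto.
  apply Ropp_lt_gt_0_contravar. apply Rdiv_lt_0_compat; [|now apply sq_pos_H].
  apply Rmult_lt_0_compat; [apply Rmult_lt_0_compat|]; auto using sinh_pos.
Qed.

Lemma tri_form_H_vertex3 x y z p q w v1 v2 v3 :
  0 < x -> 0 < y -> 0 < z -> 0 <= p -> 0 <= q -> 0 <= w ->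
  0 < gram hyperbolic x y z p q w ->
  0 < radical (sinh x) (cosh x) (sinh z) (cosh z) (sinh y) (cosh y) q p w ->
  0 < radical (sinh y) (cosh y) (sinh z) (cosh z) (sinh x) (cosh x) w p q ->
  0 <= tri_form hyperbolic x y z p q w v1 v2 v3 /\
  (tri_form hyperbolic x y z p q w v1 v2 v3 = 0 -> v1 = 0 /\ v2 = 0 /\ v3 = 0).
Proof.
  intros Hx Hy Hz Hp Hq Hw HD H13 H23.
  pose proof (nb_sym_H x y z p q w Hx Hy Hp) as E12.
  pose proof (nb_sym_H x z y q p w Hx Hz Hq) as E13.
  pose proof (nb_sym_H y z x w p q Hy Hz Hw) as E23.
  pose proof (nb_neg_H x z y q p w Hx Hz Hq H13) as N13.
  pose proof (nb_neg_H y z x w p q Hy Hz Hw H23) as N23.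
  unfold gram in HD.
  pose proof (hyperbolic_variation_posdef (edge hyperbolic x y p) (edge hyperbolic x z q)
    (edge hyperbolic y z w) (dedge hyperbolic x y p) (dedge hyperbolic x z q)
    (dedge hyperbolic y x p) (dedge hyperbolic y z w) (dedge hyperbolic z x q)
    (dedge hyperbolic z y w) v1 v2 v3) as L. cbv zeta in L.
  assert (N : forall a b c, cosnum hyperbolic a b c = cosnum hyperbolic b a c) by (intros; simpl; ring).
  unfold tri_form, own, nb in *.
  rewrite ?(edge_sym_H y x p), ?(edge_sym_H z x q), ?(edge_sym_H z y w) in *.
  rewrite ?(N (edge hyperbolic y z w) (edge hyperbolic x z q)) in *.
  rewrite ?(N (edge hyperbolic x z q) (edge hyperbolic x y p)) in *.
  rewrite ?(N (edge hyperbolic y z w) (edge hyperbolic x y p)) in *.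
  apply L; auto using edge_gt1_H, dedge_pos_H.
  set (a := edge hyperbolic x y p) in *. set (b := edge hyperbolic x z q) in *.
  set (c := edge hyperbolic y z w) in *.
  change (0 < (a * a - 1) * (b * b - 1) - (a * b - c) * (a * b - c)) in HD. lra.
Qed.

Lemma tri_form_H x y z p q w v1 v2 v3 :
  0 < x -> 0 < y -> 0 < z -> 0 <= p -> 0 <= q -> 0 <= w ->
  0 < gram hyperbolic x y z p q w ->
  0 <= tri_form hyperbolic x y z p q w v1 v2 v3 /\
  (tri_form hyperbolic x y z p q w v1 v2 v3 = 0 -> v1 = 0 /\ v2 = 0 /\ v3 = 0).
Proof.
  intros Hx Hy Hz Hp Hq Hw HD.
  destruct (two_radical_pos (sinh x) (cosh x) (sinh y) (cosh y) (sinh z) (cosh z) p q w)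
    as [[A B]|[[A B]|[A B]]]; auto using sinh_pos, cosh_pos.
  - now apply tri_form_H_vertex3.
  - rewrite <- (tri_form_swap23 hyperbolic x y z p q w) by apply edge_sym_H.
    rewrite <- gram_swap23_H in HD. rewrite <- radical_swap in B.
    destruct (tri_form_H_vertex3 x z y q p w v1 v3 v2) as [F Z]; auto.
    split; auto. intros E. destruct (Z E) as [? [? ?]]. auto.
  - rewrite <- (tri_form_swap13 hyperbolic x y z p q w) by apply edge_sym_H.
    rewrite <- gram_swap13_H in HD. rewrite <- radical_swap in A, B.
    destruct (tri_form_H_vertex3 z y x w q p v3 v2 v1) as [F Z]; auto.
    split; auto. intros E. destruct (Z E) as [? [? ?]]. auto.
Qed.

(** * Derivatives of the angles *)

(** With k = N / sqrt (a b), the root sqrt (1 - k^2) of the derivative of [acos] equals sqrt (a b -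
    N^2) / sqrt (a b). The outer square roots cancel, and only the one of [gram] survives. *)
Lemma derivable_pt_lim_acos_ratio (N a b : R -> R) t N' a' b' :
  derivable_pt_lim N t N' -> derivable_pt_lim a t a' -> derivable_pt_lim b t b' ->
  0 < a t -> 0 < b t -> 0 < a t * b t - N t * N t ->
  derivable_pt_lim (fun s => acos (N s / (sqrt (a s) * sqrt (b s)))) t
    (- (N' - N t * a' / (2 * a t) - N t * b' / (2 * b t)) / sqrt (a t * b t - N t * N t)).
Proof.
  intros HN Ha Hb Pa Pb HD.
  pose proof (sqrt_lt_R0 _ Pa) as Ra. pose proof (sqrt_lt_R0 _ Pb) as Rb.
  pose proof (sqrt_lt_R0 _ HD) as RD.
  assert (Sa : sqrt (a t) * sqrt (a t) = a t) by (apply sqrt_sqrt; lra).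
  assert (Sb : sqrt (b t) * sqrt (b t) = b t) by (apply sqrt_sqrt; lra).
  assert (Dsa : derivable_pt_lim (fun s => sqrt (a s)) t (/ (2 * sqrt (a t)) * a'))
    by (apply (derivable_pt_lim_comp a sqrt); auto; now apply derivable_pt_lim_sqrt).
  assert (Dsb : derivable_pt_lim (fun s => sqrt (b s)) t (/ (2 * sqrt (b t)) * b'))
    by (apply (derivable_pt_lim_comp b sqrt); auto; now apply derivable_pt_lim_sqrt).
  pose proof (derivable_pt_lim_mult _ _ _ _ _ Dsa Dsb) as Dm. cbv beta in Dm.
  assert (Pm : (fun s => sqrt (a s)) t * (fun s => sqrt (b s)) t <> 0) by (apply Rgt_not_eq; nra).
  pose proof (derivable_pt_lim_div _ _ _ _ _ HN Dm Pm) as Dq.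
  unfold mult_fct in Dq. cbv beta in Dq.
  set (r := sqrt (a t)) in *. set (u := sqrt (b t)) in *.
  set (k := N t / (r * u)) in *.
  assert (Pru : 0 < r * u) by nra.
  assert (Hk : -1 < k < 1).
  { assert (k * k < 1).
    { unfold k. replace (N t / (r * u) * (N t / (r * u))) with (N t * N t / ((r * r) * (u * u)))
        by (field; lra). rewrite Sa, Sb.
      apply Rmult_lt_reg_r with (a t * b t); [nra|].
      replace (N t * N t / (a t * b t) * (a t * b t)) with (N t * N t) by (field; lra). lra. }
    nra. }
  assert (Dk := derivable_pt_lim_comp _ acos t _ _ Dq (derivable_pt_lim_acos k Hk)).
  assert (Es : sqrt (1 - k * k) = sqrt (a t * b t - N t * N t) / (r * u)).
  { replace (1 - k * k) with ((a t * b t - N t * N t) / ((r * u) * (r * u))).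
    - rewrite sqrt_div by nra. rewrite sqrt_square by lra. reflexivity.
    - unfold k. rewrite <- Sa, <- Sb. field. lra. }
  rewrite Es in Dk.
  replace (- (N' - N t * a' / (2 * a t) - N t * b' / (2 * b t)) / sqrt (a t * b t - N t * N t))
    with (- / (sqrt (a t * b t - N t * N t) / (r * u)) *
       ((N' * (r * u) - (/ (2 * r) * a' * u + r * (/ (2 * u) * b')) * N t) / (r * u)²)).
  - exact Dk.
  - set (d := sqrt (a t * b t - N t * N t)) in *. rewrite <- Sa, <- Sb. unfold Rsqr. field. lra.
Qed.

Definition angle (G : geometry) (x y z p q w : R) : R :=
  acos (cosnum G (edge G x y p) (edge G x z q) (edge G y z w)
        / (sqrt (sinsq G (edge G x y p)) * sqrt (sinsq G (edge G x z q)))).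

Definition ok3 (len : R -> R -> R -> R) (x y z p q w : R) : Prop :=
  0 < x /\ 0 < y /\ 0 < z /\ 0 <= p /\ 0 <= q /\ 0 <= w /\
  len x y p < len y z w + len x z q /\ len y z w < len x z q + len x y p /\
  len x z q < len x y p + len y z w.

(** The interface through which cone angles are treated once for both geometries. Definiteness is
    left out of it, since its conclusion differs between the two. *)
Record angle_laws (G : geometry) (len : R -> R -> R -> R) (ang : R -> R -> R -> R) : Prop := {
  law_len_sym : forall x y p, len x y p = len y x p;
  law_edge_sym : forall x y p, edge G x y p = edge G y x p;
  law_num_sym : forall a b c, cosnum G a b c = cosnum G b a c;
  law_gram_swap23 : forall x y z p q w, gram G x z y q p w = gram G x y z p q w;
  law_gram_swap13 : forall x y z p q w, gram G z y x w q p = gram G x y z p q w;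
  law_gram : forall x y z p q w, ok3 len x y z p q w -> 0 < gram G x y z p q w;
  law_angle : forall x y z p q w, ok3 len x y z p q w ->
    ang (len x y p) (len x z q) (len y z w) = angle G x y z p q w;
  law_own : forall x y z p q w, ok3 len x y z p q w ->
    derivable_pt_lim (fun t => angle G t y z p q w) x
      (- own G x y z p q w / (rad G x * sqrt (gram G x y z p q w)));
  law_nb : forall x y z p q w, ok3 len x y z p q w ->
    derivable_pt_lim (fun t => angle G x t z p q w) y
      (- nb G x y z p q w / (rad G y * sqrt (gram G x y z p q w)));
  law_rad_pos : forall x, 0 < x -> 0 < rad G x;
  law_rad_smooth : smooth1 (fun _ => True) (rad G);
  law_len_smooth : forall n U a b p, open_n n U -> (a < n)%nat -> (b < n)%nat -> 0 <= p ->
    (forall r, U r -> 0 < r a /\ 0 < r b) -> smooth_on n U (fun r => len (r a) (r b) p);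
  law_num_smooth : forall n U f g h, open_n n U -> smooth_on n U f -> smooth_on n U g ->
    smooth_on n U h -> smooth_on n U (fun r => cosnum G (f r) (g r) (h r));
  law_sq_smooth : forall n U f, open_n n U -> smooth_on n U f -> smooth_on n U (fun r => sinsq G (f r));
  law_edge_smooth : forall n U a b p, open_n n U -> (a < n)%nat -> (b < n)%nat ->
    smooth_on n U (fun r => edge G (r a) (r b) p);
  law_sq_pos : forall x y p, 0 < x -> 0 < y -> 0 <= p -> 0 < sinsq G (edge G x y p)
}.

Definition lenE3 (x y p : R) : R := sqrt (x ^ 2 + y ^ 2 + 2 * x * y * p).
Definition lenH3 (x y p : R) : R := arcosh (cosh x * cosh y + p * sinh x * sinh y).

Lemma derivable_pt_lim_sqr x : derivable_pt_lim (fun t => t ^ 2) x (2 * x).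
Proof.
  replace (2 * x) with (INR 2 * x ^ 1) by (simpl; ring). exact (derivable_pt_lim_pow x 2).
Qed.

Lemma edge_derivable_E x y p : 0 < x ->
  derivable_pt_lim (fun t => edge euclidean t y p) x (2 * (dedge euclidean x y p / x)).
Proof.
  intros Hx. simpl. replace (2 * (x * (x + p * y) / x)) with (2 * x + 0 + 2 * y * p * 1) by (field; lra).
  apply (derivable_pt_lim_plus (fun t => t ^ 2 + y ^ 2) (fun t => 2 * t * y * p)).
  - apply (derivable_pt_lim_plus (fun t => t ^ 2) (fun _ => y ^ 2)).
    + apply derivable_pt_lim_sqr.
    + apply derivable_pt_lim_const.
  - apply derivable_pt_lim_local with (fun t => 2 * y * p * t) 1; [lra|intros; ring|].
    apply (derivable_pt_lim_scal id). apply derivable_pt_lim_id.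
Qed.

Lemma edge_derivable_H x y p : 0 < x ->
  derivable_pt_lim (fun t => edge hyperbolic t y p) x (dedge hyperbolic x y p / sinh x).
Proof.
  intros Hx. simpl. pose proof (sinh_pos x Hx).
  replace (sinh x * (sinh x * cosh y + p * cosh x * sinh y) / sinh x)
    with (cosh y * sinh x + (p * sinh y) * cosh x) by (field; lra).
  apply derivable_pt_lim_local with (fun t => cosh y * cosh t + (p * sinh y) * sinh t) 1;
    [lra|intros; ring|].
  apply (derivable_pt_lim_plus (fun t => cosh y * cosh t) (fun t => (p * sinh y) * sinh t)).
  - apply (derivable_pt_lim_scal cosh), derivable_pt_lim_cosh.
  - apply (derivable_pt_lim_scal sinh), derivable_pt_lim_sinh.
Qed.

Lemma derivable_pt_lim_half f x l :
  derivable_pt_lim f x (2 * l) -> derivable_pt_lim (fun t => f t / 2) x l.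
Proof.
  intros H. apply derivable_pt_lim_local with (fun t => / 2 * f t) 1; [lra|intros; field|].
  replace l with (/ 2 * (2 * l)) by field. now apply derivable_pt_lim_scal.
Qed.

Lemma angle_own_E x y z p q w : 0 < x -> 0 < y -> 0 < z -> 0 <= p -> 0 <= q ->
  0 < gram euclidean x y z p q w ->
  derivable_pt_lim (fun t => angle euclidean t y z p q w) x
    (- own euclidean x y z p q w / (rad euclidean x * sqrt (gram euclidean x y z p q w))).
Proof.
  intros Hx Hy Hz Hp Hq HD.
  pose proof (edge_pos_E x y p Hx Hy Hp) as P1. pose proof (edge_pos_E x z q Hx Hz Hq) as P2.
  pose proof (edge_derivable_E x y p Hx) as D1. pose proof (edge_derivable_E x z q Hx) as D2.
  unfold angle, own, gram in *.
  set (e12 := fun t => edge euclidean t y p) in *. set (e13 := fun t => edge euclidean t z q) in *.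
  change (edge euclidean x y p) with (e12 x) in *. change (edge euclidean x z q) with (e13 x) in *.
  set (c := edge euclidean y z w) in *.
  set (d1 := dedge euclidean x y p) in *. set (d2 := dedge euclidean x z q) in *.
  simpl sinsq in *. simpl cosnum in *. simpl rad.
  assert (DN : derivable_pt_lim (fun t => (e12 t + e13 t - c) / 2) x (d1 / x + d2 / x)).
  { apply (derivable_pt_lim_half (fun t => e12 t + e13 t - c)).
    replace (2 * (d1 / x + d2 / x)) with (2 * (d1 / x) + 2 * (d2 / x) - 0) by ring.
    apply (derivable_pt_lim_minus (fun t => e12 t + e13 t) (fun _ => c)).
    - now apply (derivable_pt_lim_plus e12 e13).
    - apply derivable_pt_lim_const. }
  pose proof (derivable_pt_lim_acos_ratio _ e12 e13 x _ _ _ DN D1 D2 P1 P2 HD) as K.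
  pose proof (sqrt_lt_R0 _ HD) as RD.
  cbv beta in K.
  match type of K with derivable_pt_lim _ _ ?v => match goal with
    |- derivable_pt_lim _ _ ?u => replace u with v; [exact K|] end end.
  clearbody e12 e13 c d1 d2.
  set (s := sqrt (e12 x * e13 x - (e12 x + e13 x - c) / 2 * ((e12 x + e13 x - c) / 2))) in *. clearbody s.
  field. repeat split; lra.
Qed.

Lemma angle_nb_E x y z p q w : 0 < x -> 0 < y -> 0 < z -> 0 <= p -> 0 <= q ->
  0 < gram euclidean x y z p q w ->
  derivable_pt_lim (fun t => angle euclidean x t z p q w) y
    (- nb euclidean x y z p q w / (rad euclidean y * sqrt (gram euclidean x y z p q w))).
Proof.
  intros Hx Hy Hz Hp Hq HD.
  pose proof (edge_pos_E x y p Hx Hy Hp) as P1. pose proof (edge_pos_E x z q Hx Hz Hq) as P2.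
  pose proof (edge_derivable_E y x p Hy) as D1. pose proof (edge_derivable_E y z w Hy) as D2.
  apply derivable_pt_lim_local with (f := fun t => edge euclidean t x p)
    (g := fun t => edge euclidean x t p) (d := 1) in D1; [|lra|intros; apply edge_sym_E].
  unfold angle, nb, gram in *.
  set (e12 := fun t => edge euclidean x t p) in *. set (e23 := fun t => edge euclidean t z w) in *.
  change (edge euclidean x y p) with (e12 y) in *. change (edge euclidean y z w) with (e23 y) in *.
  set (c := edge euclidean x z q) in *.
  set (d1 := dedge euclidean y x p) in *. set (d2 := dedge euclidean y z w) in *.
  simpl sinsq in *. simpl cosnum in *. simpl rad.
  assert (DN : derivable_pt_lim (fun t => (e12 t + c - e23 t) / 2) y (d1 / y - d2 / y)).
  { apply (derivable_pt_lim_half (fun t => e12 t + c - e23 t)).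
    replace (2 * (d1 / y - d2 / y)) with (2 * (d1 / y) + 0 - 2 * (d2 / y)) by ring.
    apply (derivable_pt_lim_minus (fun t => e12 t + c) e23); auto.
    apply (derivable_pt_lim_plus e12 (fun _ => c)); auto. apply derivable_pt_lim_const. }
  pose proof (derivable_pt_lim_acos_ratio _ e12 (fun _ => c) y _ _ _ DN D1
     (derivable_pt_lim_const c y) P1 P2 HD) as K.
  pose proof (sqrt_lt_R0 _ HD) as RD.
  cbv beta in K.
  match type of K with derivable_pt_lim _ _ ?v => match goal with
    |- derivable_pt_lim _ _ ?u => replace u with v; [exact K|] end end.
  clearbody e12 e23 c d1 d2.
  set (s := sqrt (e12 y * c - (e12 y + c - e23 y) / 2 * ((e12 y + c - e23 y) / 2))) in *. clearbody s.
  field. repeat split; lra.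
Qed.

Lemma angle_own_H x y z p q w : 0 < x -> 0 < y -> 0 < z -> 0 <= p -> 0 <= q ->
  0 < gram hyperbolic x y z p q w ->
  derivable_pt_lim (fun t => angle hyperbolic t y z p q w) x
    (- own hyperbolic x y z p q w / (rad hyperbolic x * sqrt (gram hyperbolic x y z p q w))).
Proof.
  intros Hx Hy Hz Hp Hq HD.
  pose proof (sq_pos_H x y p Hx Hy Hp) as P1. pose proof (sq_pos_H x z q Hx Hz Hq) as P2.
  pose proof (edge_derivable_H x y p Hx) as D1. pose proof (edge_derivable_H x z q Hx) as D2.
  pose proof (sinh_pos x Hx) as Sx.
  unfold angle, own, gram in *.
  set (e12 := fun t => edge hyperbolic t y p) in *. set (e13 := fun t => edge hyperbolic t z q) in *.
  change (edge hyperbolic x y p) with (e12 x) in *. change (edge hyperbolic x z q) with (e13 x) in *.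
  set (c := edge hyperbolic y z w) in *.
  set (d1 := dedge hyperbolic x y p) in *. set (d2 := dedge hyperbolic x z q) in *.
  simpl sinsq in *. simpl cosnum in *. simpl rad.
  assert (DN : derivable_pt_lim (fun t => e12 t * e13 t - c) x
     (d1 / sinh x * e13 x + e12 x * (d2 / sinh x) - 0)).
  { apply (derivable_pt_lim_minus (fun t => e12 t * e13 t) (fun _ => c)).
    - now apply (derivable_pt_lim_mult e12 e13).
    - apply derivable_pt_lim_const. }
  assert (DS1 : derivable_pt_lim (fun t => e12 t * e12 t - 1) x
     (d1 / sinh x * e12 x + e12 x * (d1 / sinh x) - 0)).
  { apply (derivable_pt_lim_minus (fun t => e12 t * e12 t) (fun _ => 1)).
    - now apply (derivable_pt_lim_mult e12 e12).
    - apply derivable_pt_lim_const. }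
  assert (DS2 : derivable_pt_lim (fun t => e13 t * e13 t - 1) x
     (d2 / sinh x * e13 x + e13 x * (d2 / sinh x) - 0)).
  { apply (derivable_pt_lim_minus (fun t => e13 t * e13 t) (fun _ => 1)).
    - now apply (derivable_pt_lim_mult e13 e13).
    - apply derivable_pt_lim_const. }
  pose proof (derivable_pt_lim_acos_ratio _ _ _ x _ _ _ DN DS1 DS2 P1 P2 HD) as K.
  pose proof (sqrt_lt_R0 _ HD) as RD.
  cbv beta in K.
  match type of K with derivable_pt_lim _ _ ?v => match goal with
    |- derivable_pt_lim _ _ ?u => replace u with v; [exact K|] end end.
  clearbody e12 e13 c d1 d2.
  set (s := sqrt _) in *. clearbody s.
  field. repeat split; lra.
Qed.

Lemma angle_nb_H x y z p q w : 0 < x -> 0 < y -> 0 < z -> 0 <= p -> 0 <= q ->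
  0 < gram hyperbolic x y z p q w ->
  derivable_pt_lim (fun t => angle hyperbolic x t z p q w) y
    (- nb hyperbolic x y z p q w / (rad hyperbolic y * sqrt (gram hyperbolic x y z p q w))).
Proof.
  intros Hx Hy Hz Hp Hq HD.
  pose proof (sq_pos_H x y p Hx Hy Hp) as P1. pose proof (sq_pos_H x z q Hx Hz Hq) as P2.
  pose proof (edge_derivable_H y x p Hy) as D1. pose proof (edge_derivable_H y z w Hy) as D2.
  pose proof (sinh_pos y Hy) as Sy.
  apply derivable_pt_lim_local with (f := fun t => edge hyperbolic t x p)
    (g := fun t => edge hyperbolic x t p) (d := 1) in D1; [|lra|intros; apply edge_sym_H].
  unfold angle, nb, gram in *.
  set (e12 := fun t => edge hyperbolic x t p) in *. set (e23 := fun t => edge hyperbolic t z w) in *.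
  change (edge hyperbolic x y p) with (e12 y) in *. change (edge hyperbolic y z w) with (e23 y) in *.
  set (c := edge hyperbolic x z q) in *.
  set (d1 := dedge hyperbolic y x p) in *. set (d2 := dedge hyperbolic y z w) in *.
  simpl sinsq in *. simpl cosnum in *. simpl rad.
  assert (DN : derivable_pt_lim (fun t => e12 t * c - e23 t) y
     (d1 / sinh y * c + e12 y * 0 - d2 / sinh y)).
  { apply (derivable_pt_lim_minus (fun t => e12 t * c) e23); auto.
    apply (derivable_pt_lim_mult e12 (fun _ => c)); auto. apply derivable_pt_lim_const. }
  assert (DS1 : derivable_pt_lim (fun t => e12 t * e12 t - 1) y
     (d1 / sinh y * e12 y + e12 y * (d1 / sinh y) - 0)).
  { apply (derivable_pt_lim_minus (fun t => e12 t * e12 t) (fun _ => 1)).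
    - now apply (derivable_pt_lim_mult e12 e12).
    - apply derivable_pt_lim_const. }
  pose proof (derivable_pt_lim_acos_ratio _ _ (fun _ => c * c - 1) y _ _ _ DN DS1
    (derivable_pt_lim_const (c * c - 1) y) P1 P2 HD) as K.
  pose proof (sqrt_lt_R0 _ HD) as RD.
  cbv beta in K.
  match type of K with derivable_pt_lim _ _ ?v => match goal with
    |- derivable_pt_lim _ _ ?u => replace u with v; [exact K|] end end.
  clearbody e12 e23 c d1 d2.
  set (s := sqrt _) in *. clearbody s.
  field. repeat split; lra.
Qed.

(** * The two geometries satisfy the common laws *)

Lemma smooth_on_sqrt n U f :
  smooth_on n U f -> (forall r, U r -> 0 < f r) -> smooth_on n U (fun r => sqrt (f r)).
Proof.
  intros Hf Hp. apply smooth_on_comp1 with (fun t => 0 < t); auto using open1_pos, smooth1_sqrt.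
Qed.

Lemma edge_smooth_E n U a b p : (a < n)%nat -> (b < n)%nat ->
  smooth_on n U (fun r => edge euclidean (r a) (r b) p).
Proof.
  intros Ha Hb. simpl.
  repeat first [ apply smooth_on_plus | apply smooth_on_mult
               | apply smooth_on_const | now apply smooth_on_proj ].
Qed.

Lemma edge_smooth_H n U a b p : (a < n)%nat -> (b < n)%nat ->
  smooth_on n U (fun r => edge hyperbolic (r a) (r b) p).
Proof.
  intros Ha Hb. cbn -[cosh sinh].
  assert (C : forall i, (i < n)%nat -> smooth_on n U (fun r => cosh (r i))).
  { intros i Hi. apply (smooth_on_comp1 n U (fun _ => True) cosh (fun r => r i));
      auto using open1_all, smooth1_cosh, smooth_on_proj. }
  assert (S : forall i, (i < n)%nat -> smooth_on n U (fun r => sinh (r i))).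
  { intros i Hi. apply (smooth_on_comp1 n U (fun _ => True) sinh (fun r => r i));
      auto using open1_all, smooth1_sinh, smooth_on_proj. }
  apply smooth_on_plus; apply smooth_on_mult; auto.
  apply smooth_on_mult; auto. apply smooth_on_const.
Qed.

Lemma lenE3_pos x y p : 0 < x -> 0 < y -> 0 <= p -> 0 < lenE3 x y p.
Proof. intros. apply sqrt_lt_R0. now apply edge_pos_E. Qed.

Lemma lenE3_sqr x y p : 0 < x -> 0 < y -> 0 <= p ->
  edge euclidean x y p = lenE3 x y p * lenE3 x y p.
Proof. intros. symmetry. apply sqrt_sqrt. left. now apply edge_pos_E. Qed.

(** Heron's formula: the strict triangle inequalities make all its factors positive. *)
Lemma gram_pos_E x y z p q w : ok3 lenE3 x y z p q w -> 0 < gram euclidean x y z p q w.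
Proof.
  intros (Hx & Hy & Hz & Hp & Hq & Hw & T1 & T2 & T3).
  unfold gram. rewrite !lenE3_sqr by auto.
  pose proof (lenE3_pos x y p Hx Hy Hp). pose proof (lenE3_pos x z q Hx Hz Hq).
  pose proof (lenE3_pos y z w Hy Hz Hw).
  set (a := lenE3 x y p) in *. set (b := lenE3 x z q) in *. set (c := lenE3 y z w) in *.
  cbn [sinsq cosnum euclidean].
  replace (a * a * (b * b) - (a * a + b * b - c * c) / 2 * ((a * a + b * b - c * c) / 2))
    with ((a + b + c) * (a + b - c) * ((c + a - b) * (c + b - a)) / 4) by field.
  apply Rdiv_lt_0_compat; [|lra].
  apply Rmult_lt_0_compat; apply Rmult_lt_0_compat; lra.
Qed.

Lemma euclidean_laws : angle_laws euclidean lenE3 angE.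
Proof.
  split.
  - intros. unfold lenE3. f_equal. ring.
  - apply edge_sym_E.
  - intros. simpl. field.
  - apply gram_swap23_E.
  - apply gram_swap13_E.
  - apply gram_pos_E.
  - intros x y z p q w (Hx & Hy & Hz & Hp & Hq & Hw & _).
    unfold angE, angle. f_equal. rewrite !lenE3_sqr by auto. cbn [sinsq cosnum euclidean].
    pose proof (lenE3_pos x y p Hx Hy Hp). pose proof (lenE3_pos x z q Hx Hz Hq).
    rewrite !sqrt_square by lra. field. lra.
  - intros x y z p q w H. pose proof (gram_pos_E _ _ _ _ _ _ H).
    destruct H as (Hx & Hy & Hz & Hp & Hq & Hw & _). now apply angle_own_E.
  - intros x y z p q w H. pose proof (gram_pos_E _ _ _ _ _ _ H).
    destruct H as (Hx & Hy & Hz & Hp & Hq & Hw & _). now apply angle_nb_E.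
  - auto.
  - intros k. apply Ck1_proj.
  - intros n U a b p HU Ha Hb Hp H. unfold lenE3. apply smooth_on_sqrt.
    + now apply (edge_smooth_E n U a b p).
    + intros r Hr. destruct (H r Hr). now apply edge_pos_E.
  - intros n U f g h HU Hf Hg Hh. cbn [cosnum euclidean]. unfold Rdiv.
    apply smooth_on_mult; [|apply smooth_on_const].
    apply smooth_on_minus; auto. now apply smooth_on_plus.
  - auto.
  - intros. now apply edge_smooth_E.
  - intros. now apply edge_pos_E.
Qed.

Lemma cosh_plus x y : cosh (x + y) = cosh x * cosh y + sinh x * sinh y.
Proof.
  unfold cosh, sinh. rewrite Ropp_plus_distr, !exp_plus. field.
Qed.

Lemma cosh_opp x : cosh (- x) = cosh x.
Proof. unfold cosh. rewrite Ropp_involutive. field. Qed.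

Lemma sinh_opp x : sinh (- x) = - sinh x.
Proof. unfold sinh. rewrite Ropp_involutive. field. Qed.

Lemma cosh_abs_lt x y : Rabs x < y -> cosh x < cosh y.
Proof.
  intros H.
  assert (E : cosh (Rabs x) = cosh x)
    by (unfold Rabs; destruct (Rcase_abs x); auto using cosh_opp).
  rewrite <- E. pose proof (Rabs_pos x). set (a := Rabs x) in *.
  pose proof (cosh2_sinh2 a). pose proof (cosh2_sinh2 y).
  pose proof (cosh_pos a). pose proof (cosh_pos y).
  assert (0 <= sinh a).
  { destruct (Req_dec a 0) as [->|]; [rewrite sinh_0; lra|]. left. apply sinh_pos. lra. }
  pose proof (sinh_lt a y H).
  assert (sinh a * sinh a < sinh y * sinh y) by (apply Rmult_le_0_lt_compat; lra).
  apply Rnot_le_lt. intros Hle.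
  assert (cosh y * cosh y <= cosh a * cosh a) by (apply Rmult_le_compat; lra). lra.
Qed.

Lemma arcosh_pos x : 1 < x -> 0 < arcosh x.
Proof.
  intros H. unfold arcosh. rewrite <- ln_1. apply ln_increasing; [lra|].
  pose proof (sqrt_pos (x ^ 2 - 1)). lra.
Qed.

Lemma exp_arcosh x : 1 < x ->
  exp (arcosh x) = x + sqrt (x * x - 1) /\ exp (- arcosh x) = x - sqrt (x * x - 1).
Proof.
  intros H. unfold arcosh. replace (x ^ 2 - 1) with (x * x - 1) by ring.
  pose proof (sqrt_pos (x * x - 1)).
  assert (S : sqrt (x * x - 1) * sqrt (x * x - 1) = x * x - 1) by (apply sqrt_sqrt; nra).
  rewrite exp_Ropp, exp_ln by lra. split; auto.
  apply Rmult_eq_reg_l with (x + sqrt (x * x - 1)); [|lra].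
  rewrite Rinv_r by lra. lra.
Qed.

Lemma cosh_arcosh x : 1 < x -> cosh (arcosh x) = x.
Proof. intros H. unfold cosh. destruct (exp_arcosh x H) as [-> ->]. field. Qed.

Lemma sinh_arcosh x : 1 < x -> sinh (arcosh x) = sqrt (x * x - 1).
Proof. intros H. unfold sinh. destruct (exp_arcosh x H) as [-> ->]. field. Qed.

(** For sides a, b, c the quantity factors as (cosh c - cosh (a - b)) (cosh (a + b) - cosh c), and
    |a - b| < c < a + b makes both factors positive. *)
Lemma gram_pos_H x y z p q w : ok3 lenH3 x y z p q w -> 0 < gram hyperbolic x y z p q w.
Proof.
  intros (Hx & Hy & Hz & Hp & Hq & Hw & T1 & T2 & T3).
  unfold gram, lenH3 in *.
  pose proof (edge_gt1_H x y p Hx Hy Hp) as G1. pose proof (edge_gt1_H x z q Hx Hz Hq) as G2.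
  pose proof (edge_gt1_H y z w Hy Hz Hw) as G3.
  change (cosh x * cosh y + p * sinh x * sinh y) with (edge hyperbolic x y p) in *.
  change (cosh x * cosh z + q * sinh x * sinh z) with (edge hyperbolic x z q) in *.
  change (cosh y * cosh z + w * sinh y * sinh z) with (edge hyperbolic y z w) in *.
  rewrite <- (cosh_arcosh _ G1), <- (cosh_arcosh _ G2), <- (cosh_arcosh _ G3).
  pose proof (arcosh_pos _ G1). pose proof (arcosh_pos _ G2). pose proof (arcosh_pos _ G3).
  set (a := arcosh (edge hyperbolic x y p)) in *. set (b := arcosh (edge hyperbolic x z q)) in *.
  set (c := arcosh (edge hyperbolic y z w)) in *.
  cbn [sinsq cosnum hyperbolic].
  assert (U : cosh c < cosh (a + b)) by (apply cosh_abs_lt; rewrite Rabs_right; lra).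
  assert (V : cosh (a + - b) < cosh c) by (apply cosh_abs_lt; apply Rabs_def1; lra).
  rewrite cosh_plus in U, V. rewrite cosh_opp, sinh_opp in V.
  rewrite (cosh2_sinh2 a), (cosh2_sinh2 b).
  replace ((1 + sinh a * sinh a - 1) * (1 + sinh b * sinh b - 1)
     - (cosh a * cosh b - cosh c) * (cosh a * cosh b - cosh c))
   with ((sinh a * sinh b - (cosh a * cosh b - cosh c))
         * (sinh a * sinh b + (cosh a * cosh b - cosh c))) by ring.
  apply Rmult_lt_0_compat; lra.
Qed.

Lemma hyperbolic_laws : angle_laws hyperbolic lenH3 angH.
Proof.
  split.
  - intros. unfold lenH3. f_equal. ring.
  - apply edge_sym_H.
  - intros. simpl. ring.
  - apply gram_swap23_H.
  - apply gram_swap13_H.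
  - apply gram_pos_H.
  - intros x y z p q w (Hx & Hy & Hz & Hp & Hq & Hw & _).
    unfold angH, angle, lenH3. f_equal.
    change (cosh x * cosh y + p * sinh x * sinh y) with (edge hyperbolic x y p).
    change (cosh x * cosh z + q * sinh x * sinh z) with (edge hyperbolic x z q).
    change (cosh y * cosh z + w * sinh y * sinh z) with (edge hyperbolic y z w).
    rewrite !cosh_arcosh, !sinh_arcosh by now apply edge_gt1_H. reflexivity.
  - intros x y z p q w H. pose proof (gram_pos_H _ _ _ _ _ _ H).
    destruct H as (Hx & Hy & Hz & Hp & Hq & Hw & _). now apply angle_own_H.
  - intros x y z p q w H. pose proof (gram_pos_H _ _ _ _ _ _ H).
    destruct H as (Hx & Hy & Hz & Hp & Hq & Hw & _). now apply angle_nb_H.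
  - apply sinh_pos.
  - apply smooth1_sinh.
  - intros n U a b p HU Ha Hb Hp H.
    assert (HE := edge_smooth_H n U a b p Ha Hb).
    change (fun r => lenH3 (r a) (r b) p) with (fun r : nat -> R => arcosh (edge hyperbolic (r a) (r b) p)).
    set (e := fun r : nat -> R => edge hyperbolic (r a) (r b) p) in *.
    change (fun r => arcosh (edge hyperbolic (r a) (r b) p)) with (fun r => arcosh (e r)).
    assert (He : forall r, U r -> 1 < e r)
      by (intros r Hr; destruct (H r Hr); now apply edge_gt1_H).
    clearbody e. unfold arcosh.
    apply (smooth_on_comp1 n U (fun t => 0 < t) ln (fun r => e r + sqrt (e r ^ 2 - 1)));
      auto using open1_pos, smooth1_ln.
    + apply smooth_on_plus; auto. apply smooth_on_sqrt.
      * apply smooth_on_minus; auto; [|apply smooth_on_const]. simpl.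
        repeat apply smooth_on_mult; auto; apply smooth_on_const.
      * intros r Hr. specialize (He r Hr). nra.
    + intros r Hr. specialize (He r Hr). pose proof (sqrt_pos (e r ^ 2 - 1)). lra.
  - intros n U f g h HU Hf Hg Hh. cbn [cosnum hyperbolic].
    apply smooth_on_minus; auto. now apply smooth_on_mult.
  - intros n U f HU Hf. cbn [sinsq hyperbolic].
    apply smooth_on_minus; auto; [|apply smooth_on_const]. now apply smooth_on_mult.
  - intros. now apply edge_smooth_H.
  - intros. now apply sq_pos_H.
Qed.

(** * Cone angles on a triangulated surface *)

Lemma open_lt n U f g : open_n n U -> cont_on n U f -> cont_on n U g ->
  open_n n (fun r => U r /\ f r < g r).
Proof.
  intros HU Hf Hg r [Ur Hr].
  destruct (HU r Ur) as [d0 [Hd0 H0]].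
  destruct (Hf r Ur ((g r - f r) / 2) ltac:(lra)) as [d1 [Hd1 H1]].
  destruct (Hg r Ur ((g r - f r) / 2) ltac:(lra)) as [d2 [Hd2 H2]].
  exists (Rmin d0 (Rmin d1 d2)). split; [repeat apply Rmin_pos; auto|].
  intros y Hy.
  assert (Uy : U y) by (apply H0; eapply ball_le; [apply Rmin_l|exact Hy]).
  assert (Hy' : ball n r (Rmin d1 d2) y) by (eapply ball_le; [apply Rmin_r|exact Hy]).
  specialize (H1 y Uy (ball_le _ _ _ _ _ (Rmin_l _ _) Hy')).
  specialize (H2 y Uy (ball_le _ _ _ _ _ (Rmin_r _ _) Hy')).
  apply Rabs_def2 in H1. apply Rabs_def2 in H2. split; auto. lra.
Qed.

Lemma open_ext n (U V : (nat -> R) -> Prop) :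
  (forall r, U r <-> V r) -> open_n n U -> open_n n V.
Proof.
  intros E HU r Hr. destruct (HU r (proj2 (E r) Hr)) as [d [Hd H]].
  exists d. split; auto. intros y Hy. now apply E, H.
Qed.

Lemma open_positive n : open_n n (fun r => forall i, (i < n)%nat -> 0 < r i).
Proof.
  intros r Hr.
  destruct (uniform_radius n (fun i d => forall t, Rabs (t - r i) < d -> 0 < t)) as [d [Hd H]].
  - intros i d d' HQ [_ Hle] t Ht. apply HQ. lra.
  - intros i Hi. exists (r i). split; auto. intros t Ht. apply Rabs_def2 in Ht. lra.
  - exists d. split; auto. intros y Hy i Hi. apply (H i Hi). now apply Hy.
Qed.

Lemma sumn_three n f a b c : (a < n)%nat -> (b < n)%nat -> (c < n)%nat ->
  a <> b -> b <> c -> a <> c ->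
  (forall i, i <> a -> i <> b -> i <> c -> f i = 0) -> sumn n f = f a + f b + f c.
Proof.
  intros Ha Hb Hc Hab Hbc Hac H.
  rewrite (sumn_ext n f (fun i => kron a i * f i + kron b i * f i + kron c i * f i)).
  - rewrite !sumn_plus, !sumn_kron_l by auto. reflexivity.
  - intros i _. unfold kron.
    destruct (Nat.eqb_spec a i), (Nat.eqb_spec b i), (Nat.eqb_spec c i); subst; try congruence;
      try ring. rewrite H by auto. ring.
Qed.

(** Convertible with the fold in [cone_angle], so lemmas about [tsum] apply to cone angles without
    rewriting. *)
Definition tsum (F : list tri) (g : tri -> R) : R := fold_right (fun t s => g t + s) 0 F.

Lemma tsum_ext F g h : (forall t, In t F -> g t = h t) -> tsum F g = tsum F h.
Proof.
  induction F as [|t F IH]; intros H; simpl; auto.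
  rewrite H by (now left). f_equal. apply IH. intros. apply H. now right.
Qed.

Lemma sumn_tsum n F g : sumn n (fun i => tsum F (fun t => g i t)) = tsum F (fun t => sumn n (fun i => g i t)).
Proof.
  induction F as [|t F IH]; simpl; [apply sumn_zero|]. rewrite sumn_plus, IH. reflexivity.
Qed.

Lemma tsum_scal F c g : c * tsum F g = tsum F (fun t => c * g t).
Proof. induction F as [|t F IH]; simpl; [ring|]. rewrite <- IH. ring. Qed.

Lemma tsum_nonneg F g : (forall t, In t F -> 0 <= g t) -> 0 <= tsum F g.
Proof.
  induction F as [|t F IH]; intros H; simpl; [lra|].
  pose proof (H t (or_introl eq_refl)). assert (0 <= tsum F g) by (apply IH; intros; apply H; now right).
  unfold tsum in *. lra.
Qed.

Lemma tsum_zero F g t : (forall t, In t F -> 0 <= g t) -> tsum F g = 0 -> In t F -> g t = 0.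
Proof.
  induction F as [|u F IH]; intros H E Ht; [destruct Ht|]. simpl in E.
  pose proof (H u (or_introl eq_refl)).
  assert (Hn : forall t, In t F -> 0 <= g t) by (intros; apply H; now right).
  pose proof (tsum_nonneg F g Hn). unfold tsum in *.
  destruct Ht as [->|Ht]; [lra|]. apply IH; auto. lra.
Qed.

Lemma tsum_smooth n U F (g : tri -> (nat -> R) -> R) :
  (forall t, In t F -> smooth_on n U (g t)) -> smooth_on n U (fun r => tsum F (fun t => g t r)).
Proof.
  induction F as [|t F IH]; intros H; simpl; [apply smooth_on_const|].
  apply smooth_on_plus; [apply H; now left|]. apply IH. intros. apply H. now right.
Qed.

Lemma tsum_derivable F (g : tri -> R -> R) (g' : tri -> R) x :
  (forall t, In t F -> derivable_pt_lim (g t) x (g' t)) ->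
  derivable_pt_lim (fun s => tsum F (fun t => g t s)) x (tsum F g').
Proof.
  induction F as [|t F IH]; intros H; simpl; [apply derivable_pt_lim_const|].
  apply (derivable_pt_lim_plus (g t) (fun s => tsum F (fun t => g t s))); [apply H; now left|].
  apply IH. intros. apply H. now right.
Qed.

(** * Cone angles in a geometry obeying the laws *)

Section Surface.

Variables (n : nat) (F : list tri) (I : nat -> nat -> R).
Hypothesis HS : closed_tri_surface n F.
Hypothesis HIsym : forall i j, I i j = I j i.
Hypothesis HI : forall i j, is_edge F i j -> 0 <= I i j.
Variables (G : geometry) (len : R -> R -> R -> R) (ang : R -> R -> R -> R).
Hypothesis HG : angle_laws G len ang.

Definition ilen (r : nat -> R) (i j : nat) : R := len (r i) (r j) (I i j).
Definition adm (r : nat -> R) : Prop := admissible n F (ilen r) r.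
Definition cone (r : nat -> R) (i : nat) : R := cone_angle F ang (ilen r) i.

Lemma tri_vertices a b c : In (a, b, c) F ->
  (a < n)%nat /\ (b < n)%nat /\ (c < n)%nat /\ a <> b /\ b <> c /\ a <> c.
Proof. apply HS. Qed.

Lemma tri_weights a b c : In (a, b, c) F -> 0 <= I a b /\ 0 <= I a c /\ 0 <= I b c.
Proof.
  intros H. destruct (tri_vertices a b c H) as (_ & _ & _ & Hab & Hbc & Hac).
  repeat split; apply HI; split; auto; exists (a, b, c); simpl; auto.
Qed.

Lemma ok3_swap23 x y z p q w : ok3 len x y z p q w -> ok3 len x z y q p w.
Proof.
  unfold ok3. rewrite (law_len_sym _ _ _ HG z y). intuition lra.
Qed.

Lemma ok3_swap12 x y z p q w : ok3 len x y z p q w -> ok3 len y x z p w q.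
Proof.
  unfold ok3. rewrite (law_len_sym _ _ _ HG y x). intuition lra.
Qed.

Lemma ok3_rot x y z p q w : ok3 len x y z p q w -> ok3 len z x y q w p.
Proof.
  intros H. now apply ok3_swap12, ok3_swap23.
Qed.

Lemma adm_ok3 r a b c : adm r -> In (a, b, c) F ->
  ok3 len (r a) (r b) (r c) (I a b) (I a c) (I b c).
Proof.
  intros [Hpos Htri] H.
  destruct (tri_vertices a b c H) as (Ha & Hb & Hc & _).
  destruct (tri_weights a b c H) as (W1 & W2 & W3).
  destruct (Htri a b c H) as (T1 & T2 & T3). unfold ilen in *.
  rewrite (HIsym c a), (law_len_sym _ _ _ HG (r c) (r a)) in *.
  unfold ok3. repeat split; auto.
Qed.

Lemma ilen_cont a b (U : (nat -> R) -> Prop) :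
  open_n n U -> (forall r, U r -> forall i, (i < n)%nat -> 0 < r i) ->
  (a < n)%nat -> (b < n)%nat -> 0 <= I a b -> cont_on n U (fun r => ilen r a b).
Proof.
  intros HU Hp Ha Hb HW. apply (Ck_cont n 0). apply (law_len_smooth _ _ _ HG); auto.
Qed.

Lemma adm_open : open_n n adm.
Proof.
  unfold adm, admissible.
  (* The induction runs over sublists F' of F, so that the facts on vertices and weights of
     triangles of the fixed F stay available. *)
  assert (K : forall F', (forall t, In t F' -> In t F) ->
    open_n n (fun r => (forall i, (i < n)%nat -> 0 < r i) /\
      forall a b c, In (a, b, c) F' ->
        ilen r a b < ilen r b c + ilen r c a /\
        ilen r b c < ilen r c a + ilen r a b /\
        ilen r c a < ilen r a b + ilen r b c)); [|apply K; auto].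
  induction F' as [|[[a b] c] F' IH]; intros Hin.
  - apply open_ext with (fun r => forall i, (i < n)%nat -> 0 < r i); [|apply open_positive].
    intros r; split; [|tauto]. intros H; split; auto. intros ? ? ? [].
  - specialize (IH (fun t Ht => Hin t (or_intror Ht))).
    set (U := fun r => _ /\ _) in IH.
    assert (Habc : In (a, b, c) F) by (apply Hin; now left).
    destruct (tri_vertices a b c Habc) as (Ha & Hb & Hc & _).
    destruct (tri_weights a b c Habc) as (W1 & W2 & W3).
    assert (C1 : cont_on n U (fun r => ilen r a b)) by (apply ilen_cont; auto; now intros r []).
    assert (C2 : cont_on n U (fun r => ilen r b c)) by (apply ilen_cont; auto; now intros r []).
    assert (C3 : cont_on n U (fun r => ilen r c a))
      by (apply ilen_cont; auto; [now intros r []|now rewrite HIsym]).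
    apply open_ext with (fun r =>
      (U r /\ ilen r a b < ilen r b c + ilen r c a) /\
      ((U r /\ ilen r b c < ilen r c a + ilen r a b) /\
       (U r /\ ilen r c a < ilen r a b + ilen r b c))).
    + intros r. unfold U. split.
      * intros (((H & H') & T1) & (_ & T2) & (_ & T3)). split; auto.
        intros a' b' c' [E|E]; [injection E as <- <- <-; auto|auto].
      * intros (H & H').
        destruct (H' a b c (or_introl eq_refl)) as (T1 & T2 & T3).
        assert (forall a b c, In (a, b, c) F' ->
        ilen r a b < ilen r b c + ilen r c a /\
        ilen r b c < ilen r c a + ilen r a b /\
        ilen r c a < ilen r a b + ilen r b c) by (intros; apply H'; now right).
        tauto.
    + apply open_and; [|apply open_and]; apply open_lt; auto; now apply cont_on_plus.
Qed.

Lemma angle_swap x y z p q w : angle G x z y q p w = angle G x y z p q w.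
Proof.
  unfold angle. rewrite (law_edge_sym _ _ _ HG z y), (law_num_sym _ _ _ HG (edge G x z q)).
  now rewrite (Rmult_comm (sqrt (sinsq G (edge G x z q)))).
Qed.

Lemma gram_swap12 x y z p q w : gram G y x z p w q = gram G x y z p q w.
Proof.
  rewrite <- (law_gram_swap13 _ _ _ HG y x z), <- (law_gram_swap23 _ _ _ HG z x y).
  apply (law_gram_swap13 _ _ _ HG).
Qed.

Lemma gram_rot x y z p q w : gram G z x y q w p = gram G x y z p q w.
Proof. rewrite <- (law_gram_swap23 _ _ _ HG z x y). apply (law_gram_swap13 _ _ _ HG). Qed.

Lemma angle_smooth (U : (nat -> R) -> Prop) a b c p q w :
  open_n n U -> (a < n)%nat -> (b < n)%nat -> (c < n)%nat ->
  (forall r, U r -> ok3 len (r a) (r b) (r c) p q w) ->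
  smooth_on n U (fun r => angle G (r a) (r b) (r c) p q w).
Proof.
  intros HU Ha Hb Hc Hok. unfold angle.
  apply (smooth_on_comp1 n U (fun t => -1 < t < 1) acos (fun r =>
     cosnum G (edge G (r a) (r b) p) (edge G (r a) (r c) q) (edge G (r b) (r c) w)
     / (sqrt (sinsq G (edge G (r a) (r b) p)) * sqrt (sinsq G (edge G (r a) (r c) q)))));
    auto using open1_unit, smooth1_acos.
  - assert (P1 : forall r, U r -> 0 < sinsq G (edge G (r a) (r b) p)).
    { intros r Hr. destruct (Hok r Hr) as (? & ? & ? & ? & ? & ? & _). now apply (law_sq_pos _ _ _ HG). }
    assert (P2 : forall r, U r -> 0 < sinsq G (edge G (r a) (r c) q)).
    { intros r Hr. destruct (Hok r Hr) as (? & ? & ? & ? & ? & ? & _). now apply (law_sq_pos _ _ _ HG). }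
    assert (HE : forall i j s, (i < n)%nat -> (j < n)%nat -> smooth_on n U (fun r => edge G (r i) (r j) s))
      by (intros; now apply (law_edge_smooth _ _ _ HG)).
    apply smooth_on_div; auto.
    + apply (law_num_smooth _ _ _ HG n U (fun r => edge G (r a) (r b) p)
        (fun r => edge G (r a) (r c) q) (fun r => edge G (r b) (r c) w)); auto.
    + apply smooth_on_mult; apply smooth_on_sqrt; auto.
      * apply (law_sq_smooth _ _ _ HG n U (fun r => edge G (r a) (r b) p)); auto.
      * apply (law_sq_smooth _ _ _ HG n U (fun r => edge G (r a) (r c) q)); auto.
    + intros r Hr. apply Rmult_lt_0_compat; apply sqrt_lt_R0; auto.
  - intros r Hr. pose proof (law_gram _ _ _ HG _ _ _ _ _ _ (Hok r Hr)) as HD. unfold gram in HD.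
    destruct (Hok r Hr) as (? & ? & ? & ? & ? & ? & _).
    assert (P1 : 0 < sinsq G (edge G (r a) (r b) p)) by now apply (law_sq_pos _ _ _ HG).
    assert (P2 : 0 < sinsq G (edge G (r a) (r c) q)) by now apply (law_sq_pos _ _ _ HG).
    set (N := cosnum G _ _ _) in *. set (u := sinsq G (edge G (r a) (r b) p)) in *.
    set (v := sinsq G (edge G (r a) (r c) q)) in *.
    pose proof (sqrt_lt_R0 u P1). pose proof (sqrt_lt_R0 v P2).
    assert (Su : sqrt u * sqrt u = u) by (apply sqrt_sqrt; lra).
    assert (Sv : sqrt v * sqrt v = v) by (apply sqrt_sqrt; lra).
    assert (Puv : 0 < sqrt u * sqrt v) by now apply Rmult_lt_0_compat.
    assert (HN : N * N < (sqrt u * sqrt v) * (sqrt u * sqrt v)).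
    { replace ((sqrt u * sqrt v) * (sqrt u * sqrt v)) with ((sqrt u * sqrt u) * (sqrt v * sqrt v)) by ring.
      rewrite Su, Sv. lra. }
    set (k := sqrt u * sqrt v) in *.
    assert (- k < N < k) by nra.
    split; apply Rmult_lt_reg_r with k; auto; unfold Rdiv; rewrite Rmult_assoc, Rinv_l; lra.
Qed.

(** The angle as a function of the radii, with the vertex i moved to the first place and the weights
    permuted accordingly. In this form it can be differentiated. *)
Definition tang (t : tri) (i : nat) (r : nat -> R) : R :=
  let '(a, b, c) := t in
  if Nat.eqb i a then angle G (r a) (r b) (r c) (I a b) (I a c) (I b c)
  else if Nat.eqb i b then angle G (r b) (r a) (r c) (I a b) (I b c) (I a c)
  else if Nat.eqb i c then angle G (r c) (r a) (r b) (I a c) (I b c) (I a b)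
  else 0.

Lemma angle_at_tang r t i : adm r -> In t F -> angle_at ang (ilen r) t i = tang t i r.
Proof.
  destruct t as [[a b] c]. intros Hr Ht. unfold angle_at, tang, ilen.
  pose proof (adm_ok3 r a b c Hr Ht) as H1.
  pose proof (ok3_swap12 _ _ _ _ _ _ H1) as H2. pose proof (ok3_rot _ _ _ _ _ _ H1) as H3.
  rewrite (HIsym b a), (HIsym c a), (HIsym c b).
  rewrite (law_angle _ _ _ HG _ _ _ _ _ _ H1).
  rewrite (law_angle _ _ _ HG _ _ _ _ _ _ H2).
  rewrite (law_angle _ _ _ HG _ _ _ _ _ _ H3). reflexivity.
Qed.

Lemma cone_tang r i : adm r -> cone r i = tsum F (fun t => tang t i r).
Proof. intros Hr. apply tsum_ext. intros t Ht. now apply angle_at_tang. Qed.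

Lemma tang_smooth t i : In t F -> smooth_on n adm (tang t i).
Proof.
  destruct t as [[a b] c]. intros Ht. unfold tang.
  destruct (tri_vertices a b c Ht) as (Ha & Hb & Hc & _).
  pose proof adm_open.
  destruct (Nat.eqb i a); [|destruct (Nat.eqb i b); [|destruct (Nat.eqb i c); [|apply smooth_on_const]]];
    apply angle_smooth; auto; intros r Hr; pose proof (adm_ok3 r a b c Hr Ht) as H1; auto.
  - now apply ok3_swap12.
  - now apply ok3_rot.
Qed.

Lemma cone_smooth : smooth_map_on n adm cone.
Proof.
  intros i Hi. apply smooth_on_ext with (fun r => tsum F (fun t => tang t i r)).
  - apply adm_open.
  - intros r Hr. symmetry. now apply cone_tang.
  - apply tsum_smooth. intros. now apply tang_smooth.
Qed.

Definition vrow (a b c : nat) (p q w : R) (r : nat -> R) (j : nat) : R :=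
  if Nat.eqb j a then own G (r a) (r b) (r c) p q w
  else if Nat.eqb j b then nb G (r a) (r b) (r c) p q w
  else if Nat.eqb j c then nb G (r a) (r c) (r b) q p w
  else 0.

Definition tmat (t : tri) (i j : nat) (r : nat -> R) : R :=
  let '(a, b, c) := t in
  if Nat.eqb i a then vrow a b c (I a b) (I a c) (I b c) r j
  else if Nat.eqb i b then vrow b a c (I a b) (I b c) (I a c) r j
  else if Nat.eqb i c then vrow c a b (I a c) (I b c) (I a b) r j
  else 0.

Definition tgram (t : tri) (r : nat -> R) : R :=
  let '(a, b, c) := t in gram G (r a) (r b) (r c) (I a b) (I a c) (I b c).

Lemma angle_partial r a b c p q w j :
  a <> b -> b <> c -> a <> c -> ok3 len (r a) (r b) (r c) p q w ->
  derivable_pt_lim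
    (fun s => angle G (upd r j s a) (upd r j s b) (upd r j s c) p q w) (r j)
    (- vrow a b c p q w r j / (rad G (r j) * sqrt (gram G (r a) (r b) (r c) p q w))).
Proof.
  intros Hab Hbc Hac Hok. unfold vrow.
  destruct (Nat.eqb_spec j a) as [->|Na]; [|destruct (Nat.eqb_spec j b) as [->|Nb];
    [|destruct (Nat.eqb_spec j c) as [->|Nc]]].
  - apply derivable_pt_lim_local with (fun s => angle G s (r b) (r c) p q w) 1; [lra| |].
    + intros. now rewrite upd_same, !upd_other by auto.
    + now apply (law_own _ _ _ HG).
  - apply derivable_pt_lim_local with (fun s => angle G (r a) s (r c) p q w) 1; [lra| |].
    + intros. now rewrite upd_same, !upd_other by auto.
    + now apply (law_nb _ _ _ HG).
  - apply derivable_pt_lim_local with (fun s => angle G (r a) s (r b) q p w) 1; [lra| |].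
    + intros. rewrite upd_same, !upd_other by auto. apply angle_swap.
    + rewrite <- (law_gram_swap23 _ _ _ HG). apply (law_nb _ _ _ HG). now apply ok3_swap23.
  - apply derivable_pt_lim_local with (fun s => angle G (r a) (r b) (r c) p q w) 1; [lra| |].
    + intros. now rewrite !upd_other by auto.
    + unfold Rdiv. rewrite Ropp_0, Rmult_0_l. apply derivable_pt_lim_const.
Qed.

Lemma tang_partial r t i j : adm r -> In t F ->
  derivable_pt_lim (fun s => tang t i (upd r j s)) (r j)
    (- tmat t i j r / (rad G (r j) * sqrt (tgram t r))).
Proof.
  destruct t as [[a b] c]. intros Hr Ht. unfold tang, tmat, tgram.
  destruct (tri_vertices a b c Ht) as (Ha & Hb & Hc & Hab & Hbc & Hac).
  pose proof (adm_ok3 r a b c Hr Ht) as Hok.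
  destruct (Nat.eqb i a); [|destruct (Nat.eqb i b); [|destruct (Nat.eqb i c)]].
  - now apply angle_partial.
  - rewrite <- gram_swap12. apply angle_partial; auto. now apply ok3_swap12.
  - rewrite <- gram_rot. apply angle_partial; auto. now apply ok3_rot.
  - unfold Rdiv. rewrite Ropp_0, Rmult_0_l. apply derivable_pt_lim_const.
Qed.

Definition dcone (i j : nat) (r : nat -> R) : R :=
  tsum F (fun t => - tmat t i j r / (rad G (r j) * sqrt (tgram t r))).

Lemma cone_partial r i j : adm r -> (j < n)%nat ->
  derivable_pt_lim (fun s => cone (upd r j s) i) (r j) (dcone i j r).
Proof.
  (* The cone angle is given by the [tang] functions only at admissible vectors, so the derivative
     is taken inside a segment of admissible ones. *)
  intros Hr Hj. destruct (open_upd n adm r j adm_open Hr) as [d [Hd Hu]].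
  apply derivable_pt_lim_local with (fun s => tsum F (fun t => tang t i (upd r j s))) d; auto.
  - intros s Hs. symmetry. apply cone_tang. auto.
  - apply (tsum_derivable F (fun t s => tang t i (upd r j s))). intros t Ht.
    now apply tang_partial.
Qed.

Lemma rad_pos r j : adm r -> (j < n)%nat -> 0 < rad G (r j).
Proof. intros [Hp _] Hj. apply (law_rad_pos _ _ _ HG). auto. Qed.

Lemma rad_smooth j : (j < n)%nat -> smooth_on n adm (fun r => rad G (r j)).
Proof.
  intros Hj. apply (smooth_on_comp1 n adm (fun _ => True) (rad G) (fun r => r j)); auto.
  - apply open1_all.
  - apply (law_rad_smooth _ _ _ HG).
  - now apply smooth_on_proj.
Qed.

Definition tform (t : tri) (r v : nat -> R) : R :=
  let '(a, b, c) := t in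
  tri_form G (r a) (r b) (r c) (I a b) (I a c) (I b c) (v a) (v b) (v c).

Lemma vrow_sum a b c p q w r v : (a < n)%nat -> (b < n)%nat -> (c < n)%nat ->
  a <> b -> b <> c -> a <> c ->
  sumn n (fun j => vrow a b c p q w r j * v j)
  = own G (r a) (r b) (r c) p q w * v a + nb G (r a) (r b) (r c) p q w * v b
    + nb G (r a) (r c) (r b) q p w * v c.
Proof.
  intros. rewrite (sumn_three n _ a b c) by (auto; intros i Ha Hb Hc; unfold vrow;
    rewrite (proj2 (Nat.eqb_neq i a) Ha), (proj2 (Nat.eqb_neq i b) Hb), (proj2 (Nat.eqb_neq i c) Hc); ring).
  unfold vrow. rewrite !Nat.eqb_refl.
  rewrite (proj2 (Nat.eqb_neq b a)), (proj2 (Nat.eqb_neq c a)), (proj2 (Nat.eqb_neq c b)) by auto.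
  reflexivity.
Qed.

Lemma tmat_form t r v : In t F ->
  sumn n (fun i => v i * sumn n (fun j => tmat t i j r * v j)) = tform t r v.
Proof.
  destruct t as [[a b] c]. intros Ht.
  destruct (tri_vertices a b c Ht) as (Ha & Hb & Hc & Hab & Hbc & Hac).
  rewrite (sumn_three n _ a b c); auto.
  - unfold tmat. rewrite !Nat.eqb_refl.
    rewrite (proj2 (Nat.eqb_neq b a)), (proj2 (Nat.eqb_neq c a)), (proj2 (Nat.eqb_neq c b)) by auto.
    rewrite !vrow_sum by auto. unfold tform, tri_form, qform3. ring.
  - intros i Na Nb Nc. unfold tmat.
    rewrite (proj2 (Nat.eqb_neq i a) Na), (proj2 (Nat.eqb_neq i b) Nb), (proj2 (Nat.eqb_neq i c) Nc).
    rewrite (sumn_ext n _ (fun _ => 0)) by (intros; ring). rewrite sumn_zero. ring.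
Qed.

Lemma tgram_pos t r : adm r -> In t F -> 0 < sqrt (tgram t r).
Proof.
  destruct t as [[a b] c]. intros Hr Ht. apply sqrt_lt_R0.
  apply (law_gram _ _ _ HG). now apply adm_ok3.
Qed.

(** Multiplying column j by [rad] cancels the factor that came from dr = rad du. What remains is a
    sum of single-triangle forms, each weighted by a positive number. *)
Lemma dcone_form r v : adm r ->
  sumn n (fun i => v i * mulv n (fun i j => -1 * (dcone i j r * rad G (r j))) v i)
  = tsum F (fun t => tform t r v / sqrt (tgram t r)).
Proof.
  intros Hr.
  transitivity (tsum F (fun t => / sqrt (tgram t r) *
     sumn n (fun i => v i * sumn n (fun j => tmat t i j r * v j)))).
  - rewrite (sumn_ext n _ (fun i => tsum F (fun t => / sqrt (tgram t r) *
       (v i * sumn n (fun j => tmat t i j r * v j))))).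
    + rewrite sumn_tsum. apply tsum_ext. intros t Ht. now rewrite sumn_scal.
    + intros i Hi. unfold mulv.
      rewrite (sumn_ext n _ (fun j => tsum F (fun t => / sqrt (tgram t r) * (tmat t i j r * v j)))).
      * rewrite sumn_tsum, tsum_scal. apply tsum_ext. intros t Ht. rewrite sumn_scal. ring.
      * intros j Hj. unfold dcone.
        replace (-1 * (tsum F (fun t => - tmat t i j r / (rad G (r j) * sqrt (tgram t r))) * rad G (r j)) * v j)
          with ((- rad G (r j) * v j) * tsum F (fun t => - tmat t i j r / (rad G (r j) * sqrt (tgram t r)))) by ring.
        rewrite tsum_scal. apply tsum_ext. intros t Ht.
        pose proof (rad_pos r j Hr Hj). pose proof (tgram_pos t r Hr Ht). field. lra.
  - apply tsum_ext. intros t Ht. rewrite tmat_form by auto. unfold Rdiv. ring.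
Qed.

End Surface.

(** * Local rigidity *)

(** If A = - P diag(rho) is positive definite, the inverse of P is - diag(rho) A^(-1). Definiteness
    is thus only required after the change of parameter. *)
Lemma inverse_function_posdef n D (f : (nat -> R) -> nat -> R) P rho x0 :
  open_n n D -> smooth_map_on n D f ->
  (forall i j x, (i < n)%nat -> (j < n)%nat -> D x ->
     derivable_pt_lim (fun t => f (upd x j t) i) (x j) (P i j x)) ->
  (forall j, (j < n)%nat -> smooth_on n D (rho j)) ->
  (forall j x, (j < n)%nat -> D x -> 0 < rho j x) ->
  (forall x, D x -> posdef n (fun i j => -1 * (P i j x * rho j x))) ->
  D x0 ->
  exists (U W : (nat -> R) -> Prop) (g : (nat -> R) -> nat -> R),
    open_n n U /\ U x0 /\ (forall y, U y -> D y) /\ open_n n W /\ W (f x0) /\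
    smooth_map_on n W g /\
    (forall y, U y -> W (f y) /\ eqn n (g (f y)) y) /\
    (forall z, W z -> U (g z) /\ eqn n (f (g z)) z).
Proof.
  intros HD Hf HP Hrs Hrp Hpos Hx0.
  destruct (posdef_smooth_inverse n D n (fun i j x => -1 * (P i j x * rho j x)) HD) as
    [C [HC [HAC HCA]]]; auto.
  { intros i j Hi Hj. apply smooth_on_mult; [apply smooth_on_const|].
    apply smooth_on_mult; auto.
    apply smooth_on_partial with (fun x => f x i) j; auto. }
  apply (inverse_function n D f P (fun i j x => -1 * (rho i x * C i j x)) x0); auto.
  - intros i j Hi Hj. apply smooth_on_mult; [apply smooth_on_const|].
    apply smooth_on_mult; auto.
  - intros x i j Hx Hi Hj. rewrite <- (HAC x i j Hx Hi Hj). apply sumn_ext. intros; ring.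
  - intros x i j Hx Hi Hj.
    pose proof (Hrp j x Hj Hx) as Hj0.
    apply Rmult_eq_reg_r with (rho j x); [|lra].
    transitivity (rho i x * kron i j).
    + rewrite <- (HCA x i j Hx Hi Hj), <- sumn_scal, Rmult_comm, <- sumn_scal.
      apply sumn_ext. intros; ring.
    + destruct (Nat.eq_dec i j) as [->|Hn]; [ring|]. rewrite kron_neq by auto. ring.
Qed.

(** The addition formulas give cos (A + B) = - cos C and sin (A + B) > 0. The sign of the sine puts
    A + B in [0, PI], where [acos] inverts [cos]. *)
Lemma angE_sum a b c : 0 < a -> 0 < b -> 0 < c -> a < b + c -> b < a + c -> c < a + b ->
  angE a b c + angE a c b + angE b c a = PI.
Proof.
  intros Ha Hb Hc T1 T2 T3.
  set (K2 := (a + b + c) * (a + b - c) * ((c + a - b) * (c + b - a)) / 4).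
  assert (PK : 0 < K2).
  { apply Rdiv_lt_0_compat; [|lra]. apply Rmult_lt_0_compat; apply Rmult_lt_0_compat; lra. }
  pose proof (sqrt_lt_R0 _ PK) as RK. set (K := sqrt K2) in *.
  assert (SK : K * K = K2) by (apply sqrt_sqrt; lra).
  (* K is twice the area, so this is the area formula for the sine of the angle between sides u and
     v. *)
  assert (Sin : forall k u v, 0 < u -> 0 < v -> 1 - k * k = K2 / ((u * v) * (u * v)) ->
     -1 <= k <= 1 /\ sin (acos k) = K / (u * v)).
  { intros k u v Hu Hv E. assert (Puv : 0 < u * v) by now apply Rmult_lt_0_compat.
    assert (0 < K2 / ((u * v) * (u * v))) by (apply Rdiv_lt_0_compat; nra).
    assert (Hk : -1 <= k <= 1) by nra. split; auto.
    rewrite sin_acos by auto. unfold Rsqr. rewrite E, sqrt_div by nra.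
    rewrite sqrt_square by lra. reflexivity. }
  unfold angE.
  set (A := (a ^ 2 + b ^ 2 - c ^ 2) / (2 * a * b)).
  set (B := (a ^ 2 + c ^ 2 - b ^ 2) / (2 * a * c)).
  set (C := (b ^ 2 + c ^ 2 - a ^ 2) / (2 * b * c)).
  destruct (Sin A a b Ha Hb) as [RA SA]; [unfold A, K2; field; lra|].
  destruct (Sin B a c Ha Hc) as [RB SB]; [unfold B, K2; field; lra|].
  pose proof (acos_bound A) as BA. pose proof (acos_bound B) as BB.
  assert (Cs : cos (acos A + acos B) = - C).
  { rewrite cos_plus, !cos_acos, SA, SB by auto.
    replace (K / (a * b) * (K / (a * c))) with (K2 / (a * b * (a * c))) by (rewrite <- SK; field; lra).
    unfold A, B, C, K2. field. lra. }
  assert (Sn : 0 < sin (acos A + acos B)).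
  { rewrite sin_plus, !cos_acos, SA, SB by auto.
    replace (K / (a * b) * B + A * (K / (a * c))) with (K / (b * c)) by (unfold A, B; field; lra).
    apply Rdiv_lt_0_compat; auto. nra. }
  assert (Hlt : acos A + acos B <= PI).
  { apply Rnot_lt_le. intros Hgt.
    assert (sin (acos A + acos B) <= 0) by (apply sin_le_0; lra). lra. }
  rewrite <- (acos_cos (acos A + acos B)) by lra.
  rewrite Cs, acos_opp. ring.
Qed.

Lemma ln_prodn n r : (forall i, (i < n)%nat -> 0 < r i) ->
  0 < prodn n r /\ ln (prodn n r) = sumn n (fun i => ln (r i)).
Proof.
  induction n as [|n IH]; intros H; simpl.
  - split; [lra|apply ln_1].
  - destruct IH as [P E]; [intros; apply H; lia|].
    pose proof (H n ltac:(lia)) as Hn. split; [now apply Rmult_lt_0_compat|].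
    rewrite ln_mult by auto. now rewrite E.
Qed.

(** f y1 and f y2 agree only up to [eqn]. That g gives them the same coordinates follows from its
    continuity. *)
Lemma local_inverse_inj n (U W : (nat -> R) -> Prop) (f g : (nat -> R) -> nat -> R) y1 y2 :
  smooth_map_on n W g -> (forall y, U y -> W (f y) /\ eqn n (g (f y)) y) ->
  U y1 -> U y2 -> eqn n (f y1) (f y2) -> eqn n y1 y2.
Proof.
  intros Hg Hgf H1 H2 E i Hi. destruct (Hgf y1 H1) as [W1 E1]. destruct (Hgf y2 H2) as [W2 E2].
  rewrite <- (E1 i Hi), <- (E2 i Hi). symmetry.
  apply (cont_on_eqn n W (fun z => g z i)); auto. apply (Ck_cont n 0), Hg, Hi.
Qed.

(** A zero of the total form is a zero of each triangle form, so v vanishes at the vertices of every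
    triangle, and every vertex lies in one. *)
Lemma hyperbolic_posdef n F I r :
  closed_tri_surface n F -> (forall i j, I i j = I j i) ->
  (forall i j, is_edge F i j -> 0 <= I i j) -> adm n F I lenH3 r ->
  posdef n (fun i j => -1 * (dcone F I hyperbolic i j r * rad hyperbolic (r j))).
Proof.
  intros HS HIsym HI Hr v [i0 [Hi0 Hv]].
  rewrite (dcone_form n F I HS HIsym HI hyperbolic lenH3 angH hyperbolic_laws r v Hr).
  assert (Ht : forall t, In t F -> 0 < sqrt (tgram I hyperbolic t r) /\
     0 <= tform I hyperbolic t r v /\
     (tform I hyperbolic t r v = 0 -> forall i, in_tri t i -> v i = 0)).
  { intros [[a b] c] Hin. split.
    - now apply (tgram_pos n F I HS HIsym HI hyperbolic lenH3 angH hyperbolic_laws).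
    - pose proof (adm_ok3 n F I HS HIsym HI hyperbolic lenH3 angH hyperbolic_laws r a b c Hr Hin) as Hok.
      pose proof (law_gram _ _ _ hyperbolic_laws _ _ _ _ _ _ Hok) as HD.
      destruct Hok as (Hx & Hy & Hz & Hp & Hq & Hw & _).
      destruct (tri_form_H (r a) (r b) (r c) (I a b) (I a c) (I b c) (v a) (v b) (v c)) as [Q Z]; auto.
      split; [exact Q|]. intros E. destruct (Z E) as (Ea & Eb & Ec).
      intros i [->|[->| ->]]; auto. }
  assert (Hnn : forall t, In t F -> 0 <= tform I hyperbolic t r v / sqrt (tgram I hyperbolic t r)).
  { intros t Hin. destruct (Ht t Hin) as (S & Q & _). apply Rmult_le_pos; auto.
    left. now apply Rinv_0_lt_compat. }
  destruct (Rle_lt_or_eq_dec _ _ (tsum_nonneg F _ Hnn)) as [|E]; auto. exfalso.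
  destruct (proj1 (proj2 (proj2 HS)) i0 Hi0) as [t [Hin Hit]].
  apply Hv. destruct (Ht t Hin) as (S & Q & Z). apply Z; auto.
  pose proof (tsum_zero F _ t Hnn (eq_sym E) Hin) as E0. cbv beta in E0.
  apply Rmult_integral in E0. destruct E0 as [E0|E0]; auto.
  pose proof (Rinv_0_lt_compat _ S). lra.
Qed.

(** The term 1 / r_j, scaled by r_j, contributes the all-ones matrix, whose form is the square of
    the sum of v. If the total vanishes, v is constant along edges, hence constant by connectedness,
    and its zero sum makes it 0. *)
Lemma euclidean_posdef n F I r :
  closed_tri_surface n F -> (forall i j, I i j = I j i) ->
  (forall i j, is_edge F i j -> 0 <= I i j) -> adm n F I lenE3 r ->
  posdef n (fun i j => -1 * ((dcone F I euclidean i j r - / r j) * r j)).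
Proof.
  intros HS HIsym HI Hr v [i0 [Hi0 Hv]].
  assert (Hp : forall j, (j < n)%nat -> 0 < r j) by apply Hr.
  assert (Split : sumn n (fun i => v i * mulv n (fun i j => -1 * ((dcone F I euclidean i j r - / r j) * r j)) v i)
    = tsum F (fun t => tform I euclidean t r v / sqrt (tgram I euclidean t r)) + sumn n v * sumn n v).
  { rewrite <- (dcone_form n F I HS HIsym HI euclidean lenE3 angE euclidean_laws r v Hr).
    rewrite <- sumn_scal, <- sumn_plus. apply sumn_ext. intros i Hi.
    rewrite (Rmult_comm (sumn n v) (v i)), <- Rmult_plus_distr_l. f_equal.
    unfold mulv. rewrite <- sumn_plus. apply sumn_ext. intros j Hj.
    specialize (Hp j Hj). cbn [rad euclidean]. field. lra. }
  rewrite Split.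
  assert (Ht : forall t, In t F -> 0 < sqrt (tgram I euclidean t r) /\
     0 <= tform I euclidean t r v /\
     (tform I euclidean t r v = 0 -> forall i j, in_tri t i -> in_tri t j -> v i = v j)).
  { intros [[a b] c] Hin. split.
    - now apply (tgram_pos n F I HS HIsym HI euclidean lenE3 angE euclidean_laws).
    - pose proof (adm_ok3 n F I HS HIsym HI euclidean lenE3 angE euclidean_laws r a b c Hr Hin) as Hok.
      pose proof (law_gram _ _ _ euclidean_laws _ _ _ _ _ _ Hok) as HD.
      destruct Hok as (Hx & Hy & Hz & Hp' & Hq & Hw & _).
      destruct (tri_form_E (r a) (r b) (r c) (I a b) (I a c) (I b c) (v a) (v b) (v c)) as [Q Z]; auto.
      split; [exact Q|]. intros E. destruct (Z E) as (Ea & Eb).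
      intros i j [->|[->| ->]] [->|[->| ->]]; congruence. }
  assert (Hnn : forall t, In t F -> 0 <= tform I euclidean t r v / sqrt (tgram I euclidean t r)).
  { intros t Hin. destruct (Ht t Hin) as (S & Q & _). apply Rmult_le_pos; auto.
    left. now apply Rinv_0_lt_compat. }
  pose proof (tsum_nonneg F _ Hnn) as Hts.
  pose proof (Rle_0_sqr (sumn n v)) as Hsq. unfold Rsqr in Hsq.
  set (T := tsum F _) in *.
  destruct (Rle_lt_or_eq_dec 0 (T + sumn n v * sumn n v)) as [|E]; [lra|auto|]. exfalso.
  assert (ET : T = 0) by lra. assert (Es : sumn n v = 0) by nra.
  assert (Hedge : forall i j, is_edge F i j -> v i = v j).
  { intros i j (_ & t & Hin & Hi & Hj). destruct (Ht t Hin) as (S & Q & Z). apply Z; auto.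
    pose proof (tsum_zero F _ t Hnn ET Hin) as E0. cbv beta in E0.
    apply Rmult_integral in E0. destruct E0 as [E0|E0]; auto.
    pose proof (Rinv_0_lt_compat _ S). lra. }
  assert (Hconn : forall i j, clos_refl_trans nat (is_edge F) i j -> v i = v j).
  { intros i j H. induction H; auto. congruence. }
  assert (Hc : forall i, (i < n)%nat -> v i = v i0).
  { intros i Hi. apply Hconn. now apply HS. }
  rewrite (sumn_ext n v (fun _ => v i0)), sumn_const in Es by auto.
  apply Rmult_integral in Es. destruct Es as [Es|Es]; auto.
  assert (0 < INR n) by (apply lt_0_INR; lia). lra.
Qed.

Lemma coneE_sum n F I r :
  closed_tri_surface n F -> (forall i j, I i j = I j i) ->
  (forall i j, is_edge F i j -> 0 <= I i j) -> admE n F I r ->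
  sumn n (coneE F I r) = PI * INR (length F).
Proof.
  intros HS HIsym HI Hr.
  change (sumn n (fun i => tsum F (fun t => angle_at angE (lenE I r) t i)) = PI * INR (length F)).
  rewrite sumn_tsum.
  assert (H : forall t, In t F -> sumn n (fun i => angle_at angE (lenE I r) t i) = PI).
  { intros [[a b] c] Hin.
    destruct (tri_vertices n F HS a b c Hin) as (Ha & Hb & Hc & Hab & Hbc & Hac).
    destruct (adm_ok3 n F I HS HIsym HI euclidean lenE3 angE euclidean_laws r a b c Hr Hin)
      as (Hx & Hy & Hz & Hp & Hq & Hw & T1 & T2 & T3).
    assert (Sym : forall i j, lenE I r i j = lenE I r j i)
      by (intros i j; unfold lenE; rewrite (HIsym i j); f_equal; ring).
    rewrite (sumn_three n _ a b c); auto.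
    - unfold angle_at. rewrite !Nat.eqb_refl.
      rewrite (proj2 (Nat.eqb_neq b a)), (proj2 (Nat.eqb_neq c a)), (proj2 (Nat.eqb_neq c b)) by auto.
      rewrite (Sym b a), (Sym c a), (Sym c b).
      change (lenE3 (r a) (r b) (I a b)) with (lenE I r a b) in *.
      change (lenE3 (r a) (r c) (I a c)) with (lenE I r a c) in *.
      change (lenE3 (r b) (r c) (I b c)) with (lenE I r b c) in *.
      apply angE_sum; try (now apply lenE3_pos); lra.
    - intros i Na Nb Nc. unfold angle_at.
      now rewrite (proj2 (Nat.eqb_neq i a) Na), (proj2 (Nat.eqb_neq i b) Nb), (proj2 (Nat.eqb_neq i c) Nc). }
  clear - H. induction F as [|t F IH]; [simpl; ring|].
  cbn [tsum fold_right length]. rewrite H by now left. rewrite S_INR.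
  fold (tsum F (fun t => sumn n (fun i => angle_at angE (lenE I r) t i))).
  rewrite IH by (intros; apply H; now right). ring.
Qed.

(** * Scaling, normalization and local inverses *)

Lemma lenE_scale I r c i j : 0 < c -> lenE I (scale c r) i j = c * lenE I r i j.
Proof.
  intros Hc. unfold lenE, scale.
  replace ((c * r i) ^ 2 + (c * r j) ^ 2 + 2 * (c * r i) * (c * r j) * I i j)
    with ((c * c) * (r i ^ 2 + r j ^ 2 + 2 * r i * r j * I i j)) by ring.
  rewrite sqrt_mult_alt by nra. rewrite sqrt_square by lra. reflexivity.
Qed.

Lemma angE_scale c x y z : 0 < c -> angE (c * x) (c * y) (c * z) = angE x y z.
Proof.
  intros Hc. unfold angE. f_equal.
  replace ((c * x) ^ 2 + (c * y) ^ 2 - (c * z) ^ 2) with ((c * c) * (x ^ 2 + y ^ 2 - z ^ 2)) by ring.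
  replace (2 * (c * x) * (c * y)) with ((c * c) * (2 * x * y)) by ring.
  unfold Rdiv. rewrite (Rinv_mult (c * c)).
  transitivity ((c * c * / (c * c)) * ((x ^ 2 + y ^ 2 - z ^ 2) * / (2 * x * y))); [ring|].
  rewrite Rinv_r by nra. ring.
Qed.

Lemma coneE_scale F I r c i : 0 < c -> coneE F I (scale c r) i = coneE F I r i.
Proof.
  intros Hc. apply (tsum_ext F (fun t => angle_at angE (lenE I (scale c r)) t i)
    (fun t => angle_at angE (lenE I r) t i)).
  intros [[a b] d] _. unfold angle_at. rewrite !lenE_scale by auto. rewrite !angE_scale by auto.
  reflexivity.
Qed.

Lemma admE_scale n F I r c : 0 < c -> admE n F I r -> admE n F I (scale c r).
Proof.
  intros Hc [Hp Ht]. split.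
  - intros i Hi. unfold scale. apply Rmult_lt_0_compat; auto.
  - intros a b d Hin. rewrite !lenE_scale by auto. destruct (Ht a b d Hin) as (T1 & T2 & T3).
    rewrite <- !Rmult_plus_distr_l. repeat split; now apply Rmult_lt_compat_l.
Qed.

(* Subtracting the logarithm of the product of the radii turns the cone angle map, whose
   differential has the scaling direction as kernel, into a map with definite differential;
   the two agree on the normalized radius vectors. *)
Definition normalized_cone (n : nat) (F : list tri) (I : nat -> nat -> R) (r : nat -> R) (i : nat) : R :=
  coneE F I r i - sumn n (fun j => ln (r j)).

Lemma normalized_cone_inverse n F I r :
  closed_tri_surface n F -> (forall i j, I i j = I j i) ->
  (forall i j, is_edge F i j -> 0 <= I i j) -> admE n F I r ->
  exists (U W : (nat -> R) -> Prop) (g : (nat -> R) -> nat -> R),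
    open_n n U /\ U r /\ (forall y, U y -> admE n F I y) /\
    open_n n W /\ W (normalized_cone n F I r) /\ smooth_map_on n W g /\
    (forall y, U y -> W (normalized_cone n F I y) /\ eqn n (g (normalized_cone n F I y)) y) /\
    (forall z, W z -> U (g z) /\ eqn n (normalized_cone n F I (g z)) z).
Proof.
  intros HS HIsym HI Hr.
  pose proof (adm_open n F I HS HIsym HI euclidean lenE3 angE euclidean_laws) as HO.
  change (open_n n (admE n F I)) in HO.
  assert (Hpos : forall x j, admE n F I x -> (j < n)%nat -> 0 < x j) by (intros x j [H _]; auto).
  apply (inverse_function_posdef n (admE n F I) (normalized_cone n F I)
    (fun i j x => dcone F I euclidean i j x - / x j) (fun j x => x j) r); auto.
  - intros i Hi. unfold normalized_cone. apply smooth_on_minus; auto.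
    + now apply (cone_smooth n F I HS HIsym HI euclidean lenE3 angE euclidean_laws).
    + apply (smooth_on_sumn n (admE n F I) n (fun j x => ln (x j))). intros j Hj.
      apply (smooth_on_comp1 n (admE n F I) (fun t => 0 < t) ln (fun x => x j));
        auto using open1_pos, smooth1_ln, smooth_on_proj.
  - intros i j x Hi Hj Hx. unfold normalized_cone.
    apply (derivable_pt_lim_minus (fun t => coneE F I (upd x j t) i)
      (fun t => sumn n (fun k => ln (upd x j t k)))).
    + now apply (cone_partial n F I HS HIsym HI euclidean lenE3 angE euclidean_laws).
    + rewrite <- (sumn_kron_l n j (fun k => / x k)) by auto.
      apply derivable_pt_lim_local with (fun t => sumn n (fun k => 1 * ln (upd x j t k))) 1;
        [lra|intros; apply sumn_ext; intros; ring|].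
      rewrite (sumn_ext n _ (fun k => 1 * (kron j k * / x k))) by (intros; ring).
      apply (derivable_pt_lim_sumn n (fun k t => ln (upd x j t k)) (fun k => kron j k * / x k) (fun _ => 1)).
      intros k Hk. destruct (Nat.eq_dec j k) as [->|Hn].
      * rewrite kron_refl, Rmult_1_l.
        apply derivable_pt_lim_local with ln 1; [lra|intros; now rewrite upd_same|].
        apply derivable_pt_lim_ln. auto.
      * rewrite kron_neq, Rmult_0_l by auto.
        apply derivable_pt_lim_local with (fun _ => ln (x k)) 1; [lra| |apply derivable_pt_lim_const].
        intros; now rewrite upd_other by auto.
  - intros. now apply smooth_on_proj.
  - intros x Hx. now apply euclidean_posdef.
Qed.

(** The inverse of [normalized_cone] also serves here. It maps the hyperplane back into the
    normalized set: summing the components of z and using the total angle PI |F| leaves n ln (prod)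
    = 0. *)
Lemma euclidean_local_diffeo n F I :
  closed_tri_surface n F -> (forall i j, I i j = I j i) ->
  (forall i j, is_edge F i j -> 0 <= I i j) ->
  local_diffeo_between n (admE n F I)
     (fun r => admE n F I r /\ prodn n r = 1)
     (fun x => sumn n x = PI * INR (length F))
     (coneE F I).
Proof.
  intros HS HIsym HI x [Hx Hx1].
  assert (Norm : forall y, admE n F I y -> prodn n y = 1 -> normalized_cone n F I y = coneE F I y).
  { intros y Hy E. destruct (ln_prodn n y) as [_ L]; [apply Hy|].
    extensionality i. unfold normalized_cone. rewrite <- L, E, ln_1. ring. }
  destruct (normalized_cone_inverse n F I x HS HIsym HI Hx)
    as (U & W & g & HU & Ux & HUD & HW & Wx & Hg & Hgf & Hfg).
  rewrite Norm in Wx by auto.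
  exists U, W, g.
  split; [|split; [|split; [|split; [|split; [|split; [|split; [|split]]]]]]]; auto.
  - intros i Hi. apply smooth_on_sub with (admE n F I); auto.
    now apply (cone_smooth n F I HS HIsym HI euclidean lenE3 angE euclidean_laws).
  - intros y Uy [Hy E]. rewrite <- (Norm y Hy E). destruct (Hgf y Uy) as [Wy Ey].
    split; [auto|split]; auto. rewrite (Norm y Hy E). now apply coneE_sum.
  - intros z Wz Nz. destruct (Hfg z Wz) as [Ug E]. pose proof (HUD _ Ug) as Hy.
    assert (P1 : prodn n (g z) = 1).
    { destruct (ln_prodn n (g z)) as [Pp L]; [apply Hy|].
      (* Dividing by n needs n > 0; for n = 0 the empty product is 1. *)
      destruct (Nat.eq_dec n 0) as [->|Hn]; [reflexivity|].
      assert (E' : sumn n (normalized_cone n F I (g z)) = sumn n z) by (apply sumn_ext; auto).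
      unfold normalized_cone in E'. rewrite sumn_minus, sumn_const in E'.
      change (sumn n (fun i => coneE F I (g z) i)) with (sumn n (coneE F I (g z))) in E'.
      rewrite (coneE_sum n F I (g z)), Nz, <- L in E' by auto.
      assert (Hn0 : 0 < INR n) by (apply lt_0_INR; lia).
      assert (L0 : INR n * ln (prodn n (g z)) = 0) by lra.
      apply Rmult_integral in L0. destruct L0 as [L0|L0]; [lra|].
      rewrite <- (exp_ln _ Pp), L0. apply exp_0. }
    split; auto. split; auto. rewrite <- (Norm _ Hy P1). exact E.
Qed.

(** A nearby x is rescaled to have the same product of radii as r. Scaling leaves the cone angles
    unchanged, so equal cone angles become equal values of [normalized_cone], which is locally
    injective. *)
Lemma euclidean_local_rigidity n F I r :
  closed_tri_surface n F -> (forall i j, I i j = I j i) ->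
  (forall i j, is_edge F i j -> 0 <= I i j) -> admE n F I r ->
  exists U : (nat -> R) -> Prop, open_n n U /\ U r /\
    forall r', U r' -> admE n F I r' -> eqn n (coneE F I r') (coneE F I r) ->
      exists c, 0 < c /\ eqn n r' (scale c r).
Proof.
  intros HS HIsym HI Hr.
  destruct (Nat.eq_dec n 0) as [->|Hn].
  { exists (fun _ => True). split; [intros x _; exists 1; split; [lra|auto]|]. split; auto.
    intros. exists 1. split; [lra|]. intros i Hi. lia. }
  assert (Hn0 : 0 < INR n) by (apply lt_0_INR; lia).
  destruct (normalized_cone_inverse n F I r HS HIsym HI Hr)
    as (U & W & g & HU & Ur & HUD & HW & Wr & Hg & Hgf & Hfg).
  pose proof (adm_open n F I HS HIsym HI euclidean lenE3 angE euclidean_laws) as HO.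
  change (open_n n (admE n F I)) in HO.
  set (S := fun x : nat -> R => sumn n (fun j => ln (x j))).
  (* The scaling factor is the n-th root of the quotient of the products of radii of r and x. *)
  set (s := fun x => exp (/ INR n * (S r - S x))).
  assert (HSs : smooth_on n (admE n F I) S).
  { apply (smooth_on_sumn n (admE n F I) n (fun j x => ln (x j))). intros j Hj.
    apply (smooth_on_comp1 n (admE n F I) (fun t => 0 < t) ln (fun x => x j));
      auto using open1_pos, smooth1_ln, smooth_on_proj. intros x [Hp _]. auto. }
  assert (Hs : cont_on n (admE n F I) s).
  { apply (cont_on_comp n (admE n F I) 1 (line (fun _ => True)) (fun y => exp (y 0%nat))
      (fun _ x => / INR n * (S r - S x))).
    - apply cont_on_derivable1 with exp. intros; apply derivable_pt_lim_exp.
    - intros i _. apply (Ck_cont n 0).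
      apply smooth_on_mult; [apply smooth_on_const|].
      apply smooth_on_minus; auto. apply smooth_on_const.
    - intros; exact Logic.I. }
  exists (fun x => admE n F I x /\ U (fun i => s x * x i)). split; [|split].
  (* The neighbourhood consists of the admissible vectors whose rescaling lies in U; it is open
     because s is continuous. *)
  - apply (open_preimage n (admE n F I) n U (fun i x => s x * x i)); auto.
    intros i Hi. apply cont_on_mult; auto. apply (Ck_cont n 0). now apply Ck_proj.
  - split; auto. replace (fun i => s r * r i) with r; auto. extensionality i.
    unfold s. rewrite Rminus_diag, Rmult_0_r, exp_0. ring.
  - intros x [_ Ux] Hx E.
    assert (Hp : forall i, (i < n)%nat -> 0 < x i) by apply Hx.
    assert (Hs0 : 0 < s x) by apply exp_pos.
    change (U (scale (s x) x)) in Ux.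
    assert (SS : S (scale (s x) x) = S r).
    { unfold S at 1. rewrite (sumn_ext n _ (fun j => ln (s x) + ln (x j))).
      - rewrite sumn_plus, sumn_const. unfold s. rewrite ln_exp. fold (S x). field. lra.
      - intros j Hj. unfold scale. apply ln_mult; auto. }
    assert (Eq : eqn n (scale (s x) x) r).
    { apply (local_inverse_inj n U W (normalized_cone n F I) g); auto.
      intros i Hi. unfold normalized_cone. fold (S (scale (s x) x)). fold (S r).
      rewrite SS, coneE_scale, (E i Hi) by auto. reflexivity. }
    exists (/ s x). split; [now apply Rinv_0_lt_compat|].
    intros i Hi. specialize (Eq i Hi). unfold scale in *. rewrite <- Eq. field. lra.
Qed.

Lemma hyperbolic_cone_inverse n F I r :
  closed_tri_surface n F -> (forall i j, I i j = I j i) ->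
  (forall i j, is_edge F i j -> 0 <= I i j) -> admH n F I r ->
  exists (U W : (nat -> R) -> Prop) (g : (nat -> R) -> nat -> R),
    open_n n U /\ U r /\ (forall y, U y -> admH n F I y) /\
    open_n n W /\ W (coneH F I r) /\ smooth_map_on n W g /\
    (forall y, U y -> W (coneH F I y) /\ eqn n (g (coneH F I y)) y) /\
    (forall z, W z -> U (g z) /\ eqn n (coneH F I (g z)) z).
Proof.
  intros HS HIsym HI Hr.
  apply (inverse_function_posdef n (admH n F I) (coneH F I)
    (dcone F I hyperbolic) (fun j x => rad hyperbolic (x j)) r); auto.
  - exact (adm_open n F I HS HIsym HI hyperbolic lenH3 angH hyperbolic_laws).
  - exact (cone_smooth n F I HS HIsym HI hyperbolic lenH3 angH hyperbolic_laws).
  - intros i j x Hi Hj Hx.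
    exact (cone_partial n F I HS HIsym HI hyperbolic lenH3 angH hyperbolic_laws x i j Hx Hj).
  - exact (rad_smooth n F I hyperbolic lenH3 angH hyperbolic_laws).
  - intros j x Hj Hx. exact (rad_pos n F I hyperbolic lenH3 angH hyperbolic_laws x j Hx Hj).
  - intros x Hx. now apply hyperbolic_posdef.
Qed.

Theorem theorem1p2 (n : nat) (F : list tri) (I : nat -> nat -> R)
  (HS : closed_tri_surface n F)
  (HIsym : forall i j, I i j = I j i)
  (HI : forall i j, is_edge F i j -> 0 <= I i j) :
  (* Euclidean case *)
  ((forall r c, admE n F I r -> 0 < c ->
      admE n F I (scale c r) /\ eqn n (coneE F I (scale c r)) (coneE F I r)) /\
   local_diffeo_between n (admE n F I)
     (fun r => admE n F I r /\ prodn n r = 1)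
     (fun x => sumn n x = PI * INR (length F))
     (coneE F I) /\
   (forall r, admE n F I r -> exists (U : (nat -> R) -> Prop), open_n n U /\ U r /\
      forall r', U r' -> admE n F I r' -> eqn n (coneE F I r') (coneE F I r) ->
        exists c, 0 < c /\ eqn n r' (scale c r))) /\
  (* Hyperbolic case *)
  (local_diffeo_between n (admH n F I) (admH n F I) (fun _ => True) (coneH F I) /\
   (forall r, admH n F I r -> exists (U : (nat -> R) -> Prop), open_n n U /\ U r /\
      forall r1 r2, U r1 -> U r2 -> admH n F I r1 -> admH n F I r2 ->
        eqn n (coneH F I r1) (coneH F I r2) -> eqn n r1 r2)).
Proof.
  split; [split; [|split]|split].
  - intros r c Hr Hc. split; [now apply admE_scale|]. intros i _. now apply coneE_scale.
  - now apply euclidean_local_diffeo.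
  - intros r Hr. now apply euclidean_local_rigidity.
  - intros r Hr. destruct (hyperbolic_cone_inverse n F I r HS HIsym HI Hr)
      as (U & W & g & HU & Ur & HUD & HW & Wr & Hg & Hgf & Hfg).
    exists U, W, g.
    split; [|split; [|split; [|split; [|split; [|split; [|split; [|split]]]]]]]; auto.
    + intros i Hi. apply smooth_on_sub with (admH n F I); auto.
      now apply (cone_smooth n F I HS HIsym HI hyperbolic lenH3 angH hyperbolic_laws).
    + intros y Uy _. destruct (Hgf y Uy). auto.
    + intros z Wz _. destruct (Hfg z Wz). auto.
  - intros r Hr. destruct (hyperbolic_cone_inverse n F I r HS HIsym HI Hr)
      as (U & W & g & HU & Ur & HUD & HW & Wr & Hg & Hgf & Hfg).
    exists U. split; auto. split; auto. intros r1 r2 U1 U2 _ _ E.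
    now apply (local_inverse_inj n U W (coneH F I) g).
Qed.
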